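(* Let $E\to M$ be a Courant algebroid, $A\subset E$ a Dirac structure, and choose a lagrangian complement of $A$, identified with $A^*$ via the pairing, so that $E=A\oplus A^*$. Let $\xi\in\Gamma(A^* )$ be compactly supported, and let $\varepsilon\in\Gamma(\wedge^2A^* )$ be a Maurer-Cartan element of the $L_\infty[1]$-algebra $\Gamma(\wedge^\bullet A^* )[2]$ governing deformations of $A$. Let $\varepsilon_t\in\Gamma(\wedge^2A^* )$ be determined by the property $$\mathrm{graph}(\varepsilon_t^\sharp)=e^{t\,ad_\xi}\,\mathrm{graph}(\varepsilon^\sharp)$$ for $t\in\mathbb R$ close enough to zero. Then $\varepsilon_t$ is the unique solution of $$\dot\varepsilon_t=-d_A\xi+[\xi,\varepsilon_t]_{A^*}+\frac12(\xi^\sharp\wedge\varepsilon_t^\sharp\wedge\varepsilon_t^\sharp)\Psi$$ satisfying $\varepsilon_0=\varepsilon$.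
   Context: A Courant algebroid over a manifold $M$ is a vector bundle $E\to M$ with a fibrewise non-degenerate symmetric bilinear form $\langle\cdot,\cdot\rangle$, an $\mathbb R$-bilinear bracket $[\![\cdot,\cdot]\!]$ on $\Gamma(E)$ and a bundle map $\rho\colon E\to TM$ (anchor) such that for all $e_1,e_2,e_3\in\Gamma(E)$, $f\in C^\infty(M)$: (C1) $[\![e_1,[\![e_2,e_3]\!]]\!]=[\![[\![e_1,e_2]\!],e_3]\!]+[\![e_2,[\![e_1,e_3]\!]]\!]$; (C2) $\rho([\![e_1,e_2]\!])=[\rho(e_1),\rho(e_2)]$; (C3) $[\![e_1,fe_2]\!]=f[\![e_1,e_2]\!]+(\rho(e_1)f)e_2$; (C4) $\rho(e_1)\langle e_2,e_3\rangle=\langle[\![e_1,e_2]\!],e_3\rangle+\langle e_2,[\![e_1,e_3]\!]\rangle$; (C5) $[\![e_1,e_1]\!]=\mathcal D\langle e_1,e_1\rangle$, where $\mathcal D=\frac12\rho^*\circ d\colon C^\infty(M)\to\Gamma(E)$, identifying $E\cong E^*$ via the pairing. A Dirac structure is a subbundle $A\subset E$ with $A^\perp=A$ which is involutive for the bracket; it is a Lie algebroid with the restricted bracket $[\cdot,\cdot]_A$ and anchor $\rho|_A$, and $d_A$ denotes its Lie algebroid differential on $\Gamma(\wedge^\bullet A^* )$. Let $K$ be a lagrangian complement of $A$, identified with $A^*$ via $u\mapsto\langle u,\cdot\rangle|_A$. Define $[\eta_1,\eta_2]_{A^*}:=pr_{A^*}([\![(0,\eta_1),(0,\eta_2)]\!])$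 for $\eta_i\in\Gamma(A^* )$, extended to $\Gamma(\wedge^\bullet A^* )$ as a graded biderivation (Schouten-type bracket, with $[\eta,f]_{A^*}=\rho(\eta)f$ for functions $f$). Let $d_{A^*}$ be the degree $1$ derivation of $\Gamma(\wedge^\bullet A)$ determined by $[\cdot,\cdot]_{A^*}$ and $\rho|_{A^*}$ (it need not square to zero). Let $\Psi\in\Gamma(\wedge^3A)$ be given by $\Psi(\eta_1,\eta_2,\cdot)=pr_A([\![(0,\eta_1),(0,\eta_2)]\!])$. With $\mathcal L$ given by Cartan's formula, the bracket of $E$ is $$[\![(a_1,\eta_1),(a_2,\eta_2)]\!]=\big([a_1,a_2]_A+\mathcal L_{\eta_1}a_2-\iota_{\eta_2}d_{A^*}a_1+\Psi(\eta_1,\eta_2,\cdot),\ [\eta_1,\eta_2]_{A^*}+\mathcal L_{a_1}\eta_2-\iota_{a_2}d_A\eta_1\big).$$ For $\alpha\in\Gamma(\wedge^\bullet A^* )$ set $\alpha^\sharp a:=\iota_a\alpha$, and $$(\alpha^\sharp\wedge\beta^\sharp\wedge\gamma^\sharp)(x_1\wedge x_2\wedge x_3)=\sum_{\sigma\in S_3}(-1)^\sigma\alpha^\sharp(x_{\sigma(1)})\wedge\beta^\sharp(x_{\sigma(2)})\wedge\gamma^\sharp(x_{\sigma(3)}).$$ For $\varepsilon\in\Gamma(\wedge^2A^* )$, $\mathrm{graph}(\varepsilon^\sharp)=\{a+\iota_a\varepsilon: a\in A\}\subset A\oplus A^*$. The $L_\infty[1]$-algebra $\Gamma(\wedge^\bullet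 A^* )[2]$ has non-trivial multibrackets $\mu_1(\alpha)=d_A\alpha$, $\mu_2(\alpha,\beta)=(-1)^{|\alpha|}[\alpha,\beta]_{A^*}$, $\mu_3(\alpha,\beta,\gamma)=-(-1)^{|\beta|}(\alpha^\sharp\wedge\beta^\sharp\wedge\gamma^\sharp)\Psi$ (shifts suppressed, $|\cdot|$ the form degree). Its Maurer-Cartan elements are the $\varepsilon\in\Gamma(\wedge^2A^* )$ with $\mu_1(\varepsilon)+\frac12\mu_2(\varepsilon,\varepsilon)+\frac16\mu_3(\varepsilon,\varepsilon,\varepsilon)=0$; equivalently, those for which $\mathrm{graph}(\varepsilon^\sharp)$ is a Dirac structure. For $\xi\in\Gamma(A^* )$ compactly supported, $ad_\xi:=[\![\xi,\cdot]\!]$ is an infinitesimal automorphism of $E$, and $e^{t\,ad_\xi}$ denotes the 1-parameter group of Courant algebroid automorphisms integrating it, i.e. on sections $\frac{d}{dt}e^{t\,ad_\xi}e=ad_\xi(e^{t\,ad_\xi}e)$. *)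

(* Defs.v *)
From HB Require Import structures.
From mathcomp Require Import all_boot all_order all_algebra all_fingroup.
From mathcomp Require Import all_classical all_reals all_analysis.

Set Implicit Arguments.
Unset Strict Implicit.
Unset Printing Implicit Defensive.

Import Order.TTheory GRing.Theory Num.Theory.
Import numFieldNormedType.Exports.

Local Open Scope classical_set_scope.
Local Open Scope ring_scope.

(** * Smooth functions between normed spaces *)

Fixpoint Ck (R : realType) (V W : normedModType R) (k : nat) (U : set V)
    (f : V -> W) : Prop :=
  match k with
  | 0 => forall x, U x -> {for x, continuous f}
  | k'.+1 => (forall x, U x -> differentiable f x) /\
             (forall v, Ck k' U (fun x => 'd f x v))
  end.

Definition Cinfty (R : realType) (V W : normedModType R) (U : set V)
    (f : V -> W) : Prop := forall k, Ck k U f.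

(** * Smooth manifolds *)

(* A chart is stored together with a total inverse; only the values of [chart]
   on [chart_dom] and of [chart_inv] on the image of [chart_dom] matter. *)
Record smooth_manifold (R : realType) := SmoothManifold {
  carrier :> topologicalType;
  mdim : nat;
  chart_idx : Type;
  chart_dom : chart_idx -> set carrier;
  chart : chart_idx -> carrier -> 'rV[R]_mdim;
  chart_inv : chart_idx -> 'rV[R]_mdim -> carrier;
  mfd_hausdorff : hausdorff_space carrier;
  mfd_second_countable : @second_countable carrier;
  chart_cover : forall x, exists i, chart_dom i x;
  chart_dom_open : forall i, open (chart_dom i);
  chart_img_open : forall i, open (chart i @` chart_dom i);
  chartK : forall i x, chart_dom i x -> chart_inv i (chart i x) = x;
  chart_continuous :
    forall i x, chart_dom i x -> {for x, continuous (chart i)};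
  chart_inv_continuous :
    forall i u, (chart i @` chart_dom i) u -> {for u, continuous (chart_inv i)};
  chart_compatible : forall i j,
    Cinfty (chart i @` (chart_dom i `&` chart_dom j)) (chart j \o chart_inv i)
}.

Section Manifold.
Variables (R : realType) (M : smooth_manifold R).

Definition smooth_in (U : set M) (f : M -> R) : Prop :=
  forall i, Cinfty (chart i @` (@chart_dom R M i `&` U)) (f \o chart_inv i).

Definition smooth (f : M -> R) : Prop := smooth_in setT f.

(* joint smoothness of (t, x) |-> f t x on J x U, for J open in R *)
Definition smooth_family_in (J : set R) (U : set M) (f : R -> M -> R) : Prop :=
  forall i, Cinfty
    [set p : R * 'rV[R]_(mdim M) |
       J p.1 /\ (chart i @` (@chart_dom R M i `&` U)) p.2]
    (fun p => f p.1 (chart_inv i p.2)).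

Definition smooth_family (J : set R) (f : R -> M -> R) : Prop :=
  smooth_family_in J setT f.

Definition smooth_map (g : M -> M) : Prop :=
  forall f, smooth f -> smooth (f \o g).

(* Tangent vectors at x are the derivations at x of the algebra of smooth
   functions; D is a total function of which only the values at smooth
   functions are used. *)
Definition is_tangent (x : M) (D : (M -> R) -> R) : Prop :=
  (forall c f g, smooth f -> smooth g ->
     D (fun y => c * f y + g y) = c * D f + D g) /\
  (forall f g, smooth f -> smooth g ->
     D (fun y => f y * g y) = f x * D g + g x * D f).

End Manifold.

(** * Vector bundles *)

(* Local trivializations are given by the corresponding local frames. *)
Record vbundle (R : realType) (M : smooth_manifold R) := VBundle {
  fiber :> M -> vectType R;
  vrank : nat;
  triv_idx : Type;
  triv_dom : triv_idx -> set M;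
  triv_frame : triv_idx -> forall x, vrank.-tuple (fiber x);
  triv_cover : forall x, exists i, triv_dom i x;
  triv_dom_open : forall i, open (triv_dom i);
  triv_frame_basis :
    forall i x, triv_dom i x -> basis_of fullv (triv_frame i x);
  triv_transition : forall i j k l, smooth_in (triv_dom i `&` triv_dom j)
    (fun x => coord (triv_frame j x) l (tnth (triv_frame i x) k))
}.

Definition sec (R : realType) (M : smooth_manifold R) (V : M -> vectType R) :=
  forall x, V x.

Section Sections.
Variables (R : realType) (M : smooth_manifold R) (E : vbundle M).

Definition smooth_sec_in (U : set M) (s : sec E) : Prop :=
  forall i l, smooth_in (@triv_dom R M E i `&` U)
    (fun x => coord (triv_frame i x) l (s x)).

Definition smooth_sec (s : sec E) : Prop := smooth_sec_in setT s.

Definition smooth_sec_family (J : set R) (s : R -> sec E) : Prop :=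
  forall i l, smooth_family_in J (@triv_dom R M E i)
    (fun t x => coord (triv_frame i x) l (s t x)).

Record subbundle := Subbundle {
  sub :> forall x, {vspace E x};
  sub_frame : forall x0, exists (U : set M) (k : nat) (s : 'I_k -> sec E),
    [/\ open U, U x0, (forall i, smooth_sec_in U (s i)) &
        forall x, U x -> basis_of (sub x) [tuple s i x | i < k]]
}.

Definition sfiber (A : subbundle) (x : M) : vectType R := subvs_of (A x).

Definition incl_sec (A : subbundle) (a : sec (sfiber A)) : sec E :=
  fun x => vsval (a x).

Definition smooth_ssec (A : subbundle) (a : sec (sfiber A)) : Prop :=
  smooth_sec (incl_sec a).

(* the projection of E x onto A x along K x *)
Definition pr (A K : subbundle) (x : M) (w : E x) : sfiber A x :=
  vsproj (A x) (daddv_pi (A x) (K x) w).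

End Sections.

(** * Exterior algebra of the dual of a vector space *)

(* An element of the (ungraded) exterior algebra of V^* is encoded by a function
   on lists of vectors, whose restriction to the lists of length k is the
   component of degree k, seen as an alternating k-linear form. *)
Section Exterior.
Variables (R : realType) (V : vectType R).
Implicit Types w : seq V -> R.

Definition alternating_form (k : nat) w : Prop :=
  [/\ forall s, size s != k -> w s = 0,
      forall s1 s2 (c : R) u v,
        w (s1 ++ (c *: u + v) :: s2) = c * w (s1 ++ u :: s2) + w (s1 ++ v :: s2)
    & forall s1 s2 s3 u, w (s1 ++ u :: s2 ++ u :: s3) = 0].

(* The sum over all (p, n - p)-shuffles: m marks the arguments given to w1, and
   the exponent is the number of inversions of the shuffle. With this
   normalization (a /\ b)(u, v) = a(u) b(v) - a(v) b(u) for 1-forms. *)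
Definition wedge w1 w2 : seq V -> R := fun s =>
  \sum_(m : (size s).-tuple bool)
    (-1) ^+ (\sum_(i < size s) \sum_(j < size s)
               [&& i < j, ~~ tnth m i & tnth m j])%N
    * w1 (mask m s) * w2 (mask (map negb m) s).

Definition iota_form (a : V) w : seq V -> R := fun s => w (a :: s).

Definition sharp_wedge3 w1 w2 w3 (x : 'I_3 -> V) : seq V -> R := fun s =>
  \sum_(g : 'S_3) (-1) ^+ g *
    wedge (wedge (iota_form (x (g 0)) w1) (iota_form (x (g 1)) w2))
          (iota_form (x (g 2)) w3) s.

(* The value at Psi of the linear map on the third exterior power of V whose
   value at x_0 /\ x_1 /\ x_2 is F x. Psi is an alternating trilinear function
   on V^*; as an element of the exterior power it is the sum over i < j < k of
   Psi(e^i, e^j, e^k) e_i /\ e_j /\ e_k, for any basis e with dual basis e^*. *)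
Definition extend_trivector (F : ('I_3 -> V) -> seq V -> R)
    (Psi : (V -> R) -> (V -> R) -> (V -> R) -> R) : seq V -> R := fun s =>
  let e := vbasis {:V} in
  \sum_(i < \dim {:V}) \sum_(j < \dim {:V} | (i < j)%N)
  \sum_(k < \dim {:V} | (j < k)%N)
    Psi (coord e i) (coord e j) (coord e k) *
    F (fun r => nth 0 [:: e`_i; e`_j; e`_k] r) s.

End Exterior.

(** * Courant algebroids *)

(* The bracket is a total function on sections, of which only the values at
   smooth sections are used. *)
Record courant (R : realType) (M : smooth_manifold R) := Courant {
  cbundle :> vbundle M;
  cpair : forall x, cbundle x -> cbundle x -> R;
  bracket : sec cbundle -> sec cbundle -> sec cbundle;
  anchor : forall x, cbundle x -> (M -> R) -> R;
  pair_sym : forall x (u v : cbundle x), cpair u v = cpair v u;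
  pair_linear : forall x (c : R) (u v w : cbundle x),
    cpair (c *: u + v) w = c * cpair u w + cpair v w;
  pair_nondegenerate : forall x (u : cbundle x),
    (forall v, cpair u v = 0) -> u = 0;
  pair_smooth : forall e1 e2 : sec cbundle, smooth_sec e1 -> smooth_sec e2 ->
    smooth (fun x => cpair (e1 x) (e2 x));
  bracket_smooth : forall e1 e2, smooth_sec e1 -> smooth_sec e2 ->
    smooth_sec (bracket e1 e2);
  bracket_linearl : forall (c : R) e1 e2 e3,
    smooth_sec e1 -> smooth_sec e2 -> smooth_sec e3 ->
    bracket (fun x => c *: e1 x + e2 x) e3
      = (fun x => c *: bracket e1 e3 x + bracket e2 e3 x);
  bracket_linearr : forall (c : R) e1 e2 e3,
    smooth_sec e1 -> smooth_sec e2 -> smooth_sec e3 ->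
    bracket e1 (fun x => c *: e2 x + e3 x)
      = (fun x => c *: bracket e1 e2 x + bracket e1 e3 x);
  anchor_tangent : forall x (u : cbundle x), is_tangent x (anchor u);
  anchor_linear : forall x (c : R) (u v : cbundle x) f, smooth f ->
    anchor (c *: u + v) f = c * anchor u f + anchor v f;
  anchor_smooth : forall (e : sec cbundle) f, smooth_sec e -> smooth f ->
    smooth (fun x => anchor (e x) f);
  courant_jacobi : forall e1 e2 e3,
    smooth_sec e1 -> smooth_sec e2 -> smooth_sec e3 ->
    bracket e1 (bracket e2 e3) = (fun x =>
      bracket (bracket e1 e2) e3 x + bracket e2 (bracket e1 e3) x);
  courant_anchor : forall e1 e2 f, smooth_sec e1 -> smooth_sec e2 -> smooth f ->
    forall x, anchor (bracket e1 e2 x) f =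
      anchor (e1 x) (fun y => anchor (e2 y) f)
      - anchor (e2 x) (fun y => anchor (e1 y) f);
  courant_leibniz : forall e1 e2 f, smooth_sec e1 -> smooth_sec e2 ->
    smooth f ->
    bracket e1 (fun x => f x *: e2 x) = (fun x =>
      f x *: bracket e1 e2 x + anchor (e1 x) f *: e2 x);
  courant_metric : forall e1 e2 e3,
    smooth_sec e1 -> smooth_sec e2 -> smooth_sec e3 ->
    forall x, anchor (e1 x) (fun y => cpair (e2 y) (e3 y)) =
      cpair (bracket e1 e2 x) (e3 x) + cpair (e2 x) (bracket e1 e3 x);
  (* D f is the section with <D f, v> = 1/2 rho(v) f for all v *)
  courant_square : forall e, smooth_sec e ->
    forall x (v : cbundle x), cpair (bracket e e x) v =
      2^-1 * anchor v (fun y => cpair (e y) (e y))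
}.

Section Courant.
Variables (R : realType) (M : smooth_manifold R) (E : courant M).

Definition is_lagrangian (A : subbundle E) : Prop :=
  forall x (v : E x), v \in A x <-> (forall w, w \in A x -> cpair v w = 0).

Definition is_involutive (A : subbundle E) : Prop :=
  forall a b : sec (sfiber A), smooth_ssec a -> smooth_ssec b ->
  forall x, bracket (incl_sec a) (incl_sec b) x \in A x.

Definition is_dirac (A : subbundle E) : Prop :=
  is_lagrangian A /\ is_involutive A.

Definition is_complement (A K : subbundle E) : Prop :=
  forall x, (A x + K x = fullv)%VS /\ (A x :&: K x = 0)%VS.

(** ** Automorphisms *)

(* A bundle automorphism covering the diffeomorphism [abase]; its fibre maps are
   indexed by the base point of their target. *)
Record automorphism := Automorphism {
  abase : M -> M;
  abase_inv : M -> M;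
  afib : forall x, 'Hom(E (abase_inv x), E x);
  push : sec E -> sec E := fun e x => afib x (e (abase_inv x));
  abaseK : cancel abase abase_inv;
  abase_invK : cancel abase_inv abase;
  abase_smooth : smooth_map abase;
  abase_inv_smooth : smooth_map abase_inv;
  afib_bij : forall x, bijective (afib x);
  push_smooth : forall e, smooth_sec e -> smooth_sec (push e);
  push_pair : forall x u v, cpair (afib x u) (afib x v) = cpair u v;
  push_bracket : forall e1 e2, smooth_sec e1 -> smooth_sec e2 ->
    push (bracket e1 e2) = bracket (push e1) (push e2);
  push_anchor : forall x u f, smooth f ->
    anchor (afib x u) f = anchor u (f \o abase)
}.

(* [Phi] is the one-parameter group of automorphisms integrating
   bracket xi : it is a smooth action of (R, +), and
   d/dt (Phi_t e) = bracket xi (Phi_t e), the derivative being taken at each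
   point in the fibre of E, by means of coordinates. *)
Record is_flow_of (xi : sec E) (Phi : R -> automorphism) : Prop := IsFlowOf {
  flow_base0 : forall x, abase (Phi 0) x = x;
  flow_baseD : forall s t x,
    abase (Phi (s + t)) x = abase (Phi s) (abase (Phi t) x);
  flow0 : forall e, smooth_sec e -> push (Phi 0) e = e;
  flowD : forall s t e, smooth_sec e ->
    push (Phi (s + t)) e = push (Phi s) (push (Phi t) e);
  flow_base_smooth : forall f, smooth f ->
    smooth_family setT (fun t => f \o abase (Phi t));
  flow_smooth : forall e, smooth_sec e ->
    smooth_sec_family setT (fun t => push (Phi t) e);
  flow_derive : forall e, smooth_sec e -> forall (t : R) x i,
    let c := coord (vbasis {:E x}) i in
    is_derive t 1 (fun s : R => c (push (Phi s) e x) : R)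
                  (c (bracket xi (push (Phi t) e) x))
}.

End Courant.

(** ** Forms on a Dirac structure with lagrangian complement *)

Definition extform (R : realType) (M : smooth_manifold R) (E : vbundle M)
    (A : subbundle E) := forall x, seq (sfiber A x) -> R.

(* [extform] unfolds to a product: automatic implicit arguments would hide the
   base point of operations with values in forms. *)
Unset Implicit Arguments.

Section Forms.
Context {R : realType} {M : smooth_manifold R} {E : courant M}.
Context {A : subbundle E} (K : subbundle E).

Definition is_form (k : nat) (w : extform A) : Prop :=
  (forall x, alternating_form k (w x)) /\
  (forall a : seq (sec (sfiber A)), (forall i, (i < size a)%N ->
     smooth_ssec (nth (fun=> 0) a i)) ->
   smooth (fun x => w x [seq b x | b <- a])).

Definition form0 (f : M -> R) : extform A :=
  fun x s => if s is [::] then f x else 0.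

(* the 1-form <u, .> on A *)
Definition flat (u : sec E) : extform A :=
  fun x s => if s is [:: a] then cpair (u x) (vsval a) else 0.

Definition fwedge (w1 w2 : extform A) : extform A :=
  fun x => wedge (w1 x) (w2 x).

(* a smooth section of A through a given vector *)
Definition extA {x : M} (v : sfiber A x) : sec (sfiber A) :=
  xget (fun=> 0) [set a : sec (sfiber A) | smooth_ssec a /\ a x = v].

(* a smooth section of K which at x represents a given linear form on A x *)
Definition extK {x : M} (h : sfiber A x -> R) : sec (sfiber K) :=
  xget (fun=> 0) [set k : sec (sfiber K) |
    smooth_ssec k /\ forall a, cpair (vsval (k x)) (vsval a) = h a].

Definition bracketA (a b : sec (sfiber A)) : sec (sfiber A) :=
  fun x => vsproj (A x) (bracket (incl_sec a) (incl_sec b) x).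

Definition del {T : Type} (i : nat) (s : seq T) : seq T :=
  take i s ++ drop i.+1 s.

(* Koszul's formula for the differential, on sections a_0, ..., a_k of A *)
Definition koszul (w : extform A) (a : seq (sec (sfiber A))) : M -> R :=
  let a_ := nth (fun=> 0) a in
  fun x =>
  \sum_(i < size a) (-1) ^+ i *
     anchor (incl_sec (a_ i) x) (fun y => w y [seq b y | b <- del i a])
  + \sum_(i < size a) \sum_(j < size a | (i < j)%N) (-1) ^+ (i + j) *
     w x [seq b x | b <- bracketA (a_ i) (a_ j) :: del i (del j a)].

(* The Lie algebroid differential of A. The value of Koszul's formula at x
   depends on the sections through their values at x only. *)
Definition dA (w : extform A) : extform A :=
  fun x s => koszul w [seq extA v | v <- s] x.

(* Psi(h1, h2, .) = pr_A [(0, h1), (0, h2)], as an element of A x *)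
Definition Psi_vec {x : M} (h1 h2 : sfiber A x -> R) : sfiber A x :=
  pr A K (bracket (incl_sec (extK h1)) (incl_sec (extK h2)) x).

Definition Psi (x : M) (h1 h2 h3 : sfiber A x -> R) : R := h3 (Psi_vec h1 h2).

(* (w1^# /\ w2^# /\ w3^#) Psi *)
Definition sharp_wedge_Psi (w1 w2 w3 : extform A) : extform A :=
  fun x => extend_trivector (sharp_wedge3 (w1 x) (w2 x) (w3 x)) (Psi x).

(* [S] is the extension to all forms, as a graded biderivation, of the bracket
   pr_{A^*} [(0, h1), (0, h2)] of sections of A^* = K and of the action of such
   sections on functions through the anchor. In the signs, p - 1 is replaced by
   p + 1, which has the same parity. *)
Record is_schouten (S : extform A -> extform A -> extform A)
  : Prop := IsSchouten {
  schouten_form : forall p q w1 w2, is_form p w1 -> is_form q w2 ->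
    is_form (p + q).-1 (S w1 w2);
  schouten_linear : forall p q w1 w2 w3 (c : R),
    is_form p w1 -> is_form q w2 -> is_form q w3 ->
    S w1 (fun x s => c * w2 x s + w3 x s)
      = (fun x s => c * S w1 w2 x s + S w1 w3 x s);
  schouten_skew : forall p q w1 w2, is_form p w1 -> is_form q w2 ->
    S w1 w2 = (fun x s => - (-1) ^+ (p.+1 * q.+1) * S w2 w1 x s);
  schouten_leibniz : forall p q r w1 w2 w3,
    is_form p w1 -> is_form q w2 -> is_form r w3 ->
    S w1 (fwedge w2 w3) = (fun x s => fwedge (S w1 w2) w3 x s
                             + (-1) ^+ (p.+1 * q) * fwedge w2 (S w1 w3) x s);
  schouten_fun : forall f g, smooth f -> smooth g ->
    S (form0 f) (form0 g) = (fun _ _ => 0);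
  schouten_anchor : forall (k : sec (sfiber K)) f, smooth_ssec k -> smooth f ->
    S (flat (incl_sec k)) (form0 f) = form0 (fun x => anchor (incl_sec k x) f);
  schouten_bracket : forall k1 k2 : sec (sfiber K),
    smooth_ssec k1 -> smooth_ssec k2 ->
    S (flat (incl_sec k1)) (flat (incl_sec k2))
      = flat (incl_sec (fun x =>
                pr K A (bracket (incl_sec k1) (incl_sec k2) x)))
}.

Section Linfty.
Variable S : extform A -> extform A -> extform A.

(* The multibrackets; the degrees of the arguments on which the signs depend are
   passed explicitly. *)
Definition mu1 (w : extform A) : extform A := dA w.
Definition mu2 (p : nat) (w1 w2 : extform A) : extform A :=
  fun x s => (-1) ^+ p * S w1 w2 x s.
Definition mu3 (q : nat) (w1 w2 w3 : extform A) : extform A :=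
  fun x s => - (-1) ^+ q * sharp_wedge_Psi w1 w2 w3 x s.

Definition is_maurer_cartan (eps : extform A) : Prop :=
  is_form 2 eps /\
  forall x s, mu1 eps x s + 2^-1 * mu2 2 eps eps x s
              + 6^-1 * mu3 2 eps eps eps x s = 0.

(* the elements a + iota_a eps, where iota_a eps is seen in K x *)
Definition form_graph (eps : extform A) (x : M) : set (E x) :=
  [set w | exists (a : sfiber A x) (k : sfiber K x),
     w = vsval a + vsval k /\
     forall b : sfiber A x,
       cpair (vsval k) (vsval b) = iota_form a (eps x) [:: b]].

Definition smooth_form_family (J : set R) (w : R -> extform A) : Prop :=
  forall a : seq (sec (sfiber A)), (forall i, (i < size a)%N ->
    smooth_ssec (nth (fun=> 0) a i)) ->
  smooth_family J (fun t x => w t x [seq b x | b <- a]).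

Definition evolution_rhs (xi : sec (sfiber K)) (w : extform A) :
    extform A := fun x s =>
  - dA (flat (incl_sec xi)) x s + S (flat (incl_sec xi)) w x s
  + 2^-1 * sharp_wedge_Psi (flat (incl_sec xi)) w w x s.

(* [w] is a smooth solution, on the open set of times J, of the evolution
   equation with initial value [eps] *)
Definition is_solution (xi : sec (sfiber K)) (eps : extform A)
    (J : set R) (w : R -> extform A) : Prop :=
  [/\ forall t, J t -> is_form 2 (w t),
      smooth_form_family J w,
      w 0 = eps
    & forall t, J t -> forall x s,
        is_derive t 1 (fun r : R => w r x s) (evolution_rhs xi (w t) x s)].

End Linfty.
End Forms.

(* Main.v *)
(* Write [e = a + iota_a w] for the elements of the graph of a 2-form [w]. The
   heart of the matter is that the right-hand side of the evolution equation,
   evaluated on [(a, c)], is [<[[xi, a + iota_a w]], c + iota_c w>]: expanding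
   this pairing, the component in [A] gives [- d_A xi], the mixed terms give
   [[xi, w]_{A^*}], and the component in [A^*] gives the [Psi] term.

   Existence: if [U_t] is the image under the flow of a section of the graph of
   [eps], then [<U_t, c> = eps_t(pr_A U_t, c)]. Solving this linear system with
   Cramer's rule shows that [eps_t] is smooth, and differentiating it in [t]
   gives the evolution equation.

   Uniqueness: if [w_t] is any solution, the functions [<U_t, b + iota_b w_t>],
   for [b] in a local frame of [A], satisfy a linear differential equation along
   the flow lines of the base. They vanish at [t = 0], hence for all times, so
   the graph of [eps_t] is contained in that of [w_t]. *)

Require Import Defs.
From HB Require Import structures.
From mathcomp Require Import all_boot all_order all_algebra all_fingroup.
From mathcomp Require Import all_classical all_reals all_analysis.
From mathcomp Require Import zify ring lra.

Set Implicit Arguments.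
Unset Strict Implicit.
Unset Printing Implicit Defensive.

Import Order.TTheory GRing.Theory Num.Theory.
Import numFieldNormedType.Exports.

Local Open Scope classical_set_scope.
Local Open Scope ring_scope.

(** * Calculus of smooth germs *)

Section Calculus.
Context {R : realType}.

(** The bracket and the operation [S] are given on global sections and forms only, so the identities
    fed to them must hold on the whole of [M]. Local frames are therefore multiplied by bump
    functions, and the frames of [A] and [K] are dual only up to a function [th]: an expansion
    computes [th] times a vector, is valid everywhere, and is divided by [th] only near the point of
    interest. The term [[xi, w]] differentiates [w] along the anchor of [xi], so the evolution
    equation is a partial differential equation, and uniqueness cannot be settled at a fixed point
    of [M]. The flow lines of the base are its characteristics: since transported sections satisfy
    d/dt = bracket with [xi], the base moves with velocity minus the anchor of [xi], and this motion
    cancels the derivative term. What remains for the defect is linear of order zero, within reach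
    of a Gronwall estimate. One frame serves only for a short time, so the vanishing is propagated
    over the whole interval by connectedness. *)

Lemma near_eq_differential (V W : normedModType R) (f g : V -> W)
    (L : {linear V -> W}) x : (\near x, f x = g x) ->
  f \o shift x = cst (f x) + L +o_ (0 : V) id ->
  g \o shift x = cst (g x) + L +o_ (0 : V) id.
Proof.
move=> fg E.
have fgx : f x = g x := nbhs_singleton fg.
have fg0 : \forall y \near (0 : V), f (y + x) = g (y + x).
  by move: fg; rewrite (near_shift 0) subr0.
apply/eqaddoE/eqaddoP => e e0.
have /eqaddoP/(_ e e0) H := E.
near=> y.
have <- : ((f \o shift x) - (cst (f x) + L)) y =
          ((g \o shift x) - (cst (g x) + L)) y.
  rewrite !fctE -fgx; congr (_ - _).
  by near: y.
by near: y.
Unshelve. all: by end_near. Qed.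

Lemma near_eq_diff (V W : normedModType R) (f g : V -> W) x :
  (\near x, f x = g x) -> differentiable f x ->
  differentiable g x /\ 'd g x = 'd f x :> (V -> W).
Proof.
move=> fg /diff_locallyP[]; move: ('d f x) => L cL E.
have {}E := near_eq_differential fg E.
have dE : 'd g x = L :> (V -> W) by exact: diff_unique.
by split => //; apply/diff_locallyP; rewrite dE.
Qed.

Section Ck_general.
Context {V W : normedModType R}.
Implicit Types (U : set V) (f g : V -> W).

Lemma Ck_sub k U U' f : U' `<=` U -> Ck k U f -> Ck k U' f.
Proof.
move=> UU'; elim: k f => [|k IH] f /=; first by move=> + x /UU'; apply.
by move=> [d c]; split => [x /UU'/d//|v]; exact: IH.
Qed.

Lemma Ck_ext k U f g : open U -> {in U, f =1 g} -> Ck k U f -> Ck k U g.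
Proof.
move=> oU; have nr (h1 h2 : V -> W) x : {in U, h1 =1 h2} -> U x ->
    \near x, h1 x = h2 x.
  move=> h12 Ux; near=> y; apply: h12; rewrite inE; near: y.
  exact: open_nbhs_nbhs.
elim: k f g => [|k IH] f g fg /=.
  move=> c x Ux; have fgx := nr _ _ _ fg Ux.
  rewrite /prop_for/continuous_at -(nbhs_singleton fgx).
  apply: cvg_trans (c x Ux); apply: near_eq_cvg.
  exact: fgx.
move=> [d c]; split => [x Ux|v].
  by have [] := near_eq_diff (nr _ _ _ fg Ux) (d x Ux).
apply: IH (c v) => x; rewrite inE => Ux.
have [_ E] := near_eq_diff (nr _ _ _ fg Ux) (d x Ux).
by rewrite E.
Unshelve. all: by end_near. Qed.

Lemma CkS k U f : Ck k.+1 U f -> Ck k U f.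
Proof.
elim: k f => [|k IH] f /= [d c].
  by move=> x Ux; exact: differentiable_continuous (d x Ux).
by split=> // v; apply: IH; exact: c.
Qed.

(** Differentiability at a point is taken in the whole space and not relative to the set, so the
    conditions at different points are independent of each other. *)
Lemma Ck_local k U f :
  (forall x, U x -> exists N, N x /\ Ck k N f) -> Ck k U f.
Proof.
elim: k f => [|k IH] f H /=.
  by move=> x /H [N [Nx]]; apply.
split=> [x /H [N [Nx []]]|v]; first by move/(_ x Nx).
by apply: IH => x /H [N [Nx [_ c]]]; exists N; split => //; exact: c.
Qed.

Lemma Ck_cst k U (c : W) : Ck k U (cst c).
Proof.
elim: k c => [|k IH] c /=; first by move=> x _; exact: cst_continuous.
split=> [x _|v]; first exact: differentiable_cst.
rewrite [X in Ck k U X](_ : _ = cst 0) //.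
by apply/funext => x; rewrite diff_cst.
Qed.

Lemma CkD k U f g : open U -> Ck k U f -> Ck k U g -> Ck k U (f + g).
Proof.
move=> oU; elim: k f g => [|k IH] f g /=.
  by move=> cf cg x Ux; apply: continuousD; [exact: cf|exact: cg].
move=> [df cf] [dg cg]; split=> [x Ux|v].
  by apply: differentiableD; [exact: df|exact: dg].
apply: (Ck_ext oU _ (IH _ _ (cf v) (cg v))) => x; rewrite inE => Ux.
by rewrite diffD ?fctE//; [exact: df|exact: dg].
Qed.

End Ck_general.

Lemma Ck_lin_outer (V W Z : normedModType R) k (U : set V) (f : V -> W)
    (L : {linear W -> Z}) : continuous L -> open U ->
  Ck k U f -> Ck k U (L \o f).
Proof.
move=> cL oU; elim: k f => [|k IH] f /=.
  by move=> c x Ux; apply: continuous_comp; [exact: c|exact: cL].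
move=> [df cf]; split=> [x Ux|v].
  by apply: differentiable_comp; [exact: df|exact: linear_differentiable].
apply: (Ck_ext oU _ (IH _ (cf v))) => x; rewrite inE => Ux.
rewrite diff_comp; [|exact: df|exact: linear_differentiable].
by rewrite /= diff_lin.
Qed.

(** The differential [L] of [a] is the same at every point, so the derivative of [f \o a] in
    direction [v] is the derivative of [f] in the fixed direction [L v], composed with [a]; the
    induction on [k] stays within such compositions. *)
Lemma Ck_affine (V W Z : normedModType R) k (U : set V) (f : V -> W)
    (a L : Z -> V) : (forall x, is_diff x a L) -> open (a @^-1` U) ->
  Ck k U f -> Ck k (a @^-1` U) (f \o a).
Proof.
move=> da oU; have daf x : differentiable a x by have [] := da x.
elim: k f => [|k IH] f /=.
  move=> c x Ux; apply: continuous_comp; last exact: c.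
  exact: differentiable_continuous.
move=> [df cf]; split=> [x Ux|v].
  by apply: differentiable_comp => //; exact: df.
apply: (Ck_ext oU _ (IH _ (cf (L v)))) => x; rewrite inE => Ux.
rewrite diff_comp //=; last exact: df.
by rewrite (@diff_val _ _ _ _ _ _ _ (da x)).
Qed.

Section Ck_real.
Context {V : normedModType R}.
Implicit Types (U : set V) (f g : V -> R).

Lemma CkM k U f g : open U -> Ck k U f -> Ck k U g -> Ck k U (f * g).
Proof.
move=> oU; elim: k f g => [|k IH] f g.
  by move=> cf cg x Ux; apply: continuousM; [exact: cf|exact: cg].
move=> cf cg; have f0 := CkS cf; have g0 := CkS cg.
case: cf cg => [df cf] [dg cg]; split=> [x Ux|v].
  by apply: differentiableM; [exact: df|exact: dg].
have H := CkD oU (IH _ _ f0 (cg v)) (IH _ _ g0 (cf v)).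
apply: (Ck_ext oU _ H) => x; rewrite inE => Ux.
by rewrite diffM ?fctE//; [exact: df|exact: dg].
Qed.

(** Induction through (1/f)' = - (1/f) (1/f) f', where 1/f is already of class [k] by the induction
    hypothesis. *)
Lemma CkV k U f : open U -> (forall x, U x -> f x != 0) ->
  Ck k U f -> Ck k U (fun x => (f x)^-1).
Proof.
move=> oU f0; elim: k => [|k IH].
  by move=> cf x Ux; apply: continuousV; [exact: f0|exact: cf].
move=> cf; have Vk := IH (CkS cf).
case: cf => [df cf]; split=> [x Ux|v].
  by apply: differentiableV; [exact: df|exact: f0].
have H := CkM oU (Ck_cst k U (-1 : R)) (CkM oU (CkM oU Vk Vk) (cf v)).
apply: (Ck_ext oU _ H) => x; rewrite inE => Ux.
rewrite diffV; [|exact: df|exact: f0].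
by rewrite !fctE /= mulN1r scaleNr expr2 invfM.
Qed.

(** In one real variable the differential of [g] is multiplication by its value at 1, so the
    derivative of the composite is a product of two functions of class [k]. *)
Lemma Ck_comp_outer k U f (g : R -> R) : open U ->
  Ck k setT g -> Ck k U f -> Ck k U (g \o f).
Proof.
move=> oU; elim: k g f => [|k IH] g f.
  by move=> cg cf x Ux; apply: continuous_comp; [exact: cf|exact: cg].
move=> [dg cg] cf; have f0 := CkS cf.
case: cf => [df cf]; split=> [x Ux|v].
  by apply: differentiable_comp; [exact: df|exact: dg].
have H := CkM oU (cf v) (IH _ _ (cg 1) f0).
apply: (Ck_ext oU _ H) => x; rewrite inE => Ux.
rewrite diff_comp; [|exact: df|exact: dg].
by rewrite /= -[X in _ = 'd g _ X]mulr1 [RHS]linearZ.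
Qed.

End Ck_real.

Lemma nbhs_open (T : topologicalType) (x : T) (P : set T) :
  nbhs x P -> exists U, [/\ open U, U x & U `<=` P].
Proof. by rewrite nbhsE => -[U [oU Ux] UP]; exists U. Qed.

(** One neighbourhood serves all orders of differentiability. Germs make it possible to divide by a
    function that is nonzero at [x] but vanishes elsewhere. *)
Definition smooth_germ {V W : normedModType R} (f : V -> W) (x : V) :=
  exists N, [/\ open N, N x & Cinfty N f].

Section Germ.
Context {V W : normedModType R}.
Implicit Types (U : set V) (f g : V -> W).

Lemma smooth_germ_Cinfty U f :
  (forall x, U x -> smooth_germ f x) -> Cinfty U f.
Proof.
move=> H k; apply: Ck_local => x /H [N [_ Nx c]].
by exists N; split => //; exact: c.
Qed.

Lemma Cinfty_smooth_germ U f (x : V) : open U -> U x -> Cinfty U f -> smooth_germ f x.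
Proof. by move=> *; exists U. Qed.

Lemma smooth_germ_ext f g (x : V) :
  (\near x, f x = g x) -> smooth_germ f x -> smooth_germ g x.
Proof.
move=> /nbhs_open[U [oU Ux fg]] [N [oN Nx c]].
exists (U `&` N); split; [exact: openI|by []|move=> k].
apply: (@Ck_ext _ _ k _ f); first exact: openI.
  by move=> y; rewrite inE => -[/fg].
by apply: Ck_sub (c k) => y [].
Qed.

Lemma smooth_germ_cst (c : W) (x : V) : smooth_germ (cst c) x.
Proof.
by exists setT; split => //; [exact: openT|move=> k; exact: Ck_cst].
Qed.

Lemma smooth_germD f g (x : V) :
  smooth_germ f x -> smooth_germ g x -> smooth_germ (f + g) x.
Proof.
move=> [N [oN Nx c]] [N' [oN' N'x c']].
exists (N `&` N'); split; [exact: openI|by []|move=> k].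
apply: CkD; first exact: openI.
  by apply: Ck_sub (c k) => y [].
by apply: Ck_sub (c' k) => y [].
Qed.

Lemma smooth_germ_lin_outer (Z : normedModType R) (L : {linear W -> Z}) f (x : V) :
  continuous L -> smooth_germ f x -> smooth_germ (L \o f) x.
Proof.
move=> cL [N [oN Nx c]]; exists N; split => // k.
exact: Ck_lin_outer.
Qed.

Lemma smooth_germ_affine (Z : normedModType R) (a L : Z -> V) f (x : Z) :
  (forall x, is_diff x a L) -> smooth_germ f (a x) -> smooth_germ (f \o a) x.
Proof.
move=> da [N [oN Nx c]]; have oaN : open (a @^-1` N).
  apply: open_comp => // y _.
  apply: differentiable_continuous; have [] := da y => //.
by exists (a @^-1` N); split => // k; exact: (Ck_affine da).
Qed.

Lemma smooth_germ_diff f (x : V) : smooth_germ f x -> differentiable f x.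
Proof. by move=> [N [_ Nx /(_ 1%N)[/(_ x Nx)]]]. Qed.

Lemma smooth_germ_continuous f (x : V) : smooth_germ f x -> {for x, continuous f}.
Proof. by move=> /smooth_germ_diff/differentiable_continuous. Qed.

End Germ.

Section Germ_real.
Context {V : normedModType R}.
Implicit Types (f g : V -> R).

Lemma smooth_germM f g (x : V) :
  smooth_germ f x -> smooth_germ g x -> smooth_germ (f * g) x.
Proof.
move=> [N [oN Nx c]] [N' [oN' N'x c']].
exists (N `&` N'); split; [exact: openI|by []|move=> k].
apply: CkM; first exact: openI.
  by apply: Ck_sub (c k) => y [].
by apply: Ck_sub (c' k) => y [].
Qed.

Lemma smooth_germV f (x : V) :
  f x != 0 -> smooth_germ f x -> smooth_germ (fun y => (f y)^-1) x.
Proof.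
move=> fx0 sf; have := smooth_germ_continuous sf; case: sf => [N [oN Nx c]] cfx.
have : \near x, f x != 0 by apply: (cvgr_neq0 (f x)); [exact: cfx|].
move=> /nbhs_open[U [oU Ux f0]].
exists (U `&` N); split; [exact: openI|by []|move=> k].
apply: CkV; first exact: openI.
  by move=> y [/f0].
by apply: Ck_sub (c k) => y [].
Qed.

Lemma smooth_germ_outer f (g : R -> R) x :
  Cinfty setT g -> smooth_germ f x -> smooth_germ (g \o f) x.
Proof.
move=> cg [N [oN Nx c]]; exists N; split => // k.
exact: Ck_comp_outer.
Qed.

End Germ_real.
End Calculus.

(** * A smooth function on the line that vanishes exactly on the closed negative half-line *)

Section FlatFunction.
Context {R : realType}.

(** The difference quotient at 0 is bounded by [C] times |h|. This serves at the one point where the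
    two pieces of [flat_fun] meet. *)
Lemma is_derive0_quadratic (f : R -> R) (C : R) :
  (forall h, `|f h| <= C * h ^+ 2) -> is_derive (0 : R) 1 f 0.
Proof.
move=> fC.
have f0 : f 0 = 0.
  by apply/eqP; rewrite -normr_le0 (le_trans (fC 0))// expr0n mulr0.
have C0 : 0 <= C by have := fC 1; rewrite expr1n mulr1; exact: le_trans.
have H : (fun h : R => h^-1 *: (f (h *: (1 : R) + 0) - f 0)) @ 0^' --> (0 : R).
  apply/cvgr0Pnorm_le => e e0.
  (* Adding 1 keeps the denominator positive when [C] is 0. *)
  have d0 : 0 < e / (C + 1) by rewrite divr_gt0// ltr_wpDl.
  near=> h.
  rewrite addr0 f0 subr0 /= [h *: 1]mulr1 normrZ normfV.
  have h0 : h != 0 by near: h; exact: nbhs_dnbhs_neq.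
  rewrite ler_pdivrMl ?normr_gt0//; apply: (le_trans (fC h)).
  rewrite -real_normK ?num_real// expr2 mulrA mulrC ler_wpM2l//.
  have : `|h| <= e / (C + 1) by near: h; exact: dnbhs0_le.
  rewrite ler_pdivlMr ?ltr_wpDl// => he.
  by apply: le_trans he; rewrite mulrC ler_wpM2l// lerDl.
by apply: DeriveDef; [apply/cvg_ex; exists 0|apply: cvg_lim].
Unshelve. all: by end_near. Qed.

(* the factor [x^-1 ^+ m] makes the family closed under differentiation *)
Definition flat_fun (m : nat) (x : R) : R :=
  if 0 < x then x^-1 ^+ m * expR (- x^-1) else 0.

Lemma flat_fun_le0 m x : x <= 0 -> flat_fun m x = 0.
Proof. by rewrite /flat_fun leNgt => /negbTE ->. Qed.

(** With y = 1/h, one term of the exponential series gives y^(m+2) <= (m+2)! e^y, that is, y^m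
    e^(-y) <= (m+2)! h^2. *)
Lemma flat_fun_quadratic m h :
  `|flat_fun m h| <= (m.+2)`!%:R * h ^+ 2.
Proof.
rewrite /flat_fun; case: ifPn => h0; last first.
  by rewrite normr0 mulr_ge0// ?ler0n// sqr_ge0.
have y0 : 0 < h^-1 by rewrite invr_gt0.
rewrite ger0_norm ?mulr_ge0 ?exprn_ge0 ?expR_ge0 ?(ltW y0)//.
rewrite expRN ler_pdivrMr ?expR_gt0//.
have F0 : 0 < (m.+2)`!%:R :> R by rewrite ltr0n fact_gt0.
have H : h^-1 ^+ m.+2 <= expR h^-1 * (m.+2)`!%:R.
  rewrite -ler_pdivrMr//; apply: le_trans (expR_ge1Dxn m.+1 (ltW y0)).
  by rewrite lerDr.
rewrite mulrAC -ler_pdivrMr ?exprn_gt0// -exprVn -exprD addn2 mulrC.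
exact: H.
Qed.

Lemma is_derive_flat_fun m (x : R) :
  is_derive x 1 (flat_fun m) (- m%:R * flat_fun m.+1 x + flat_fun m.+2 x).
Proof.
have [x0|x0|<-] := ltgtP 0 x.
- have xn0 : x != 0 by rewrite gt_eqF.
  apply: (@near_eq_is_derive _ _ _ (fun y : R => y^-1 ^+ m * expR (- y^-1))).
    near=> y; rewrite /flat_fun ifT//; near: y.
    by apply: open_nbhs_nbhs; split => //; exact: open_gt.
  have dV : is_derive x 1 (fun y : R => y^-1) (- x ^- 2).
    have := @is_deriveV R id x 1 1 xn0 _.
    by rewrite /GRing.scale/= mulr1; apply; exact: is_derive_id.
  have dE : is_derive x 1 (fun y : R => expR (- y^-1)) (x ^- 2 * expR (- x^-1)).
    have := @is_derive1_comp R expR (fun y => - y^-1) x _ _ (is_derive_expR _)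
      (is_deriveN dV).
    by rewrite opprK mulrC.
  rewrite /flat_fun x0.
  case: m => [|m].
    rewrite mulr0n oppr0 mul0r add0r.
    rewrite (_ : (fun y => _) = (fun y : R => expR (- y^-1))).
      by rewrite exprVn.
    by apply/funext => y; rewrite expr0 mul1r.
  have dX := @is_deriveX _ _ (fun y : R => y^-1) m.+1 x 1 _ dV.
  rewrite (_ : (fun y => _) =
    ((fun y : R => y^-1) ^+ m.+1 * (fun y : R => expR (- y^-1)))); last first.
    by apply/funext => y; rewrite fctE exprfctE.
  apply: (is_derive_eq (is_deriveM dX dE)).
  rewrite ?fctE /GRing.scale /= /=.
  rewrite -exprVn; move: (x^-1) => y; rewrite !exprS expr0; ring.
- rewrite !(flat_fun_le0 _ (ltW x0)) mulr0 addr0.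
  apply: (near_eq_is_derive _ (is_derive_cst (0 : R) x (1 : R))).
  near=> y; rewrite flat_fun_le0//; apply: ltW; near: y.
  by apply: open_nbhs_nbhs; split => //; exact: open_lt.
- rewrite !flat_fun_le0// mulr0 addr0.
  exact: is_derive0_quadratic (flat_fun_quadratic m).
Unshelve. all: by end_near. Qed.

(** The derivative of [flat_fun m] involves [flat_fun m.+1] and [flat_fun m.+2], so the induction on
    [k] has to treat all [m] at once. *)
Lemma flat_fun_smooth m : Cinfty setT (flat_fun m).
Proof.
move=> k; elim: k m => [|k IH] m.
  move=> x _; apply: differentiable_continuous.
  by apply/derivable1_diffP; have [] := is_derive_flat_fun m x.
have dm x : differentiable (flat_fun m) x.
  by apply/derivable1_diffP; have [] := is_derive_flat_fun m x.
split=> [x _|v]; first exact: dm.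
have -> : (fun x => 'd (flat_fun m) x v) =
    cst v * (cst (- m%:R) * flat_fun m.+1 + flat_fun m.+2).
  apply/funext => x; rewrite diff1E// derive1E.
  by have [_ ->] := is_derive_flat_fun m x.
apply: CkM; [exact: openT|exact: Ck_cst|].
by apply: CkD; [exact: openT|apply: CkM; [exact: openT|exact: Ck_cst|]|].
Qed.

Lemma flat_fun0_neq0 x : (flat_fun 0 x != 0) = (0 < x).
Proof.
rewrite /flat_fun; case: ifP; rewrite ?eqxx// => _.
by rewrite expr0 mul1r gt_eqF// expR_gt0.
Qed.

End FlatFunction.

(** * Smooth functions and bump functions on a manifold *)

Lemma is_diff_snd (R : realType) (V W : normedModType R) (p : V * W) :
  is_diff p (snd : V * W -> W) snd.
Proof.
pose L : {linear (V * W)%type -> W} := snd.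
have cL : continuous L by move=> q; exact: cvg_snd.
rewrite -[X in is_diff _ X _]/(L : _ -> _).
apply: DiffDef; first exact: linear_differentiable.
by rewrite diff_lin.
Qed.

Section SmoothFamilies.
Context {R : realType} {M : smooth_manifold R}.
Implicit Types (f g : R -> M -> R) (t : R) (x : M).

(* Time-independent functions are treated as constant families. *)
Definition smooth_fam_at f t x := forall i, @chart_dom R M i x ->
  smooth_germ (fun p : R * 'rV[R]_(mdim M) => f p.1 (chart_inv i p.2))
    (t, chart i x).

Lemma chart_image_open (i : chart_idx M) (U : set M) :
  open U -> open (chart i @` (chart_dom i `&` U)).
Proof.
move=> oU.
have -> : chart i @` (chart_dom i `&` U) =
    (chart i @` chart_dom i) `&` (chart_inv i @^-1` U).
  apply/seteqP; split => [u [x [dx Ux] <-]|u [[x dx <-]]].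
    by split; [exists x|rewrite /= chartK].
  by rewrite /= chartK// => Ux; exists x.
rewrite openE => u [Vu Uu]; apply: filterI.
  by apply: open_nbhs_nbhs; split => //; exact: chart_img_open.
apply: (chart_inv_continuous Vu : {for u, continuous (chart_inv i : _ -> M)}).
exact: open_nbhs_nbhs.
Qed.

Lemma smooth_family_in_fam_at (J : set R) (U : set M) f t x :
  open J -> open U -> smooth_family_in J U f -> J t -> U x ->
  smooth_fam_at f t x.
Proof.
move=> oJ oU sf Jt Ux i dx.
apply: (Cinfty_smooth_germ _ _ (sf i)); last by split => //; exists x.
have oV := @chart_image_open i _ oU.
rewrite [X in open X](_ : _ =
  (fst @^-1` J) `&` (snd @^-1` (chart i @` (chart_dom i `&` U)))); last first.
  by apply/seteqP; split.
apply: openI; apply: open_comp => //= p _; first exact: cvg_fst.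
exact: cvg_snd.
Qed.

Lemma fam_at_smooth_family_in (J : set R) (U : set M) f :
  (forall t x, J t -> U x -> smooth_fam_at f t x) -> smooth_family_in J U f.
Proof.
move=> H i; apply: smooth_germ_Cinfty => -[t u] /= [Jt [x [dx Ux] <-]].
exact: H.
Qed.

Lemma smooth_fam_at_slice (U : set M) f t :
  (forall x, U x -> smooth_fam_at f t x) -> smooth_in U (f t).
Proof.
move=> H i; apply: smooth_germ_Cinfty => u [x [dx Ux] <-].
have := H x Ux i dx.
pose a (u : 'rV[R]_(mdim M)) : R * 'rV[R]_(mdim M) := (t, u).
have da y : is_diff y a (fun v => (0, v)).
  exact: (is_diff_pair (is_diff_cst t y) (is_diff_id y)).
move=> /(smooth_germ_affine (a := a)); apply; exact: da.
Qed.

Lemma smooth_in_fam_at (U : set M) (f : M -> R) t x :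
  open U -> smooth_in U f -> U x -> smooth_fam_at (fun=> f) t x.
Proof.
move=> oU sf Ux i dx.
have : smooth_germ (f \o chart_inv i) (chart i x).
  by apply: (Cinfty_smooth_germ (@chart_image_open i _ oU) _ (sf i)); exists x.
have da (y : R * 'rV[R]_(mdim M)) : is_diff y snd snd := is_diff_snd y.
by move=> /(smooth_germ_affine (a := snd) (x := (t, chart i x)) da).
Qed.

Lemma smooth_fam_atP (f : M -> R) :
  smooth f <-> forall x, smooth_fam_at (fun=> f) 0 x.
Proof.
split=> [sf x|H]; first exact: smooth_in_fam_at openT sf _.
by apply: (@smooth_fam_at_slice _ (fun=> f) 0) => x _; exact: H.
Qed.

Lemma smooth_fam_at_const (f : M -> R) t x :
  smooth f -> smooth_fam_at (fun=> f) t x.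
Proof. by move=> sf; exact: smooth_in_fam_at openT sf _. Qed.

Lemma smooth_fam_at_ext f g t x :
  (\forall p \near (t, x), f p.1 p.2 = g p.1 p.2) ->
  smooth_fam_at f t x -> smooth_fam_at g t x.
Proof.
move=> fg sf i dx; apply: smooth_germ_ext (sf i dx).
have c : (fun p : R * 'rV[R]_(mdim M) => (p.1, chart_inv i p.2)) p
    @[p --> (t, chart i x)] --> (t, x).
  apply: (@cvg_pair _ _ _ _ (nbhs t) (nbhs x)); first exact: cvg_fst.
  have ci : {for chart i x, continuous (chart_inv i : _ -> M)}.
    by apply: chart_inv_continuous; exists x.
  rewrite /= -[X in _ --> nbhs X](chartK dx).
  exact: (@cvg_comp _ _ _ snd (chart_inv i : _ -> M) _ (nbhs (chart i x))
    _ (@cvg_snd _ _ _ _ _) ci).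
exact: c _ fg.
Qed.

Lemma smooth_fam_at_cst (c : R) t x : smooth_fam_at (fun _ _ => c) t x.
Proof. by move=> i dx; exact: smooth_germ_cst. Qed.

Lemma smooth_fam_atD f g t x : smooth_fam_at f t x -> smooth_fam_at g t x ->
  smooth_fam_at (fun t x => f t x + g t x) t x.
Proof. by move=> sf sg i dx; apply: smooth_germD; [exact: sf|exact: sg]. Qed.

Lemma smooth_fam_atM f g t x : smooth_fam_at f t x -> smooth_fam_at g t x ->
  smooth_fam_at (fun t x => f t x * g t x) t x.
Proof. by move=> sf sg i dx; apply: smooth_germM; [exact: sf|exact: sg]. Qed.

Lemma smooth_fam_atV f t x : f t x != 0 -> smooth_fam_at f t x ->
  smooth_fam_at (fun t x => (f t x)^-1) t x.
Proof.
move=> f0 sf i dx; apply: smooth_germV; last exact: sf.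
by rewrite /= chartK.
Qed.

Lemma smooth_fam_atN f t x : smooth_fam_at f t x ->
  smooth_fam_at (fun t x => - f t x) t x.
Proof.
move=> sf; have := smooth_fam_atM (@smooth_fam_at_cst (-1) t x) sf.
by apply: smooth_fam_at_ext; near=> p; rewrite mulN1r.
Unshelve. all: by end_near. Qed.

Lemma smooth_fam_at_sum (I : Type) (r : seq I) (P : pred I)
    (F : I -> R -> M -> R) t x :
  (forall i, P i -> smooth_fam_at (F i) t x) ->
  smooth_fam_at (fun t x => \sum_(i <- r | P i) F i t x) t x.
Proof.
move=> H; elim: r => [|a r IH].
  apply: smooth_fam_at_ext (@smooth_fam_at_cst 0 t x).
  by near=> p; rewrite big_nil.
have [Pa|nPa] := boolP (P a).
  apply: smooth_fam_at_ext (smooth_fam_atD (H a Pa) IH).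
  by near=> p; rewrite big_cons Pa.
apply: smooth_fam_at_ext IH.
by near=> p; rewrite big_cons (negbTE nPa).
Unshelve. all: by end_near. Qed.

Lemma smooth_fam_at_prod (I : Type) (r : seq I) (P : pred I)
    (F : I -> R -> M -> R) t x :
  (forall i, P i -> smooth_fam_at (F i) t x) ->
  smooth_fam_at (fun t x => \prod_(i <- r | P i) F i t x) t x.
Proof.
move=> H; elim: r => [|a r IH].
  apply: smooth_fam_at_ext (@smooth_fam_at_cst 1 t x).
  by near=> p; rewrite big_nil.
have [Pa|nPa] := boolP (P a).
  apply: smooth_fam_at_ext (smooth_fam_atM (H a Pa) IH).
  by near=> p; rewrite big_cons Pa.
apply: smooth_fam_at_ext IH.
by near=> p; rewrite big_cons (negbTE nPa).
Unshelve. all: by end_near. Qed.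

Lemma smooth_fam_at_continuous f t x : smooth_fam_at f t x ->
  {for (t, x), continuous (fun p : R * M => f p.1 p.2)}.
Proof.
move=> sf; have [i dx] := chart_cover x.
have := smooth_germ_continuous (sf i dx).
rewrite /prop_for /continuous_at /= chartK// => c.
have cc : (fun p : R * M => (p.1, chart i p.2)) p @[p --> (t, x)] -->
    (t, chart i x).
  apply: (@cvg_pair _ _ _ _ (nbhs t) (nbhs (chart i x))); first exact: cvg_fst.
  have ci : {for x, continuous (chart i : M -> _)} by exact: chart_continuous.
  exact: (@cvg_comp _ _ _ snd (chart i : M -> _) _ (nbhs x)
    _ (@cvg_snd _ _ _ _ _) ci).
apply: cvg_trans (cvg_comp _ _ cc c).
apply: near_eq_cvg.
have : \forall p \near (t, x), chart_dom i p.2.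
  have : open_nbhs x (chart_dom i) by split => //; exact: chart_dom_open.
  move=> /open_nbhs_nbhs.
  exact: (@cvg_snd _ _ (nbhs t) (nbhs x)).
by move=> H; near=> p; rewrite /= chartK//; near: p.
Unshelve. all: by end_near. Qed.

Lemma smooth_fam_at_det n (F : R -> M -> 'M[R]_n) t x :
  (forall i j, smooth_fam_at (fun t x => F t x i j) t x) ->
  smooth_fam_at (fun t x => \det (F t x)) t x.
Proof.
move=> H; apply: smooth_fam_at_sum => s _; apply: smooth_fam_atM.
  exact: smooth_fam_at_cst.
by apply: smooth_fam_at_prod => i _; exact: H.
Qed.

Lemma smooth_fam_at_adj n (F : R -> M -> 'M[R]_n) t x :
  (forall i j, smooth_fam_at (fun t x => F t x i j) t x) ->
  forall i j, smooth_fam_at (fun t x => (\adj (F t x)) i j) t x.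
Proof.
move=> H i j; apply: (@smooth_fam_at_ext (fun t x =>
  (-1) ^+ (j + i) * \det (row' j (col' i (F t x))))).
  by near=> p; rewrite mxE.
apply: smooth_fam_atM; first exact: smooth_fam_at_cst.
apply: (@smooth_fam_at_det n.-1 (fun t x => row' j (col' i (F t x)))) => k l.
apply: smooth_fam_at_ext (H (lift j k) (lift i l)).
by near=> p; rewrite !mxE.
Unshelve. all: by end_near. Qed.

End SmoothFamilies.

(** * Bump functions *)

Section Bump.
Context {R : realType} {M : smooth_manifold R}.

Lemma near_snd (P : set M) (t : R) (x : M) :
  nbhs x P -> \forall p \near (t, x), P p.2.
Proof. exact: (@cvg_snd _ _ (nbhs t) (nbhs x)). Qed.

Lemma chart_coord_smooth (i : chart_idx M) k t (y : M) :
  chart_dom i y -> smooth_fam_at (fun=> (fun x => chart i x 0 k)) t y.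
Proof.
move=> dy j djy.
have : smooth_germ (chart i \o chart_inv j : 'rV[R]_(mdim M) -> _) (chart j y).
  apply: (Cinfty_smooth_germ _ _ (chart_compatible j i)).
    by apply: chart_image_open; exact: chart_dom_open.
  by exists y.
pose L (u : 'rV[R]_(mdim M)) : R := u 0 k.
have linL : linear L by move=> c u v; rewrite /L !mxE.
pose LM := GRing.isLinear.Build _ _ _ _ _ linL.
pose LL : {linear 'rV[R]_(mdim M) -> R} := HB.pack L LM.
have cL : continuous LL by exact: coord_continuous.
move=> /(smooth_germ_lin_outer cL).
exact: (smooth_germ_affine (x := (t, chart j y)) (@is_diff_snd R R _)).
Qed.

Lemma smooth_fam_at_outer (g : R -> R) (f : R -> M -> R) t x :
  Cinfty setT g -> smooth_fam_at f t x ->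
  smooth_fam_at (fun t x => g (f t x)) t x.
Proof. by move=> cg sf i dx; exact: smooth_germ_outer (sf i dx). Qed.

(** In a chart, [phi] is the product over the coordinates of [flat_fun 0] at q^2 - (u_k - c_k)^2,
    supported in a closed ball of the sup norm. The image [C] of this ball is compact, hence closed
    because [M] is Hausdorff, and this makes the extension by zero smooth outside the chart. *)
Lemma smooth_bump (x0 : M) (U : set M) : open U -> U x0 ->
  exists (phi : M -> R) (C : set M),
    [/\ smooth phi, phi x0 != 0, closed C, C `<=` U &
        forall x, ~ C x -> phi x = 0].
Proof.
move=> oU Ux0; have [i di] := chart_cover x0.
pose c := chart i x0.
have : nbhs c (chart i @` (chart_dom i `&` U)).
  by apply: open_nbhs_nbhs; split; [exact: chart_image_open|exists x0].
move=> /nbhs_ballP[r /= r0 rV].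
pose q := r / 2.
have q0 : 0 < q by rewrite divr_gt0.
pose B := closed_ball c q.
have BE : B = [set u | `|c - u| <= q] by rewrite /B closed_ballE.
have Br u : B u -> (chart i @` (chart_dom i `&` U)) u.
  rewrite BE /= => uq; apply: rV; rewrite -ball_normE /=.
  by apply: le_lt_trans uq _; rewrite /q ltr_pdivrMr// ltr_pMr// ltr1n.
have cB : compact B.
  apply: bounded_closed_compact; last exact: closed_ball_closed.
  exists (`|c| + q); split; first exact: num_real.
  move=> y ly u; rewrite BE /= => uq; apply: ltW; apply: le_lt_trans ly.
  have -> : u = c - (c - u) by rewrite opprB addrC subrK.
  by rewrite (le_trans (ler_normB _ _))// lerD2l.
pose C : set M := chart_inv i @` B.
have clC : closed C.
  apply: compact_closed; first exact: mfd_hausdorff.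
  apply: continuous_compact => //; apply: continuous_in_subspaceT => u.
  rewrite inE => /Br[x [dx _] <-]; apply: chart_inv_continuous.
  by exists x.
have CU : C `<=` chart_dom i `&` U.
  by move=> _ [u /Br[x xU <-] <-]; rewrite chartK//; case: xU.
pose phi0 (x : M) := \prod_(k < mdim M)
  flat_fun 0 (q ^+ 2 - (chart i x 0 k - c 0 k) ^+ 2).
pose phi (x : M) := if `[< chart_dom i x >] then phi0 x else 0.
have phiC x : ~ C x -> phi x = 0.
  move=> nCx; rewrite /phi; case: asboolP => // dx.
  apply/eqP; rewrite /phi0 prodf_seq_eq0; apply: contrapT => /negP.
  rewrite -all_predC => /allP H; apply: nCx; exists (chart i x).
    (* The norm of a row vector is the maximum of its entries, so it is enough to bound each
       coordinate. *)
    rewrite BE /= /Num.Def.normr /= mx_normrE (bigmax_le _ (ltW q0))//= => -[a b] _.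
    rewrite !mxE /= ord1.
    have := H b; rewrite mem_index_enum => /(_ isT) /=.
    rewrite flat_fun0_neq0 subr_gt0 => h.
    rewrite distrC -(@ler_pXn2r _ 2) ?nnegrE// ?(ltW q0)//.
    by rewrite real_normK ?num_real// ltW.
  by rewrite chartK.
exists phi, C; split => //; last by move=> x /CU[].
- apply/smooth_fam_atP => y.
  have [dy|ndy] := pselect (chart_dom i y).
    apply: (@smooth_fam_at_ext _ _ (fun=> phi0)).
      have : nbhs y (chart_dom i).
        by apply: open_nbhs_nbhs; split => //; exact: chart_dom_open.
      by move=> /(near_snd 0) H; near=> p; rewrite /phi asboolT//; near: p.
    apply: smooth_fam_at_prod => k _; apply: smooth_fam_at_outer.
      exact: flat_fun_smooth.
    apply: smooth_fam_atD; first exact: smooth_fam_at_cst.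
    apply: smooth_fam_atN.
    have h : smooth_fam_at (fun=> fun x : M => chart i x 0 k - c 0 k) 0 y.
      apply: smooth_fam_atD; first exact: chart_coord_smooth.
      exact: smooth_fam_at_cst.
    exact: (smooth_fam_atM h h).
  apply: smooth_fam_at_ext (@smooth_fam_at_cst _ _ 0 0 y).
  have : nbhs y (~` C).
    by apply: open_nbhs_nbhs; split; [exact: closed_openC|move=> /CU[]].
  by move=> /(near_snd 0) H; near=> p; rewrite phiC//; near: p.
- rewrite /phi asboolT// prodf_seq_neq0; apply/allP => k _ /=.
  by rewrite subrr expr0n/= subr0 flat_fun0_neq0 exprn_gt0.
Unshelve. all: by end_near. Qed.

End Bump.

(** * Smooth sections and local frames *)

Section BundleSections.
Context {R : realType} {M : smooth_manifold R} {E : vbundle M}.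
Implicit Types (s : R -> sec E) (t : R) (x : M).

Definition smooth_sec_at s t x := forall i l, triv_dom i x ->
  smooth_fam_at (fun t x => coord (triv_frame i x) l (s t x)) t x.

Lemma smooth_sec_in_at (U : set M) (s : sec E) t x :
  open U -> smooth_sec_in U s -> U x -> smooth_sec_at (fun=> s) t x.
Proof.
move=> oU ss Ux i l dx; apply: (smooth_in_fam_at _ _ (ss i l)) => //.
by apply: openI => //; exact: triv_dom_open.
Qed.

Lemma smooth_sec_atP (s : sec E) :
  smooth_sec s <-> forall x, smooth_sec_at (fun=> s) 0 x.
Proof.
split=> [ss x|H i l]; first exact: smooth_sec_in_at openT ss _.
apply: (@smooth_fam_at_slice _ _ _
  (fun _ x => coord (triv_frame i x) l (s x)) 0) => x [dx _].
exact: H.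
Qed.

Lemma smooth_sec_at_const (s : sec E) t x :
  smooth_sec s -> smooth_sec_at (fun=> s) t x.
Proof. by move=> ss; exact: smooth_sec_in_at openT ss _. Qed.

Lemma smooth_sec_family_at (J : set R) s t x :
  open J -> smooth_sec_family J s -> J t -> smooth_sec_at s t x.
Proof.
move=> oJ ss Jt i l dx; apply: (smooth_family_in_fam_at oJ _ (ss i l)) => //.
exact: triv_dom_open.
Qed.

Lemma smooth_sec_at_ext (s1 s2 : R -> sec E) t x :
  (\forall p \near (t, x), s1 p.1 p.2 = s2 p.1 p.2) ->
  smooth_sec_at s1 t x -> smooth_sec_at s2 t x.
Proof.
move=> s12 ss i l dx; apply: smooth_fam_at_ext (ss i l dx).
by near=> p; congr (coord _ _ _); near: p.
Unshelve. all: by end_near. Qed.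

Lemma smooth_sec_at0 t x : smooth_sec_at (fun _ _ => 0) t x.
Proof.
move=> i l dx; apply: smooth_fam_at_ext (@smooth_fam_at_cst _ _ 0 t x).
by near=> p; rewrite linear0.
Unshelve. all: by end_near. Qed.

Lemma smooth_sec_atD (s1 s2 : R -> sec E) t x :
  smooth_sec_at s1 t x -> smooth_sec_at s2 t x ->
  smooth_sec_at (fun t x => s1 t x + s2 t x) t x.
Proof.
move=> h1 h2 i l dx.
apply: smooth_fam_at_ext (smooth_fam_atD (h1 i l dx) (h2 i l dx)).
by near=> p; rewrite linearD.
Unshelve. all: by end_near. Qed.

Lemma smooth_sec_atZ (f : R -> M -> R) s t x :
  smooth_fam_at f t x -> smooth_sec_at s t x ->
  smooth_sec_at (fun t x => f t x *: s t x) t x.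
Proof.
move=> h1 h2 i l dx.
apply: smooth_fam_at_ext (smooth_fam_atM h1 (h2 i l dx)).
by near=> p; rewrite linearZ.
Unshelve. all: by end_near. Qed.

Lemma smooth_sec_at_sum (I : Type) (r : seq I) (P : pred I)
    (F : I -> R -> sec E) t x :
  (forall i, P i -> smooth_sec_at (F i) t x) ->
  smooth_sec_at (fun t x => \sum_(i <- r | P i) F i t x) t x.
Proof.
move=> H; elim: r => [|a r IH].
  apply: smooth_sec_at_ext (@smooth_sec_at0 t x).
  by near=> p; rewrite big_nil.
have [Pa|nPa] := boolP (P a).
  apply: smooth_sec_at_ext (smooth_sec_atD (H a Pa) IH).
  by near=> p; rewrite big_cons Pa.
apply: smooth_sec_at_ext IH.
by near=> p; rewrite big_cons (negbTE nPa).
Unshelve. all: by end_near. Qed.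

Lemma smooth_secD (s1 s2 : sec E) : smooth_sec s1 -> smooth_sec s2 ->
  smooth_sec (fun x => s1 x + s2 x).
Proof.
move=> h1 h2; apply/smooth_sec_atP => x.
by apply: (@smooth_sec_atD (fun=> s1) (fun=> s2)); exact: smooth_sec_at_const.
Qed.

Lemma smooth_secZ (f : M -> R) (s : sec E) : smooth f -> smooth_sec s ->
  smooth_sec (fun x => f x *: s x).
Proof.
move=> h1 h2; apply/smooth_sec_atP => x.
apply: (@smooth_sec_atZ (fun=> f) (fun=> s)).
  exact: smooth_fam_at_const.
exact: smooth_sec_at_const.
Qed.

Lemma smooth_sec_cstZ (c : R) (s : sec E) : smooth_sec s ->
  smooth_sec (fun x => c *: s x).
Proof.
by apply: smooth_secZ; apply/smooth_fam_atP => x; exact: smooth_fam_at_cst.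
Qed.

Lemma smooth_sec0 : smooth_sec (fun x => 0 : E x).
Proof. by apply/smooth_sec_atP => x; exact: smooth_sec_at0. Qed.

Lemma smooth_sec_sum (I : Type) (r : seq I) (P : pred I) (F : I -> sec E) :
  (forall i, P i -> smooth_sec (F i)) ->
  smooth_sec (fun x => \sum_(i <- r | P i) F i x).
Proof.
move=> H; apply/smooth_sec_atP => x.
apply: (@smooth_sec_at_sum _ r P (fun i _ => F i)) => i Pi.
exact: smooth_sec_at_const (H i Pi).
Qed.

Lemma smooth_sec_bump (phi : M -> R) (C U : set M) (s : sec E) :
  smooth phi -> open U -> closed C -> C `<=` U ->
  (forall x, ~ C x -> phi x = 0) -> smooth_sec_in U s ->
  smooth_sec (fun x => phi x *: s x).
Proof.
move=> sphi oU cC CU phi0 ss; apply/smooth_sec_atP => x.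
have [Ux|nUx] := pselect (U x).
  apply: (@smooth_sec_atZ (fun=> phi) (fun=> s)).
    exact: smooth_fam_at_const.
  exact: smooth_sec_in_at oU ss Ux.
apply: smooth_sec_at_ext (@smooth_sec_at0 0 x).
have : nbhs x (~` C).
  by apply: open_nbhs_nbhs; split; [exact: closed_openC|move=> /CU].
by move=> /(near_snd 0) H; near=> p; rewrite phi0 ?scale0r//; near: p.
Unshelve. all: by end_near. Qed.

(* [b] is a local frame multiplied by a cutoff [phi]. *)
Lemma subbundle_global_frame (A : subbundle E) (x0 : M) :
  exists (phi : M -> R) (n : nat) (b : 'I_n -> sec E),
  [/\ smooth phi, phi x0 != 0,
      forall i, smooth_sec (b i) /\ (forall x, b i x \in A x),
      forall x, phi x != 0 -> basis_of (A x) [tuple b i x | i < n] &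
      forall x i, phi x = 0 -> b i x = 0].
Proof.
have [U [n [s [oU Ux0 ss bs]]]] := sub_frame A x0.
have [phi [C [sphi phi0 cC CU phiC]]] := smooth_bump oU Ux0.
have phiU x : phi x != 0 -> U x.
  move=> h; apply: CU; apply: contrapT => /phiC h0.
  by rewrite h0 eqxx in h.
exists phi, n, (fun i x => phi x *: s i x); split => //.
- move=> i; split; first exact: (smooth_sec_bump sphi oU cC CU phiC (ss i)).
  move=> x; have [->|h] := eqVneq (phi x) 0; first by rewrite scale0r mem0v.
  rewrite memvZ// (basis_mem (bs x (phiU x h)))//.
  by apply/tnthP; exists i; rewrite tnth_mktuple.
- move=> x h; have := bs x (phiU x h); rewrite !basisEfree => /and3P[f sA d].
  apply/and3P; split.
  + apply/freeP => k kE i; move/freeP: f => /(_ (fun i => k i * phi x)) f.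
    apply/eqP; rewrite -(mulIr_eq0 _ (mulIf h)); apply/eqP; apply: f.
    rewrite -[RHS]kE; apply: eq_bigr => j _.
    by rewrite !(nth_mktuple) scalerA.
  + apply/subvP => v; move: v; apply/subvP/span_subvP => v /tnthP[i ->].
    rewrite tnth_mktuple memvZ// (subvP sA)// memv_span//.
    by apply/tnthP; exists i; rewrite tnth_mktuple.
  + by move: d; rewrite !size_tuple.
- by move=> x i ->; rewrite scale0r.
Qed.

Lemma subbundle_sec_through (A : subbundle E) (x0 : M) (v : E x0) :
  v \in A x0 ->
  exists s : sec E, [/\ smooth_sec s, forall x, s x \in A x & s x0 = v].
Proof.
have [phi [n [b [sphi p0 sb bb _]]]] := subbundle_global_frame A x0.
move=> vA; have B := bb _ p0.
have vE := coord_basis B vA.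
exists (fun x => \sum_i coord [tuple b i x0 | i < n] i v *: b i x); split.
- apply: smooth_sec_sum => i _; apply: smooth_sec_cstZ; exact: (sb i).1.
- by move=> x; apply: memv_suml => i _; rewrite memvZ//; exact: (sb i).2.
- by rewrite [RHS]vE; apply: eq_bigr => i _; rewrite nth_mktuple.
Qed.

Lemma full_sub_frame (x0 : M) : exists (U : set M) (k : nat) (s : 'I_k -> sec E),
  [/\ open U, U x0, (forall i, smooth_sec_in U (s i)) &
      forall x, U x -> basis_of fullv [tuple s i x | i < k]].
Proof.
have [i dx] := triv_cover E x0.
exists (triv_dom i), (vrank E), (fun k x => tnth (triv_frame i x) k); split => //.
- exact: triv_dom_open.
- by move=> k j l; rewrite setIC; exact: triv_transition.
- move=> x Ux; rewrite (_ : [tuple _ | i < _] = triv_frame i x).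
    exact: triv_frame_basis.
  by apply/eq_from_tnth => k; rewrite tnth_mktuple.
Qed.

(** [E] as a subbundle of itself, so that sections through arbitrary vectors of [E] come from the
    construction for subbundles. *)
Definition full_subbundle : subbundle E :=
  @Subbundle R M E (fun x => fullv) full_sub_frame.

Lemma sec_through (x0 : M) (v : E x0) :
  exists s : sec E, smooth_sec s /\ s x0 = v.
Proof.
have [s [ss _ sv]] := @subbundle_sec_through full_subbundle x0 v (memvf v).
by exists s.
Qed.

End BundleSections.

(** * Lagrangian splittings and dual frames *)

Section CourantBasics.
Context {R : realType} {M : smooth_manifold R} {E : courant M}.

Section Pairing.
Context {x : M}.
Implicit Types u v w : E x.

Lemma pairDl u v w : cpair (u + v) w = cpair u w + cpair v w.
Proof. by rewrite -[u]scale1r pair_linear mul1r scale1r. Qed.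

Lemma pair0l w : cpair (0 : E x) w = 0.
Proof. by apply: (@addrI _ (cpair 0 w)); rewrite -pairDl !addr0. Qed.

Lemma pairZl c u w : cpair (c *: u) w = c * cpair u w.
Proof. by rewrite -[c *: u]addr0 pair_linear pair0l addr0. Qed.

Lemma pairDr u v w : cpair w (u + v) = cpair w u + cpair w v.
Proof. by rewrite pair_sym pairDl !(pair_sym _ w). Qed.

Lemma pairZr c u w : cpair w (c *: u) = c * cpair w u.
Proof. by rewrite pair_sym pairZl (pair_sym u). Qed.

Lemma pair0r w : cpair w (0 : E x) = 0.
Proof. by rewrite pair_sym pair0l. Qed.

Lemma pairNl u w : cpair (- u) w = - cpair u w.
Proof. by rewrite -scaleN1r pairZl mulN1r. Qed.

Lemma pair_suml (I : Type) (r : seq I) (P : pred I) (F : I -> E x) w :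
  cpair (\sum_(i <- r | P i) F i) w = \sum_(i <- r | P i) cpair (F i) w.
Proof.
apply: (big_morph (fun u => cpair u w)); last exact: pair0l.
by move=> u v; rewrite pairDl.
Qed.

Lemma pair_sumr (I : Type) (r : seq I) (P : pred I) (F : I -> E x) w :
  cpair w (\sum_(i <- r | P i) F i) = \sum_(i <- r | P i) cpair w (F i).
Proof. by rewrite pair_sym pair_suml; apply: eq_bigr => i _; rewrite pair_sym. Qed.

Lemma pair_inj u v : (forall w, cpair u w = cpair v w) -> u = v.
Proof.
move=> uv; apply/eqP; rewrite -subr_eq0; apply/eqP.
by apply: pair_nondegenerate => w; rewrite pairDl pairNl uv subrr.
Qed.

End Pairing.

(** [pair_smooth] speaks of global sections that do not depend on time. Both families are expanded
    in a frame of [E] cut off by [phi]: the coefficients carry the time dependence, and the two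
    cutoffs are divided out near [x]. *)
Lemma pair_smooth_at (s1 s2 : R -> sec E) t x :
  smooth_sec_at s1 t x -> smooth_sec_at s2 t x ->
  smooth_fam_at (fun t x => cpair (s1 t x) (s2 t x)) t x.
Proof.
move=> h1 h2; have [i dx] := triv_cover E x.
have [phi [C [sphi phi0 cC CU phiC]]] :=
  smooth_bump (@triv_dom_open _ _ E i) dx.
pose fr k (y : M) := phi y *: tnth (triv_frame i y) k : E y.
have sfr k : smooth_sec (fr k).
  apply: (smooth_sec_bump sphi (@triv_dom_open _ _ E i) cC CU phiC).
  by move=> j l; rewrite setIC; exact: triv_transition.
have phi0t : smooth_fam_at (fun=> phi) t x by exact: smooth_fam_at_const.
have inv : smooth_fam_at (fun _ y => (phi y)^-1 * (phi y)^-1) t x.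
  by apply: smooth_fam_atM; exact: smooth_fam_atV.
have pk k l : smooth_fam_at (fun _ y => cpair (fr k y) (fr l y)) t x.
  by apply: smooth_fam_at_const; exact: pair_smooth.
have H : smooth_fam_at (fun r y => \sum_k \sum_l
    ((coord (triv_frame i y) k (s1 r y) * coord (triv_frame i y) l (s2 r y)) *
     ((phi y)^-1 * (phi y)^-1 * cpair (fr k y) (fr l y)))) t x.
  apply: smooth_fam_at_sum => k _; apply: smooth_fam_at_sum => l _.
  apply: smooth_fam_atM; first exact: smooth_fam_atM (h1 i k dx) (h2 i l dx).
  exact: smooth_fam_atM inv (pk k l).
apply: smooth_fam_at_ext H.
have nd : nbhs x (triv_dom i).
  by apply: open_nbhs_nbhs; split => //; exact: triv_dom_open.
have Hd := near_snd t nd.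
have Hp : \forall p \near (t, x), phi p.2 != 0.
  have := smooth_fam_at_continuous phi0t => c.
  exact: (cvgr_neq0 (phi x) c phi0).
near=> p.
have dp : triv_dom i p.2 by near: p.
have pp : phi p.2 != 0 by near: p.
have B := triv_frame_basis dp.
rewrite [in RHS](coord_basis B (memvf (s1 p.1 p.2))) pair_suml.
apply: eq_bigr => k _; rewrite pairZl.
rewrite [in RHS](coord_basis B (memvf (s2 p.1 p.2))) pair_sumr mulr_sumr.
apply: eq_bigr => l _; rewrite pairZr /fr pairZl pairZr !(tnth_nth 0).
by field.
Unshelve. all: by end_near. Qed.

Section SplitSection.
Context {A K : subbundle E}.
Hypotheses (lagA : is_lagrangian A) (lagK : is_lagrangian K).
Hypothesis (hAK : is_complement A K).

Lemma lag_pair0 (L : subbundle E) x (u v : E x) : is_lagrangian L ->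
  u \in L x -> v \in L x -> cpair u v = 0.
Proof. by move=> lagL uL vL; apply: (lagL x u).1. Qed.

(** A vector orthogonal to [A x] lies in [A x], which meets [K x] in 0. Equalities between vectors
    of [K] are tested on [A] by this. *)
Lemma complement_pair0 x (u : E x) :
  u \in K x -> (forall a, a \in A x -> cpair u a = 0) -> u = 0.
Proof.
move=> uK h; have [_ cap] := hAK x; apply/eqP; rewrite -memv0 -cap memv_cap uK andbT.
exact/lagA.
Qed.

Lemma complement_pair0A x (u : E x) :
  u \in A x -> (forall a, a \in K x -> cpair u a = 0) -> u = 0.
Proof.
move=> uA h; have [_ cap] := hAK x; apply/eqP; rewrite -memv0 -cap memv_cap uA.
exact/lagK.
Qed.

(** The projections take values in [E x] rather than in the subspace types, so that they can be
    added and paired without coercions. *)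
Definition pA {x} (u : E x) : E x := daddv_pi (A x) (K x) u.
Definition pK {x} (u : E x) : E x := daddv_pi (K x) (A x) u.

Lemma capAK x : (A x :&: K x = 0)%VS. Proof. by have [] := hAK x. Qed.
Lemma capKA x : (K x :&: A x = 0)%VS. Proof. by rewrite capvC capAK. Qed.

Lemma pA_mem x (u : E x) : pA u \in A x.
Proof. exact: memv_pi. Qed.
Lemma pK_mem x (u : E x) : pK u \in K x.
Proof. exact: memv_pi. Qed.
Lemma pApK x (u : E x) : pA u + pK u = u.
Proof. by apply: daddv_pi_add; rewrite ?capAK// (hAK x).1 memvf. Qed.
Lemma pA_id x (u : E x) : u \in A x -> pA u = u.
Proof. by move=> uA; apply: daddv_pi_id => //; exact: capAK. Qed.
Lemma pK_id x (u : E x) : u \in K x -> pK u = u.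
Proof. by move=> uA; apply: daddv_pi_id => //; exact: capKA. Qed.
Lemma pA_K x (u : E x) : u \in K x -> pA u = 0.
Proof. by move=> uK; apply: (addIr (pK u)); rewrite pApK pK_id// add0r. Qed.
Lemma pAD x (u v : E x) : pA (u + v) = pA u + pA v. Proof. exact: linearD. Qed.
Lemma pAN x (u : E x) : pA (- u) = - pA u. Proof. exact: linearN. Qed.
Lemma pair_pA x (u k : E x) : k \in K x -> cpair (pA u) k = cpair u k.
Proof.
move=> kK; rewrite -{2}(pApK u) pairDl (lag_pair0 lagK (pK_mem u) kK).
by rewrite addr0.
Qed.
Lemma pair_pK x (u a : E x) : a \in A x -> cpair (pK u) a = cpair u a.
Proof.
move=> aA; rewrite -{2}(pApK u) pairDl (lag_pair0 lagA (pA_mem u) aA).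
by rewrite add0r.
Qed.

(* the Gram matrix of bases of [A x] and [K x] has free rows *)
Lemma represent_basis x n (b : n.-tuple (E x)) (h : 'I_n -> R) :
  basis_of (A x) b ->
  exists2 k, k \in K x & forall i, cpair k (tnth b i) = h i.
Proof.
move=> B; pose e := vbasis (K x).
pose G : 'M[R]_(n, \dim (K x)) := \matrix_(i, j) cpair (tnth b i) (tnth e j).
have bA i : tnth b i \in A x by apply: (basis_mem B); exact: mem_tnth.
have eK j : tnth e j \in K x by apply: vbasis_mem; exact: mem_tnth.
have rf : row_free G.
  apply/row_freeP; apply/row_freeP; rewrite -kermx_eq0; apply/eqP/row_matrixP => i.
  rewrite row0; have : row i (kermx G) *m G = 0.
    by apply/eqP; rewrite -sub_kermx row_sub.
  move: (row i (kermx G)) => r rG.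
  (* A relation between the rows of [G] is a vector of [A x] that pairs to 0 with all of [K x]. *)
  pose a := \sum_j r 0 j *: tnth b j.
  have aA : a \in A x by apply: memv_suml => j _; rewrite memvZ.
  have a0 : a = 0.
    apply: complement_pair0A => // k kK.
    rewrite (coord_basis (vbasisP (K x)) kK) pair_sumr big1// => j _.
    rewrite pairZr -tnth_nth pair_suml.
    have /matrixP/(_ 0 j) := rG; rewrite [LHS]mxE [RHS]mxE => H.
    rewrite (eq_bigr (fun i => r 0 i * G i j)) ?H ?mulr0//.
    by move=> l _; rewrite pairZl mxE.
  apply/rowP => j; rewrite mxE.
  have /freeP := basis_free B; apply.
  rewrite -[RHS]a0; apply: eq_bigr => l _.
  by rewrite -tnth_nth.
(* Free rows of [G] mean full rank of the transpose, whose row space therefore contains the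
   prescribed values [h]. *)
have rfull : row_full G^T by rewrite /row_full mxrank_tr.
have /submxP[c cE] := submx_full (\row_i h i) rfull.
exists (\sum_j c 0 j *: tnth e j); first by apply: memv_suml => j _; rewrite memvZ.
move=> i; have /matrixP/(_ 0 i) := cE; rewrite !mxE => ->.
rewrite pair_suml; apply: eq_bigr => j _.
by rewrite pairZl !mxE pair_sym.
Qed.

(** The expansions hold on all of [M], including the points where [th] vanishes and the frames may
    degenerate; duality itself is recorded at [x0], where [th] is nonzero. *)
Record dual_frame (x0 : M) n (b k : 'I_n -> sec E) (th : M -> R) : Prop :=
  DualFrame {
    df_smooth : smooth th;
    df_neq0 : th x0 != 0;
    df_smoothA : forall i, smooth_sec (b i);
    df_smoothK : forall i, smooth_sec (k i);
    df_memA : forall i x, b i x \in A x;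
    df_memK : forall i x, k i x \in K x;
    df_decompA : forall x (a : E x), a \in A x ->
      th x *: a = \sum_l cpair a (k l x) *: b l x;
    df_decompK : forall x (u : E x), u \in K x ->
      th x *: u = \sum_l cpair u (b l x) *: k l x;
    df_dual : forall i j, cpair (b i x0) (k j x0) = th x0 *+ (i == j) }.

(* With [G] the Gram matrix of frames of A and K, replacing the frame of A by
   its product with [\adj G] makes the frames dual up to the factor [\det G],
   without dividing. *)
Lemma exists_dual_frame x0 : exists n (b k : 'I_n -> sec E) th,
  dual_frame x0 b k th.
Proof.
have [phi [n [b [sphi p0 sb bb b0]]]] := subbundle_global_frame A x0.
(* Duality to [b] is imposed at [x0] alone; it makes the Gram matrix the identity there, so [th x0]
   equals [phi x0]. *)
have /choice[k kP] : forall j : 'I_n, exists s : sec E,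
    [/\ smooth_sec s, forall x, s x \in K x &
        forall i, cpair (s x0) (b i x0) = (i == j)%:R].
  move=> j; have [v vK vE] := represent_basis (fun i => (i == j)%:R) (bb _ p0).
  have [s [ss sK sv]] := subbundle_sec_through vK.
  exists s; split => // i; rewrite sv -vE; congr cpair.
  by rewrite tnth_mktuple.
pose G x : 'M[R]_n := \matrix_(i, j) cpair (b i x) (k j x).
pose b' (l : 'I_n) (x : M) : E x := phi x *: \sum_m (\adj (G x)) l m *: b m x.
pose th x := phi x * \det (G x).
have sG i j : smooth (fun x => G x i j).
  have [+ _ _] := kP j => skj; have := pair_smooth (sb i).1 skj.
  by congr smooth; apply/funext => x; rewrite mxE.
have sGat t x i j : smooth_fam_at (fun=> (fun x => G x i j)) t x.
  by apply: smooth_fam_at_const.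
have decA x (a : E x) : a \in A x ->
    th x *: a = \sum_l cpair a (k l x) *: b' l x.
  (* Where the cutoff vanishes both sides are 0; elsewhere [b] gives a basis of [A x]. *)
  move=> aA; have [z|z] := eqVneq (phi x) 0.
    rewrite /th z mul0r scale0r big1// => l _.
    by rewrite /b' z scale0r scaler0.
  have aE := coord_basis (bb _ z) aA.
  pose c i := coord [tuple b i x | i < n] i a.
  have {}aE : a = \sum_i c i *: b i x.
    by rewrite {1}aE; apply: eq_bigr => i _; rewrite -tnth_nth tnth_mktuple.
  have pE l : cpair a (k l x) = \sum_m c m * G x m l.
    by rewrite {1}aE pair_suml; apply: eq_bigr => m _; rewrite pairZl mxE.
  transitivity (phi x *: \sum_q (\sum_m c m * (G x *m \adj (G x)) m q) *: b q x).
    rewrite /th -scalerA; congr (_ *: _); rewrite {1}aE scaler_sumr.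
    apply: eq_bigr => q _; rewrite scalerA; congr (_ *: _).
    rewrite mul_mx_adj (bigD1 q)//= big1 ?addr0; last first.
      by move=> m mq; rewrite mxE (negbTE mq) mulr0.
    by rewrite mxE eqxx mulr1n mulrC.
  rewrite /b' [RHS](eq_bigr (fun l => phi x *:
      \sum_q (cpair a (k l x) * (\adj (G x)) l q) *: b q x)); last first.
    move=> l _ /=; rewrite !scaler_sumr; apply: eq_bigr => q _.
    by rewrite !scalerA mulrCA mulrA.
  rewrite -scaler_sumr; congr (_ *: _).
  rewrite [RHS]exchange_big; apply: eq_bigr => q _ /=.
  rewrite -scaler_suml; congr (_ *: _).
  rewrite [RHS](eq_bigr (fun l => \sum_m c m * G x m l * (\adj (G x)) l q)); last first.
    by move=> l _; rewrite pE mulr_suml.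
  rewrite [RHS]exchange_big; apply: eq_bigr => m _ /=.
  by rewrite mxE mulr_sumr; apply: eq_bigr => l _; rewrite mulrA.
have sphi1 t x : smooth_fam_at (fun=> phi) t x by exact: smooth_fam_at_const.
have G1 : G x0 = 1%:M.
  apply/matrixP => i j; rewrite !mxE pair_sym; have [_ _ ->] := kP j.
  by [].
have b'A i x : b' i x \in A x.
  rewrite memvZ// memv_suml// => m _; rewrite memvZ//; exact: (sb m).2.
exists n, b', k, th; split.
- apply/smooth_fam_atP => x; apply: (smooth_fam_atM (sphi1 _ _)).
  by apply: (smooth_fam_at_det (F := fun _ x => G x)) => i j.
- by rewrite /th G1 det1 mulr1.
- move=> i; apply: smooth_secZ => //; apply: smooth_sec_sum => m _.
  apply: smooth_secZ; last exact: (sb m).1.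
  apply/smooth_fam_atP => x.
  by apply: (smooth_fam_at_adj (F := fun _ x => G x)).
- by move=> i; have [] := kP i.
- exact: b'A.
- by move=> i; have [] := kP i.
- exact: decA.
(* The expansion in [K] is dual to the one in [A]: it is tested by pairing with vectors of [A],
   which are expanded by [decA]. *)
- move=> x u uK; apply/eqP; rewrite -subr_eq0; apply/eqP.
  have kK l : k l x \in K x by have [] := kP l.
  apply: complement_pair0.
    by rewrite memvB ?memvZ// memv_suml// => l _; rewrite memvZ.
  move=> a aA; rewrite pairDl pairNl pairZl -pairZr decA// pair_sumr pair_suml.
  apply/eqP; rewrite subr_eq0; apply/eqP; apply: eq_bigr => l _.
  by rewrite pairZr pairZl mulrC (pair_sym a).
- move=> i j; have adj1 : \adj (G x0) = 1%:M.
    by rewrite G1 -[LHS]mul1mx mul_mx_adj det1.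
  rewrite /b' /th adj1 G1 det1 mulr1 pairZl pair_suml.
  rewrite (bigD1 i)//= big1 => [|m mi]; last first.
    by rewrite mxE eq_sym (negbTE mi) scale0r pair0l.
  rewrite mxE eqxx scale1r addr0 pair_sym; have [_ _ ->] := kP j.
  by rewrite mulr_natr.
Qed.

End SplitSection.
End CourantBasics.

(** * Exterior algebra *)

Section WedgeAlgebra.
Context {R : realType} {V : vectType R}.
Implicit Types (w : seq V -> R) (s : seq V).

(** Only the shuffle that gives every argument to [w2] contributes, and it has no inversions. *)
Lemma wedge0l w1 w2 s : (forall s, s != [::] -> w1 s = 0) ->
  wedge w1 w2 s = w1 [::] * w2 s.
Proof.
move=> w10; rewrite /wedge; pose m0 := nseq_tuple (size s) false.
have m0E i : tnth m0 i = false by rewrite (tnth_nth false) nth_nseq if_same.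
rewrite (bigD1 m0)//= [X in _ + X]big1 => [|m mm0].
  rewrite big1 => [|i _]; last by rewrite big1// => j _; rewrite !m0E !andbF.
  by rewrite expr0 mul1r addr0 mask_false map_nseq mask_true.
rewrite (w10 (mask m s)) ?mulr0 ?mul0r//.
apply: contraNneq mm0 => ms.
have : size (mask m s) = 0%N by rewrite ms.
rewrite size_mask ?size_tuple// => /eqP; rewrite -leqn0 leqNgt -has_count => nh.
apply/eqP/eq_from_tnth => i; rewrite m0E; apply/negbTE.
apply: (contra _ nh) => mi; apply/hasP; exists (tnth m i); first exact: mem_tnth.
exact: mi.
Qed.

Lemma wedge_degree p q w1 w2 s : (forall s, size s != p -> w1 s = 0) ->
  (forall s, size s != q -> w2 s = 0) -> size s != (p + q)%N ->
  wedge w1 w2 s = 0.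
Proof.
move=> h1 h2 ss; rewrite /wedge big1// => m _.
have : (size (mask m s) + size (mask (map negb m) s))%N = size s.
  rewrite !size_mask ?size_map ?size_tuple// count_map.
  by rewrite -[RHS](size_tuple m) -(count_predC id m).
have [e1|n1 _] := eqVneq (size (mask m s)) p; last by rewrite h1// mulr0 mul0r.
have [e2 e|n2 _] := eqVneq (size (mask (map negb m) s)) q.
  by exfalso; move/eqP: ss; apply; rewrite -e e1 e2.
by rewrite h2// mulr0.
Qed.

Lemma big_tuple2_bool (F : 2.-tuple bool -> R) :
  \sum_m F m = F [tuple true; true] + F [tuple true; false] +
    (F [tuple false; true] + F [tuple false; false]).
Proof.
rewrite (reindex (fun p : bool * bool => [tuple p.1; p.2])) /=; last first.
  exists (fun t : 2.-tuple bool => (tnth t 0, tnth t 1)) => [[a b] _|t _] //.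
  apply/eq_from_tnth => i; case: (unliftP ord0 i) => [j ->|->] //.
  by rewrite !(tnth_nth false) ord1.
rewrite -(pair_bigA _ (fun a b => F [tuple a; b])) /=.
by rewrite big_bool !big_bool.
Qed.

Lemma wedge11 w1 w2 u v : (forall s, size s != 1%N -> w1 s = 0) ->
  wedge w1 w2 [:: u; v] = w1 [:: u] * w2 [:: v] - w1 [:: v] * w2 [:: u].
Proof.
move=> h1; rewrite /wedge big_tuple2_bool /=.
rewrite (h1 [:: u; v])// (h1 [::])// !mulr0 !mul0r add0r addr0.
rewrite !big_ord_recl !big_ord0 /=.
by rewrite ?addn0 ?add0n expr0 expr1 mul1r mulN1r mulNr.
Qed.

(** The left side is the determinant of the matrix of [H]; Laplace expansion replaces an enumeration
    of the permutations. *)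
Lemma sum_perm3 (H : 'I_3 -> 'I_3 -> R) :
  \sum_(g : 'S_3) (-1) ^+ g * (H 0 (g 0) * H 1 (g 1) * H 2%:R (g 2%:R)) =
  H 0 0 * H 1 1 * H 2%:R 2%:R - H 0 0 * H 1 2%:R * H 2%:R 1
  - H 0 1 * H 1 0 * H 2%:R 2%:R + H 0 1 * H 1 2%:R * H 2%:R 0
  + H 0 2%:R * H 1 0 * H 2%:R 1 - H 0 2%:R * H 1 1 * H 2%:R 0.
Proof.
pose A : 'M[R]_3 := \matrix_(i, j) H i j.
transitivity (\det A).
  apply: eq_bigr => g _; congr (_ * _).
  rewrite !big_ord_recl big_ord0 mulr1 !mxE mulrA.
  by congr (_ * H _ (g _) * H _ (g _)); apply/val_inj.
rewrite (expand_det_row _ 0) !big_ord_recl big_ord0 /cofactor.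
rewrite !(expand_det_row _ 0) !big_ord_recl !big_ord0 /cofactor.
rewrite !det_mx11 !mxE.
(* Indexing by natural numbers identifies nested lifts of ordinals that have the same value, so that
   [ring] sees them as one entry. *)
pose h a b := H (inord a) (inord b).
have HE i j : H i j = h (val i) (val j) by rewrite /h !inord_val.
rewrite !HE /= /bump /= ?addn0 ?add0n ?expr0 ?expr1.
rewrite -[(1 + 1)%N]/2%N sqrrN expr1n.
by ring.
Qed.

Section SkewSum.
Variables (n : nat).
Let S3 (X : 'I_n -> 'I_n -> 'I_n -> R) := \sum_i \sum_j \sum_k X i j k.

Let S3_23 X : S3 (fun i j k => X i k j) = S3 X.
Proof. by apply: eq_bigr => i _; rewrite exchange_big. Qed.

Let S3_12 X : S3 (fun i j k => X j i k) = S3 X.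
Proof. by rewrite /S3 exchange_big. Qed.

Let S3_231 X : S3 (fun i j k => X j k i) = S3 X.
Proof. by rewrite (S3_12 (fun i j k => X i k j)) S3_23. Qed.

Let S3_312 X : S3 (fun i j k => X k i j) = S3 X.
Proof. by rewrite (S3_23 (fun i j k => X j i k)) S3_12. Qed.

Let S3_321 X : S3 (fun i j k => X k j i) = S3 X.
Proof. by rewrite (S3_12 (fun i j k => X k i j)) S3_312. Qed.

(** The skew [T] vanishes on triples with a repeated index, and a triple of distinct indices is
    increasing in exactly one of its six orders. The value at a trivector is defined by a sum over
    increasing triples, while the later contractions need free indices. *)
Lemma sum_skew3 (T F : 'I_n -> 'I_n -> 'I_n -> R) :
  (forall i j k, T i j k = - T j i k) -> (forall i j k, T i j k = - T i k j) ->
  \sum_(i < n) \sum_(j < n | (i < j)%N) \sum_(k < n | (j < k)%N)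
     T i j k * (F i j k - F i k j - F j i k + F j k i + F k i j - F k j i)
  = \sum_(i < n) \sum_(j < n) \sum_(k < n) T i j k * F i j k.
Proof.
move=> T12 T23; pose c (i j k : 'I_n) : R := ((i < j)%N && (j < k)%N)%:R.
pose G i j k := T i j k * F i j k.
have diag (a : R) : a = - a -> a = 0.
  by move=> e; lra.
have T12_0 i k : T i i k = 0 by apply: diag; exact: T12.
have T23_0 i k : T i k k = 0 by apply: diag; exact: T23.
have T13_0 i k : T i k i = 0 by rewrite T12 T23_0 oppr0.
have cG i j k : G i j k = c i j k * G i j k + c i k j * G i j k
   + c j i k * G i j k + c j k i * G i j k + c k i j * G i j k
   + c k j i * G i j k.
  rewrite -!mulrDl /c.
  have [/val_inj->|ij] := eqVneq (val i) (val j).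
    by rewrite /G T12_0 !mul0r mulr0.
  have [/val_inj->|jk] := eqVneq (val j) (val k).
    by rewrite /G T23_0 !mul0r mulr0.
  have [/val_inj->|ik] := eqVneq (val i) (val k).
    by rewrite /G T13_0 !mul0r mulr0.
  move: ij jk ik => /=; rewrite -[LHS]mul1r.
  case: (ltngtP i j) => //; case: (ltngtP j k) => //; case: (ltngtP i k) => //=;
    rewrite ?addr0 ?add0r // => *; exfalso; lia.
transitivity (S3 G); last by [].
transitivity (S3 (fun i j k => c i j k * G i j k + c i k j * G i j k
   + c j i k * G i j k + c j k i * G i j k + c k i j * G i j k
   + c k j i * G i j k)); last first.
  by apply: eq_bigr => i _; apply: eq_bigr => j _; apply: eq_bigr => k _; rewrite -cG.
have S3D X Y : S3 (fun i j k => X i j k + Y i j k) = S3 X + S3 Y.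
  rewrite /S3 -big_split; apply: eq_bigr => i _ /=.
  by rewrite -big_split; apply: eq_bigr => j _ /=; rewrite -big_split.
rewrite !S3D.
(* The six terms are relabelled so that each carries the indicator of the order i < j < k. *)
rewrite (S3_23 (fun i j k => c i j k * G i k j)).
rewrite (S3_12 (fun i j k => c i j k * G j i k)).
rewrite (S3_231 (fun i j k => c i j k * G k i j)).
rewrite (S3_312 (fun i j k => c i j k * G j k i)).
rewrite (S3_321 (fun i j k => c i j k * G k j i)).
rewrite -!S3D.
rewrite /S3; apply: eq_bigr => i _; rewrite big_mkcond; apply: eq_bigr => j _.
case: ifPn => [ij|nij]; last first.
  by rewrite big1// => k _; rewrite /c (negbTE nij) /= !mul0r !addr0.
rewrite big_mkcond; apply: eq_bigr => k _; rewrite /c ij /=.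
case: ifPn => _; last by rewrite !mul0r !addr0.
rewrite /G.
have -> : T i k j = - T i j k by rewrite T23.
have -> : T j i k = - T i j k by rewrite T12.
have -> : T j k i = T i j k by rewrite T23 T12 opprK.
have -> : T k i j = T i j k by rewrite T12 T23 opprK.
have -> : T k j i = - T i j k by rewrite T12 T23 T12 opprK.
rewrite !mul1r; ring.
Qed.

End SkewSum.

(** The contraction of [xi] is a number and those of [w] are 1-forms. Their wedge on [[:: a; b]] has
    two terms; each of them, summed over the permutations, is a 3 by 3 determinant, whose six
    products are what [sum_skew3] collects. *)
Lemma extend_trivector_sharp (T : (V -> R) -> (V -> R) -> (V -> R) -> R)
    (xi w : seq V -> R) (a b : V) :
  let e := vbasis {:V} in
  let T3 i j k := T (coord e i) (coord e j) (coord e k) in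
  (forall i j k, T3 i j k = - T3 j i k) ->
  (forall i j k, T3 i j k = - T3 i k j) ->
  (forall s, size s != 1%N -> xi s = 0) ->
  (forall s, size s != 2 -> w s = 0) ->
  extend_trivector (sharp_wedge3 xi w w) T [:: a; b] =
  \sum_i \sum_j \sum_k T3 i j k *
    (xi [:: e`_i] * w [:: e`_j; a] * w [:: e`_k; b] -
     xi [:: e`_i] * w [:: e`_j; b] * w [:: e`_k; a]).
Proof.
move=> e T3 T12 T23 xi1 w2; rewrite -sum_skew3//.
apply: eq_bigr => i _; apply: eq_bigr => j _; apply: eq_bigr => k _.
congr (_ * _).
set x := fun r => _.
pose H (a b : V) (p q : 'I_3) := if p == 0 then xi [:: x q] else
  if p == 1 then w [:: x q; a] else w [:: x q; b].
have iw v : forall s, size s != 1%N -> iota_form v w s = 0.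
  by move=> s s1; apply: w2; rewrite /= eqSS.
have i0 v : forall s, size s != 0%N -> iota_form v xi s = 0.
  by move=> s s0; apply: xi1; rewrite /= eqSS.
rewrite /sharp_wedge3 (eq_bigr (fun g : 'S_3 =>
    (-1) ^+ g * (H a b 0 (g 0) * H a b 1 (g 1) * H a b 2%:R (g 2%:R)) -
    (-1) ^+ g * (H b a 0 (g 0) * H b a 1 (g 1) * H b a 2%:R (g 2%:R)))).
  rewrite sumrB !sum_perm3 /H /=.
  have -> : x 0 = e`_i by [].
  have -> : x 1 = e`_j by [].
  have -> : x 2%:R = e`_k by [].
  ring.
move=> g _; rewrite -mulrBr; congr (_ * _).
rewrite wedge11; last first.
  by move=> s; apply: (@wedge_degree 0 1); [exact: i0|exact: iw].
rewrite !wedge0l; try by move=> s; rewrite -size_eq0; exact: i0.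
by rewrite /iota_form /H /=; ring.
Qed.

Lemma extend_trivector_degree (T : (V -> R) -> (V -> R) -> (V -> R) -> R)
    (xi w : seq V -> R) s :
  (forall s, size s != 1%N -> xi s = 0) ->
  (forall s, size s != 2 -> w s = 0) -> size s != 2 ->
  extend_trivector (sharp_wedge3 xi w w) T s = 0.
Proof.
move=> xi1 w2 s2.
have iw v : forall s, size s != 1%N -> iota_form v w s = 0.
  by move=> u u1; apply: w2; rewrite /= eqSS.
have i0 v : forall s, size s != 0%N -> iota_form v xi s = 0.
  by move=> u u0; apply: xi1; rewrite /= eqSS.
rewrite /extend_trivector big1// => i _; rewrite big1// => j _.
rewrite big1// => k _; rewrite /sharp_wedge3 big1 ?mulr0// => g _.
rewrite (@wedge_degree 1 1) ?mulr0//; last exact: iw.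
by move=> u; apply: (@wedge_degree 0 1); [exact: i0|exact: iw].
Qed.

End WedgeAlgebra.

(** * Brackets and tensoriality *)

Section SmoothFunctions.
Context {R : realType} {M : smooth_manifold R}.

Lemma smooth_cst (c : R) : smooth (fun=> c : R) (M := M).
Proof. by apply/smooth_fam_atP => x; exact: smooth_fam_at_cst. Qed.

Lemma smoothD (f g : M -> R) : smooth f -> smooth g ->
  smooth (fun y => f y + g y).
Proof.
move=> /smooth_fam_atP sf /smooth_fam_atP sg; apply/smooth_fam_atP => x.
exact: smooth_fam_atD (sf x) (sg x).
Qed.

Lemma smoothM (f g : M -> R) : smooth f -> smooth g ->
  smooth (fun y => f y * g y).
Proof.
move=> /smooth_fam_atP sf /smooth_fam_atP sg; apply/smooth_fam_atP => x.
exact: smooth_fam_atM (sf x) (sg x).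
Qed.

Lemma smoothN (f : M -> R) : smooth f -> smooth (fun y => - f y).
Proof.
move=> /smooth_fam_atP sf; apply/smooth_fam_atP => x.
exact: smooth_fam_atN (sf x).
Qed.

Lemma smooth_sum (I : Type) (r : seq I) (P : pred I) (F : I -> M -> R) :
  (forall i, P i -> smooth (F i)) ->
  smooth (fun x => \sum_(i <- r | P i) F i x).
Proof.
move=> H; apply/smooth_fam_atP => x.
apply: (@smooth_fam_at_sum _ _ _ r P (fun i _ => F i)) => i Pi.
exact: smooth_fam_at_const (H i Pi).
Qed.

End SmoothFunctions.

Section BracketLemmas.
Context {R : realType} {M : smooth_manifold R} {E : courant M}.

Section Anchor.
Context {x : M}.
Implicit Types (u v : E x) (f g : M -> R).

Lemma anchorD u f g : smooth f -> smooth g ->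
  anchor u (fun y => f y + g y) = anchor u f + anchor u g.
Proof.
move=> sf sg; have [H _] := anchor_tangent u.
rewrite -[anchor u f]mul1r -H//; congr (anchor _ _).
by apply/funext => y; rewrite mul1r.
Qed.

Lemma anchorM u f g : smooth f -> smooth g ->
  anchor u (fun y => f y * g y) = f x * anchor u g + g x * anchor u f.
Proof. by move=> sf sg; have [_ H] := anchor_tangent u; rewrite H. Qed.

Lemma anchor_cst u (c : R) : anchor u (fun=> c) = 0.
Proof.
have s1 := @smooth_cst R M 1; have sc := @smooth_cst R M c.
have H1 : anchor u (fun=> 1) = 0.
  have := anchorM u s1 s1; rewrite (_ : (fun=> 1 * 1) = fun=> 1); last first.
    by apply/funext => y; rewrite mulr1.
  by rewrite !mul1r => h; lra.
have [H _] := anchor_tangent u; have s0 := @smooth_cst R M 0.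
have H0 : anchor u (fun=> 0) = 0.
  have := H 1 _ _ s0 s0; rewrite (_ : (fun=> _) = fun=> 0); last first.
    by apply/funext => y; rewrite mulr0 addr0.
  by rewrite mul1r => h; lra.
have := H c _ _ s1 s0; by rewrite H1 H0 !mulr0 !addr0 mulr1.
Qed.

Lemma anchorZ u c f : smooth f -> anchor u (fun y => c * f y) = c * anchor u f.
Proof. by move=> sf; rewrite (anchorM _ (smooth_cst c))// anchor_cst mulr0 addr0. Qed.

Lemma anchorN u f : smooth f -> anchor u (fun y => - f y) = - anchor u f.
Proof.
move=> sf; rewrite -mulN1r -anchorZ//; congr (anchor _ _).
by apply/funext => y; rewrite mulN1r.
Qed.

Lemma anchor_sum u (I : Type) (r : seq I) (P : pred I) (F : I -> M -> R) :
  (forall i, smooth (F i)) ->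
  anchor u (fun y => \sum_(i <- r | P i) F i y) =
    \sum_(i <- r | P i) anchor u (F i).
Proof.
move=> sF; elim: r => [|a r IH].
  rewrite big_nil -[RHS](anchor_cst u 0); congr (anchor _ _).
  by apply/funext => y; rewrite big_nil.
rewrite big_cons -IH; case: ifPn => Pa.
  rewrite -anchorD//; last exact: smooth_sum.
  by congr (anchor _ _); apply/funext => y; rewrite big_cons Pa.
by congr (anchor _ _); apply/funext => y; rewrite big_cons (negbTE Pa).
Qed.

End Anchor.

Implicit Types e : sec E.

Lemma bracketDr e1 e2 e3 x : smooth_sec e1 -> smooth_sec e2 -> smooth_sec e3 ->
  bracket e1 (fun y => e2 y + e3 y) x = bracket e1 e2 x + bracket e1 e3 x.
Proof.
move=> s1 s2 s3; have := bracket_linearr 1 s1 s2 s3.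
have -> : (fun y => 1 *: e2 y + e3 y) = (fun y => e2 y + e3 y) :> sec E.
  by apply/functional_extensionality_dep => y; rewrite scale1r.
by move=> ->; rewrite scale1r.
Qed.

Lemma bracketDl e1 e2 e3 x : smooth_sec e1 -> smooth_sec e2 -> smooth_sec e3 ->
  bracket (fun y => e1 y + e2 y) e3 x = bracket e1 e3 x + bracket e2 e3 x.
Proof.
move=> s1 s2 s3; have := bracket_linearl 1 s1 s2 s3.
have -> : (fun y => 1 *: e1 y + e2 y) = (fun y => e1 y + e2 y) :> sec E.
  by apply/functional_extensionality_dep => y; rewrite scale1r.
by move=> ->; rewrite scale1r.
Qed.

Lemma bracket0r e x : smooth_sec e -> bracket e (fun=> 0) x = 0.
Proof.
move=> s; have s0 := @smooth_sec0 _ _ E.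
apply: (@addrI _ (bracket e (fun=> 0) x)); rewrite addr0 -bracketDr//.
by congr (bracket e _ x); apply/functional_extensionality_dep => y; rewrite addr0.
Qed.

Lemma bracket_sumr e (I : Type) (r : seq I) (F : I -> sec E) x :
  smooth_sec e -> (forall i, smooth_sec (F i)) ->
  bracket e (fun y => \sum_(i <- r) F i y) x = \sum_(i <- r) bracket e (F i) x.
Proof.
move=> s sF; elim: r => [|a r IH].
  rewrite big_nil -[RHS](bracket0r x s); congr (bracket e _ x).
  by apply/functional_extensionality_dep => y; rewrite big_nil.
rewrite big_cons -IH -bracketDr//; last exact: smooth_sec_sum.
by congr (bracket e _ x); apply/functional_extensionality_dep => y; rewrite big_cons.
Qed.

Lemma bracketZr e1 e2 (f : M -> R) x : smooth_sec e1 -> smooth_sec e2 ->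
  smooth f -> bracket e1 (fun y => f y *: e2 y) x =
    f x *: bracket e1 e2 x + anchor (e1 x) f *: e2 x.
Proof. by move=> s1 s2 sf; rewrite courant_leibniz. Qed.

(** This is [courant_square] for [e1 + e2]; the factor 1/2 in it cancels the factor 2 of the cross
    term. *)
Lemma bracket_polarization e1 e2 x (v : E x) : smooth_sec e1 -> smooth_sec e2 ->
  cpair (bracket e1 e2 x) v + cpair (bracket e2 e1 x) v =
    anchor v (fun y => cpair (e1 y) (e2 y)).
Proof.
move=> s1 s2; have s12 := smooth_secD s1 s2.
have := courant_square s12 v.
rewrite bracketDr// !bracketDl// !pairDl !(courant_square _ v)//.
have -> : (fun y => cpair (e1 y + e2 y) (e1 y + e2 y)) =
    (fun y => (cpair (e1 y) (e1 y) + 2 * cpair (e1 y) (e2 y)) +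
              cpair (e2 y) (e2 y)).
  apply/funext => y; rewrite pairDl !pairDr (pair_sym (e2 y) (e1 y)); ring.
have p11 := pair_smooth s1 s1; have p12 := pair_smooth s1 s2.
have p22 := pair_smooth s2 s2.
have p2 : smooth (fun y => 2 * cpair (e1 y) (e2 y)).
  by apply: smoothM => //; exact: smooth_cst.
rewrite anchorD//; last exact: smoothD.
rewrite anchorD// anchorZ// => h; lra.
Qed.

End BracketLemmas.

Section SplitBracket.
Context {R : realType} {M : smooth_manifold R} {E : courant M}.
Context {A K : subbundle E}.
Hypotheses (lagA : is_lagrangian A) (lagK : is_lagrangian K).
Hypothesis (hAK : is_complement A K).
Local Notation pA := (@pA R M E A K _).
Local Notation pK := (@pK R M E A K _).

Definition sec_in (L : subbundle E) (s : sec E) :=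
  smooth_sec s /\ forall x, s x \in L x.

Lemma lag_anchor0 (L : subbundle E) s1 s2 x (v : E x) : is_lagrangian L ->
  sec_in L s1 -> sec_in L s2 -> anchor v (fun y => cpair (s1 y) (s2 y)) = 0.
Proof.
move=> lagL [_ h1] [_ h2]; rewrite -[RHS](anchor_cst v 0); congr (anchor _ _).
by apply/funext => y; rewrite (lag_pair0 lagL).
Qed.

(** The symmetric part of the bracket is the derivative of a pairing that vanishes identically on
    sections of [L]. Together with [bracket_skew23], this makes <[s1, s2], s3> totally skew on such
    sections. *)
Lemma bracket_skew12 (L : subbundle E) s1 s2 x (v : E x) : is_lagrangian L ->
  sec_in L s1 -> sec_in L s2 ->
  cpair (bracket s1 s2 x) v = - cpair (bracket s2 s1 x) v.
Proof.
move=> lagL h1 h2; have [sm1 _] := h1; have [sm2 _] := h2.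
by apply/eqP; rewrite -addr_eq0 bracket_polarization// (lag_anchor0 _ lagL).
Qed.

Lemma bracket_skew23 (L : subbundle E) s1 s2 s3 x : is_lagrangian L ->
  smooth_sec s1 -> sec_in L s2 -> sec_in L s3 ->
  cpair (bracket s1 s2 x) (s3 x) = - cpair (s2 x) (bracket s1 s3 x).
Proof.
move=> lagL h1 h2 h3; have [sm2 _] := h2; have [sm3 _] := h3.
by apply/eqP; rewrite -addr_eq0 -courant_metric// (lag_anchor0 _ lagL).
Qed.

(** The part in [A] is determined by its pairings with sections of [K]. In these the bracket passes
    to the other side by [bracket_skew23], and [k2] then enters only through its value at [x]. *)
Lemma bracketK_tensor2 k1 k2 k2' x : sec_in K k1 -> sec_in K k2 ->
  sec_in K k2' -> k2 x = k2' x -> pA (bracket k1 k2 x) = pA (bracket k1 k2' x).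
Proof.
move=> h1 h2 h2' e; apply: pair_inj => v.
have pp (u : E x) : cpair (pA u) v = cpair (pA u) (pK v).
  rewrite -{1}(pApK hAK v) pairDr (lag_pair0 lagA) ?add0r//; exact: pA_mem.
rewrite !pp !(pair_pA lagK hAK) ?pK_mem//.
have [k3 [s3 m3 <-]] := subbundle_sec_through (pK_mem (K := K) (A := A) v).
rewrite !(bracket_skew23 x lagK)//; first by rewrite e.
  exact: h1.1.
exact: h1.1.
Qed.

(** Skew symmetry carries tensoriality over to the first argument. This is why [Psi], defined
    through arbitrarily chosen extensions, does not depend on them. *)
Lemma bracketK_tensor k1 k2 k1' k2' x : sec_in K k1 -> sec_in K k2 ->
  sec_in K k1' -> sec_in K k2' -> k1 x = k1' x -> k2 x = k2' x ->
  pA (bracket k1 k2 x) = pA (bracket k1' k2' x).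
Proof.
move=> h1 h2 h1' h2' e1 e2; rewrite (bracketK_tensor2 h1 h2 h2')//.
have sk a b : sec_in K a -> sec_in K b ->
    bracket a b x = - bracket b a x.
  by move=> ha hb; apply: pair_inj => v; rewrite pairNl; exact: (bracket_skew12 v lagK).
rewrite (sk k1)// (sk k1')// !pAN.
by rewrite (bracketK_tensor2 h2' h1 h1').
Qed.

End SplitBracket.

(** * Forms on a Dirac structure *)

Section SmoothProjection.
Context {R : realType} {M : smooth_manifold R} {E : courant M}.
Context {A K : subbundle E}.
Hypotheses (lagA : is_lagrangian A) (lagK : is_lagrangian K).
Hypothesis (hAK : is_complement A K).
Local Notation pA := (@pA R M E A K _).
Local Notation pK := (@pK R M E A K _).

Lemma near_neq0 (th : M -> R) (t : R) (x : M) : smooth th -> th x != 0 ->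
  \forall p \near (t, x), th p.2 != 0.
Proof.
move=> sth th0; have := smooth_fam_at_continuous (@smooth_fam_at_const _ _ th t x sth).
by move=> c; exact: (cvgr_neq0 (th x) c th0).
Qed.

Lemma smooth_sec_at_pA (s : R -> sec E) t x : smooth_sec_at s t x ->
  smooth_sec_at (fun t x => pA (s t x)) t x.
Proof.
move=> ss; have [n [b [k [th D]]]] := exists_dual_frame lagA lagK hAK x.
have sth := @smooth_fam_at_const _ _ th t x (df_smooth D).
have H : smooth_sec_at (fun r y => (th y)^-1 *:
    \sum_l cpair (s r y) (k l y) *: b l y) t x.
  apply: smooth_sec_atZ; first exact: smooth_fam_atV (df_neq0 D) sth.
  apply: smooth_sec_at_sum => l _; apply: smooth_sec_atZ.
    apply: pair_smooth_at ss _.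
    exact: smooth_sec_at_const (df_smoothK D l).
  exact: smooth_sec_at_const (df_smoothA D l).
apply: smooth_sec_at_ext H.
have nz := near_neq0 t (df_smooth D) (df_neq0 D).
near=> p; have pz : th p.2 != 0 by near: p.
apply: (scalerI pz); rewrite [RHS](df_decompA D); last exact: pA_mem.
rewrite scalerA divff// scale1r; apply: eq_bigr => l _.
by rewrite (pair_pA lagK hAK)//; exact: df_memK D _ _.
Unshelve. all: by end_near. Qed.

Lemma sec_in_pA (s : sec E) : smooth_sec s -> sec_in A (fun x => pA (s x)).
Proof.
move=> /smooth_sec_atP ss; split; last by move=> x; exact: pA_mem.
by apply/smooth_sec_atP => x; exact: (smooth_sec_at_pA (ss x)).
Qed.

Lemma sec_in_pK (s : sec E) : smooth_sec s -> sec_in K (fun x => pK (s x)).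
Proof.
move=> ss; split; last by move=> x; exact: pK_mem.
have := smooth_secD ss (smooth_sec_cstZ (-1) (sec_in_pA ss).1).
congr smooth_sec; apply/functional_extensionality_dep => x.
by rewrite -{1}(pApK hAK (s x)) scaleN1r addrAC subrr add0r.
Qed.

Lemma represent x (h : E x -> R) :
  (forall c u v, h (c *: u + v) = c * h u + h v) ->
  exists2 k, k \in K x & forall a, a \in A x -> cpair k a = h a.
Proof.
move=> hl.
have h0 : h 0 = 0.
  by have := hl 1 0 0; rewrite scaler0 addr0 mul1r => e; lra.
have [k kK kE] := represent_basis lagK hAK
  (fun i => h (tnth (vbasis (A x)) i)) (vbasisP (A x)).
exists k => // a aA; rewrite (coord_basis (vbasisP (A x)) aA) pair_sumr.
rewrite (@big_morph _ _ h 0 +%R 0 +%R) => [|u v|//]; last first.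
  by rewrite -[u]scale1r hl mul1r scale1r.
apply: eq_bigr => i _; rewrite pairZr -tnth_nth kE.
by rewrite -[X in _ = h X]addr0 hl h0 addr0.
Qed.

Lemma vsval_pr x (u : E x) : vsval (pr A K u) = pA u.
Proof. by rewrite vsprojK// pA_mem. Qed.

Lemma pr_vsval x (s : sfiber A x) : pr A K (vsval s) = s.
Proof. by apply/val_inj; rewrite /= vsval_pr pA_id//; exact: subvsP. Qed.

Lemma pr_linear x c (u v : E x) :
  pr A K (c *: u + v) = c *: pr A K u + pr A K v.
Proof. by rewrite /pr !linearP. Qed.

(* the 2-form [w], extended to [E] by the projection along [K] *)
Definition ev (w : extform A) x (u v : E x) : R := w x [:: pr A K u; pr A K v].

Lemma evE w x s1 s2 : w x [:: s1; s2] = ev w (vsval s1) (vsval s2).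
Proof. by rewrite /ev !pr_vsval. Qed.

Lemma incl_sec_pr (s : sec E) : (forall x, s x \in A x) ->
  incl_sec (fun x => pr A K (s x)) = s.
Proof.
move=> sA; apply/functional_extensionality_dep => x.
by rewrite /incl_sec vsval_pr pA_id.
Qed.

Lemma ev_pAl w x (u v : E x) : ev w (pA u) v = ev w u v.
Proof. by rewrite /ev -{1}vsval_pr pr_vsval. Qed.

Lemma ev_pAr w x (u v : E x) : ev w u (pA v) = ev w u v.
Proof. by rewrite /ev -{1}vsval_pr pr_vsval. Qed.

Section Form2.
Variables (w : extform A) (fw : is_form 2 w).

Section Bilinear.
Context {x : M}.
Implicit Types u v z : E x.

Lemma ev_linl c u v z : ev w (c *: u + v) z = c * ev w u z + ev w v z.
Proof.
by rewrite /ev pr_linear; have [_ H _] := fw.1 x; apply: (H [::] [:: pr A K z]).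
Qed.

Lemma ev_linr c u v z : ev w z (c *: u + v) = c * ev w z u + ev w z v.
Proof.
by rewrite /ev pr_linear; have [_ H _] := fw.1 x; apply: (H [:: pr A K z] [::]).
Qed.

Lemma evvv u : ev w u u = 0.
Proof. by have [_ _ H] := fw.1 x; apply: (H [::] [::] [::]). Qed.

Lemma evDl u v z : ev w (u + v) z = ev w u z + ev w v z.
Proof. by rewrite -[u]scale1r ev_linl mul1r scale1r. Qed.
Lemma evDr u v z : ev w z (u + v) = ev w z u + ev w z v.
Proof. by rewrite -[u]scale1r ev_linr mul1r scale1r. Qed.
Lemma ev_skew u v : ev w u v = - ev w v u.
Proof.
by apply/eqP; rewrite -addr_eq0; have := evvv (u + v);
  rewrite evDl !evDr !evvv add0r addr0 => ->.
Qed.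
Lemma ev0l z : ev w 0 z = 0.
Proof. by apply: (@addrI _ (ev w 0 z)); rewrite -evDl !addr0. Qed.
Lemma ev0r z : ev w z 0 = 0. Proof. by rewrite ev_skew ev0l oppr0. Qed.
Lemma evZl c u z : ev w (c *: u) z = c * ev w u z.
Proof. by rewrite -[c *: u]addr0 ev_linl ev0l addr0. Qed.
Lemma evZr c u z : ev w z (c *: u) = c * ev w z u.
Proof. by rewrite ev_skew evZl [in RHS]ev_skew mulrN. Qed.
Lemma ev_suml (I : Type) (r : seq I) (P : pred I) (F : I -> E x) z :
  ev w (\sum_(i <- r | P i) F i) z = \sum_(i <- r | P i) ev w (F i) z.
Proof. by apply: (big_morph (fun u => ev w u z)) => [u v|]; rewrite ?evDl ?ev0l. Qed.
Lemma ev_sumr (I : Type) (r : seq I) (P : pred I) (F : I -> E x) z :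
  ev w z (\sum_(i <- r | P i) F i) = \sum_(i <- r | P i) ev w z (F i).
Proof. by apply: (big_morph (ev w z)) => [u v|]; rewrite ?evDr ?ev0r. Qed.
Lemma form2_degree (s : seq (sfiber A x)) : size s != 2 -> @w x s = 0.
Proof. by have [H _ _] := fw.1 x; exact: H. Qed.
End Bilinear.

Lemma ev_smooth a b : sec_in A a -> sec_in A b ->
  smooth (fun x => ev w (a x) (b x)).
Proof.
move=> [sa ma] [sb mb].
have := fw.2 [:: (fun x => pr A K (a x)); (fun x => pr A K (b x))].
apply; move=> [|[|i]] //= _; rewrite /smooth_ssec incl_sec_pr//.
Qed.

(** The section [k] is the contraction of [w] with [a], seen in [K]. At each point it is unique, so
    a pointwise choice does no harm; smoothness is read off from its expansion in a dual frame. *)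
Lemma form_section a : sec_in A a ->
  exists2 k, sec_in K k & forall x c, c \in A x -> cpair (k x) c = ev w (a x) c.
Proof.
move=> ha; have kex x : exists k : E x,
    k \in K x /\ forall c, c \in A x -> cpair k c = ev w (a x) c.
  have [|k kK kE] := @represent x (fun c => ev w (a x) c).
    by move=> c u v; rewrite ev_linr.
  by exists k.
pose k x := sval (cid (kex x)).
have kP x : k x \in K x /\ forall c, c \in A x -> cpair (k x) c = ev w (a x) c.
  exact: svalP (cid (kex x)).
exists k; last by move=> x; exact: (kP x).2.
split; last by move=> x; exact: (kP x).1.
apply/smooth_sec_atP => x.
have [n [b [q [th D]]]] := exists_dual_frame lagA lagK hAK x.
have sth := @smooth_fam_at_const _ _ th 0 x (df_smooth D).
have H : smooth_sec_at (fun r y => (th y)^-1 *: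
    \sum_l ev w (a y) (b l y) *: q l y) 0 x.
  apply: smooth_sec_atZ; first exact: smooth_fam_atV (df_neq0 D) sth.
  apply: smooth_sec_at_sum => l _; apply: smooth_sec_atZ.
    apply: smooth_fam_at_const; apply: ev_smooth => //.
    by split; [exact: df_smoothA D l|exact: df_memA D l].
  exact: smooth_sec_at_const (df_smoothK D l).
apply: smooth_sec_at_ext H.
have nz := near_neq0 0 (df_smooth D) (df_neq0 D).
near=> p; have pz : th p.2 != 0 by near: p.
apply: (scalerI pz); rewrite [RHS](df_decompK D); last exact: (kP _).1.
rewrite scalerA divff// scale1r; apply: eq_bigr => l _.
by rewrite (kP _).2//; exact: df_memA D _ _.
Unshelve. all: by end_near. Qed.

End Form2.
End SmoothProjection.

(** * Extensions of vectors to sections, and the differential of a 1-form *)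

Section Operations.
Context {R : realType} {M : smooth_manifold R} {E : courant M}.
Context {A K : subbundle E}.
Hypotheses (lagA : is_lagrangian A) (lagK : is_lagrangian K).
Hypothesis (hAK : is_complement A K).

Lemma sec_in_incl (L : subbundle E) (s : sec (sfiber L)) :
  smooth_ssec s -> sec_in L (incl_sec s).
Proof. by move=> h; split => // x; exact: subvsP. Qed.

Lemma exists_ssec (L : subbundle E) (s : sec E) : sec_in L s ->
  exists2 s' : sec (sfiber L), smooth_ssec s' & incl_sec s' = s.
Proof.
move=> [h m]; pose s' x : sfiber L x := vsproj (L x) (s x).
have s'E : incl_sec s' = s.
  by apply/functional_extensionality_dep => x; rewrite /incl_sec vsprojK.
by exists s' => //; rewrite /smooth_ssec s'E.
Qed.

Lemma extAP x (v : sfiber A x) :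
  sec_in A (incl_sec (extA v)) /\ incl_sec (extA v) x = vsval v.
Proof.
have [s [ss sA sv]] := subbundle_sec_through (subvsP v).
have [s' hs' s'E] := exists_ssec (conj ss sA).
have : [set a : sec (sfiber A) | smooth_ssec a /\ a x = v] (extA v).
  rewrite /extA; apply: (xgetPex (fun=> 0)); exists s'; split => //.
  by apply/val_inj; have := congr1 (fun f => f x) s'E; rewrite sv.
by move=> [ha av]; split; [exact: sec_in_incl|rewrite /incl_sec av].
Qed.

(** The section [k] shows that [xget] does not fall back on its default; the value at [x] is then
    forced, since a vector of [K x] is determined by its pairings with [A x]. *)
Lemma extKP x (h : sfiber A x -> R) (k : sec E) : sec_in K k ->
  (forall a, cpair (k x) (vsval a) = h a) ->
  sec_in K (incl_sec (extK K h)) /\ incl_sec (extK K h) x = k x.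
Proof.
move=> hk kh; have [k' hk' k'E] := exists_ssec hk.
have : [set k : sec (sfiber K) |
    smooth_ssec k /\ forall a, cpair (vsval (k x)) (vsval a) = h a] (extK K h).
  rewrite /extK; apply: (xgetPex (fun=> 0)); exists k'; split => // a.
  by rewrite -kh -k'E.
move=> [hl lh]; have hE := sec_in_incl hl; split => //.
apply/eqP; rewrite -subr_eq0; apply/eqP; apply: (complement_pair0 lagA hAK).
  by rewrite memvB//; [exact: hE.2|exact: hk.2].
move=> a aA; have := lh (vsproj (A x) a); rewrite -kh vsprojK// => e.
by rewrite pairDl pairNl e subrr.
Qed.

Section Differential.
Hypothesis (invA : is_involutive A).
Variables (xi : sec (sfiber K)) (hxi : smooth_ssec xi).
Let xi' := incl_sec xi.
Let sxi : smooth_sec xi'. Proof. exact: hxi. Qed.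

(** Koszul's formula reads a1<xi,a2> - a2<xi,a1> - <xi,[a1,a2]>. The metric axiom turns the first
    and last terms into <[a1,xi],a2>, and polarization exchanges [a1] and [xi], absorbing the middle
    term. *)
Lemma koszul_flat (a1 a2 : sec (sfiber A)) x :
  smooth_ssec a1 -> smooth_ssec a2 ->
  koszul (flat xi') [:: a1; a2] x =
    - cpair (bracket xi' (incl_sec a1) x) (incl_sec a2 x).
Proof.
move=> h1 h2; rewrite /koszul !big_ord_recl !big_ord0 /=.
rewrite !big_mkcond /= !big_ord_recl !big_ord0 /=.
rewrite /bracketA vsprojK; last exact: invA.
rewrite -/(incl_sec a1) -/(incl_sec a2).
have P := bracket_polarization (incl_sec a2 x) sxi h1.
have Q := courant_metric h1 sxi h2 x.
rewrite /flat /=.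
rewrite [X in _ + (_ + (X + 0))]big1 => [|[[|[|j]] hj]]//.
rewrite /bump /= !expr0 !expr1 => *; rewrite Q -P /xi'; ring.
Qed.

Lemma flat_degree (u : sec E) y (s : seq (sfiber A y)) :
  size s != 1%N -> flat u y s = 0.
Proof. by case: s => [|? [|? ?]]. Qed.

Lemma size_del (T : Type) i (s : seq T) : (i < size s)%N ->
  size (del i s) = (size s).-1.
Proof. by move=> h; rewrite /del size_cat size_takel ?size_drop; lia. Qed.

(** Only the first of the extensions [extA] sits under the bracket. Moving the bracket to [c] by
    [bracket_skew23] and back exchanges it for [a], which has the same value at [x]. *)
Lemma dA_flat a c x : sec_in A a -> sec_in A c ->
  dA (flat xi') x [:: pr A K (a x); pr A K (c x)] =
    - cpair (bracket xi' a x) (c x).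
Proof.
move=> ha hc; rewrite /dA /=.
have [h1 e1] := extAP (pr A K (a x)); have [h2 e2] := extAP (pr A K (c x)).
have [[s1 _] [s2 _]] := (h1, h2).
rewrite koszul_flat// e2 vsval_pr// pA_id ?hc.2//.
rewrite (bracket_skew23 x lagA sxi h1 hc) e1 vsval_pr// pA_id ?ha.2//.
by rewrite (bracket_skew23 x lagA sxi ha hc).
Qed.

Lemma dA_flat_degree x (s : seq (sfiber A x)) :
  size s != 2 -> dA (flat xi') x s = 0.
Proof.
move=> s2; rewrite /dA /koszul size_map; set a := map _ s.
have sa : size a = size s by rewrite size_map.
rewrite big1 => [|i _]; last first.
  rewrite (_ : (fun y => _) = fun=> 0) ?anchor_cst ?mulr0//.
  apply/funext => y; apply: flat_degree; rewrite size_map size_del ?sa//.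
  by apply: contra s2 => /eqP; case: (size s) => [|[|[|n]]].
rewrite big1 ?addr0// => i _; rewrite big1// => j ij.
have js := ltn_ord j.
rewrite flat_degree ?mulr0//= size_map !size_del ?sa//; first by lia.
by rewrite -ltnS prednK ?(leq_trans _ js)//; exact: leq_trans js.
Qed.

End Differential.
End Operations.

(** * Constructions of forms *)

Section FormConstructions.
Context {R : realType} {M : smooth_manifold R} {E : courant M}.
Context {A : subbundle E}.

Lemma is_form_bilinear (B : forall x, E x -> E x -> R) :
  (forall x c u v z, B x (c *: u + v) z = c * B x u z + B x v z) ->
  (forall x c u v z, B x z (c *: u + v) = c * B x z u + B x z v) ->
  (forall x u, B x u u = 0) ->
  (forall a b, sec_in A a -> sec_in A b -> smooth (fun x => B x (a x) (b x))) ->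
  is_form 2 (fun x (s : seq (sfiber A x)) =>
    if s is [:: u; v] then B x (vsval u) (vsval v) else 0).
Proof.
move=> Bl Br Ba Bs; split=> [x|a ha]; last first.
  case: a ha => [|a [|b [|? ?]]] ha; try exact: smooth_cst.
  apply: Bs; apply: sec_in_incl; first exact: (ha 0%N isT).
  exact: (ha 1%N isT).
split.
- by case=> [|? [|? [|? ?]]].
- case=> [|z [|z' [|? s1]]] [|y [|y' s2]] c u v /=; rewrite ?mulr0 ?addr0//.
- move=> s1 s2 s3 u; have [|n2] := eqVneq (size (s1 ++ u :: s2 ++ u :: s3)) 2.
    by case: s1 => [|? ?]; case: s2 => [|? ?]; case: s3 => [|? ?] //=;
      rewrite ?size_cat /=; lia.
  by case: (s1 ++ _) n2 => [|? [|? [|? ?]]].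
Qed.

Lemma is_form_flat (u : sec E) : smooth_sec u -> is_form 1 (flat (A := A) u).
Proof.
move=> su; split=> [x|a ha]; last first.
  case: a ha => [|a [|b ?]] ha; try exact: smooth_cst.
  by apply: pair_smooth => //; exact: (ha 0%N isT).
split.
- by case=> [|? [|? ?]].
- case=> [|z [|z' s1]] [|y s2] c p q /=; rewrite ?mulr0 ?addr0//.
  by rewrite -[LHS]/(cpair (u x) (c *: vsval p + vsval q)) pairDr pairZr.
- by case=> [|z [|z' s1]] [|y s2] s3 p.
Qed.

Lemma is_form_form0 (f : M -> R) : smooth f -> is_form 0 (form0 f : extform A).
Proof.
move=> sf; split=> [x|a ha]; last by case: a ha => [|a ?] ha //=; exact: smooth_cst.
by split; [case|case=> [|? ?] *; rewrite /= ?mulr0 ?addr0|case].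
Qed.

Lemma fwedge_form0 (f : M -> R) (w : extform A) :
  fwedge (form0 f) w = fun x s => f x * w x s.
Proof.
apply/functional_extensionality_dep => x; apply/funext => s.
by rewrite /fwedge wedge0l//; case.
Qed.

Definition wedge_pair (k1 k2 : sec E) : extform A := fun x s =>
  if s is [:: u; v] then
    cpair (k1 x) (vsval u) * cpair (k2 x) (vsval v)
    - cpair (k1 x) (vsval v) * cpair (k2 x) (vsval u)
  else 0.

Lemma fwedge_flat (k1 k2 : sec E) :
  fwedge (flat k1) (flat k2) = wedge_pair k1 k2.
Proof.
apply/functional_extensionality_dep => x; apply/funext => s; rewrite /fwedge.
have d (k : sec E) (t : seq (sfiber A x)) : size t != 1%N -> flat k x t = 0.
  by move: t => [|? [|? ?]].
case: s => [|u [|v [|z s]]]; try exact: (wedge_degree (d k1) (d k2)).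
by rewrite wedge11//; exact: d.
Qed.

Lemma is_form_fwedge (f : M -> R) (k1 k2 : sec E) : smooth f ->
  smooth_sec k1 -> smooth_sec k2 ->
  is_form 2 (fwedge (form0 f) (fwedge (flat k1) (flat k2)) : extform A).
Proof.
move=> sf s1 s2; rewrite fwedge_flat fwedge_form0.
rewrite (_ : (fun x s => _) = (fun x (s : seq (sfiber A x)) =>
    if s is [:: u; v] then
      (fun u v : E x => f x * (cpair (k1 x) u * cpair (k2 x) v
      - cpair (k1 x) v * cpair (k2 x) u)) (vsval u) (vsval v) else 0)); last first.
  apply/functional_extensionality_dep => x; apply/funext => s.
  by case: s => [|u [|v [|z s]]] //=; rewrite mulr0.
apply: (is_form_bilinear (B := fun x u v => f x * (cpair (k1 x) u *
  cpair (k2 x) v - cpair (k1 x) v * cpair (k2 x) u))).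
- by move=> x c u v z; rewrite !pairDr !pairZr; ring.
- by move=> x c u v z; rewrite !pairDr !pairZr; ring.
- by move=> x u; ring.
- move=> a b [sa _] [sb _]; apply: smoothM => //; apply: smoothD.
    by apply: smoothM; exact: pair_smooth.
  by apply: smoothN; apply: smoothM; exact: pair_smooth.
Qed.

Lemma is_form_zero p : is_form p (fun x (s : seq (sfiber A x)) => 0 : R).
Proof.
split=> [x|a ha]; last exact: smooth_cst.
by split => *; rewrite ?mulr0 ?addr0.
Qed.

Lemma is_formD p (w1 w2 : extform A) : is_form p w1 -> is_form p w2 ->
  is_form p (fun x s => w1 x s + w2 x s).
Proof.
move=> [h1 s1] [h2 s2]; split=> [x|a ha]; last first.
  by apply: smoothD; [exact: s1|exact: s2].
have [[a1 b1 c1] [a2 b2 c2]] := (h1 x, h2 x).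
split=> [s ss|s t c u v|s t r u]; first by rewrite a1// a2// addr0.
  by rewrite b1 b2; ring.
by rewrite c1 c2 addr0.
Qed.

Lemma is_form_sum p (I : Type) (r : seq I) (F : I -> extform A) :
  (forall i, is_form p (F i)) -> is_form p (fun x s => \sum_(i <- r) F i x s).
Proof.
move=> h; elim: r => [|i r IH].
  rewrite (_ : (fun x s => _) = fun x s => 0); first exact: is_form_zero.
  apply/functional_extensionality_dep => x; apply/funext => s.
  by rewrite big_nil.
rewrite (_ : (fun x s => _) = fun x s => F i x s + \sum_(i <- r) F i x s).
  exact: is_formD (h i) IH.
apply/functional_extensionality_dep => x; apply/funext => s.
by rewrite big_cons.
Qed.

End FormConstructions.

(** * The Schouten bracket of a 1-form with a 2-form *)

Section Schouten.
Context {R : realType} {M : smooth_manifold R} {E : courant M}.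
Context {A K : subbundle E}.
Hypotheses (lagA : is_lagrangian A) (lagK : is_lagrangian K).
Hypothesis (hAK : is_complement A K).
Context {S : extform A -> extform A -> extform A}.
Arguments S : clear implicits.
Hypothesis hS : is_schouten K S.
Variables (xi : sec (sfiber K)) (hxi : smooth_ssec xi).
Local Notation pK := (@pK R M E A K _).
Local Notation ev := (@ev R M E A K).
Let xi' := incl_sec xi.
Let sxi : smooth_sec xi'. Proof. exact: hxi. Qed.
Let fxi : is_form 1 (flat (A := A) xi'). Proof. exact: is_form_flat. Qed.

Lemma schouten_form0_wedge f (w : extform A) : smooth f -> is_form 2 w ->
  S (flat xi') (fwedge (form0 f) w) =
    fun x s => anchor (xi' x) f * w x s + f x * S (flat xi') w x s.
Proof.
move=> sf fw; rewrite (schouten_leibniz _ _ hS _ _ _ _ _ _ fxi (is_form_form0 sf) fw).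
rewrite (schouten_anchor _ _ hS _ _ hxi sf) muln0 expr0.
apply/functional_extensionality_dep => x; apply/funext => s.
by rewrite mul1r !fwedge_form0.
Qed.

(** The bracket with a 1-form is a derivation without sign, and the projection to [K] disappears in
    the pairing with vectors of [A]. *)
Lemma schouten_flat_wedge k1 k2 x (a c : E x) : sec_in K k1 -> sec_in K k2 ->
  a \in A x -> c \in A x ->
  S (flat xi') (fwedge (flat k1) (flat k2)) x [:: pr A K a; pr A K c] =
    cpair (bracket xi' k1 x) a * cpair (k2 x) c
    - cpair (bracket xi' k1 x) c * cpair (k2 x) a
    + (cpair (k1 x) a * cpair (bracket xi' k2 x) c
    - cpair (k1 x) c * cpair (bracket xi' k2 x) a).
Proof.
move=> h1 h2 aA cA.
have [[s1 _] [s2 _]] := (h1, h2).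
have Sk k : sec_in K k -> S (flat xi') (flat k) =
    flat (fun x => pK (bracket xi' k x)).
  move=> hk; have [k' hk' <-] := exists_ssec hk.
  rewrite (schouten_bracket _ _ hS _ _ hxi hk'); congr (flat _).
  apply/functional_extensionality_dep => y.
  by rewrite /incl_sec vsprojK// /pK memv_pi.
rewrite (schouten_leibniz _ _ hS _ _ _ _ _ _ fxi (is_form_flat s1) (is_form_flat s2)).
rewrite !Sk// muln1 sqrrN expr1n mul1r !fwedge_flat /wedge_pair !vsval_pr !(pA_id hAK)//.
by rewrite !(pair_pK lagA hAK).
Qed.

Lemma schouten_sum (w1 : extform A) p (I : Type) (r : seq I)
    (F : I -> extform A) : is_form p w1 -> (forall i, is_form 2 (F i)) ->
  S w1 (fun x s => \sum_(i <- r) F i x s) =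
    fun x s => \sum_(i <- r) S w1 (F i) x s.
Proof.
move=> f1 fF; have S0 : S w1 (fun x s => 0) = fun x s => 0.
  have := schouten_linear _ _ hS _ _ _ _ _ 1 f1 (is_form_zero 2) (is_form_zero 2).
  have -> : (fun x (s : seq (sfiber A x)) => 1 * 0 + 0 : R) = fun x s => 0.
    by apply/functional_extensionality_dep => x; apply/funext => s; rewrite mul1r addr0.
  move=> e; apply/functional_extensionality_dep => x; apply/funext => s.
  have := congr1 (fun w : extform A => w x s) e; rewrite mul1r => h.
  by apply: (@addrI _ (S w1 (fun x s => 0) x s)); rewrite addr0 -h.
elim: r => [|i r IH].
  rewrite (_ : (fun x s => _) = fun x s => 0).
    rewrite S0; apply/functional_extensionality_dep => x; apply/funext => s.
    by rewrite big_nil.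
  apply/functional_extensionality_dep => x; apply/funext => s.
  by rewrite big_nil.
rewrite (_ : (fun x s => _) =
    fun x s => 1 * F i x s + \sum_(i <- r) F i x s); last first.
  apply/functional_extensionality_dep => x; apply/funext => s.
  by rewrite big_cons mul1r.
rewrite (schouten_linear _ _ hS _ _ _ _ _ 1 f1 (fF i) (is_form_sum r fF)) IH.
apply/functional_extensionality_dep => x; apply/funext => s.
by rewrite big_cons mul1r.
Qed.

Section Form2.
Variables (w : extform A) (fw : is_form 2 w).
Arguments w : clear implicits.

(** This is the expansion of a 2-form in the coframe given by [k]. The sum runs over all pairs of
    indices, whence the 2, and each of the two arguments brings one factor [th]. *)
Lemma dual_frame_form2 x0 n (b k : 'I_n -> sec E) th x (u v : E x) :
  @dual_frame R M E A K x0 n b k th ->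
  \sum_(p : 'I_n * 'I_n) ev w (b p.1 x) (b p.2 x) *
    (cpair (k p.1 x) u * cpair (k p.2 x) v
     - cpair (k p.1 x) v * cpair (k p.2 x) u) = 2 * (th x * th x) * ev w u v.
Proof.
move=> D.
have H (a c : E x) : \sum_(p : 'I_n * 'I_n) ev w (b p.1 x) (b p.2 x) *
    (cpair (k p.1 x) a * cpair (k p.2 x) c) = th x * th x * ev w a c.
  rewrite -(ev_pAl hAK w) -(ev_pAr hAK w) -mulrA -(evZr fw) -(evZl fw).
  rewrite !(df_decompA D) ?(pA_mem)// (ev_suml fw).
  rewrite -(pair_bigA _ (fun i j => ev w (b i x) (b j x) *
    (cpair (k i x) a * cpair (k j x) c))) /=.
  apply: eq_bigr => i _; rewrite (ev_sumr fw); apply: eq_bigr => j _.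
  rewrite (evZl fw) (evZr fw) !(pair_pA lagK hAK) ?(df_memK D)//.
  by rewrite (pair_sym a) (pair_sym c); ring.
under eq_bigr do rewrite mulrBr.
by rewrite sumrB !H (ev_skew fw v u); ring.
Qed.

(* [S] is only given on globally defined forms: near [x] the form [w] is
   recovered from the global identity [dual_frame_form2], whose right-hand side
   is a multiple of [w] by a function that does not vanish at [x]. *)
Lemma schouten_form2 a c x : sec_in A a -> sec_in A c ->
  S (flat xi') w x [:: pr A K (a x); pr A K (c x)] =
    anchor (xi' x) (fun y => ev w (a y) (c y))
    - ev w (bracket xi' a x) (c x) - ev w (a x) (bracket xi' c x).
Proof.
move=> ha hc; have [[sa mA] [sc mC]] := (ha, hc).
have [n [b [k [th D]]]] := exists_dual_frame lagA lagK hAK x.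
have hb i : sec_in A (b i) by split; [exact: df_smoothA D i|exact: df_memA D i].
have hk i : sec_in K (k i) by split; [exact: df_smoothK D i|exact: df_memK D i].
have sk i : smooth_sec (k i) := (hk i).1.
pose W (p : 'I_n * 'I_n) y := ev w (b p.1 y) (b p.2 y).
have sW p : smooth (W p) by exact: ev_smooth.
pose F p : extform A := fwedge (form0 (W p)) (fwedge (flat (k p.1)) (flat (k p.2))).
have fF p : is_form 2 (F p) by exact: is_form_fwedge.
have fkk p : is_form 2 (fwedge (flat (k p.1)) (flat (k p.2)) : extform A).
  have := @is_form_fwedge _ _ _ A _ _ _ (@smooth_cst R M 1) (sk p.1) (sk p.2).
  rewrite fwedge_form0; congr is_form.
  by apply/functional_extensionality_dep => y; apply/funext => s; rewrite mul1r.
pose th2 y := 2 * (th y * th y).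
have sth := df_smooth D.
have sth2 : smooth th2 by apply: smoothM; [exact: smooth_cst|exact: smoothM].
have FE : (fun y s => \sum_(p <- index_enum _) F p y s) = fwedge (form0 th2) w.
  rewrite fwedge_form0.
  apply/functional_extensionality_dep => y; apply/funext => s.
  have [|s2] := eqVneq (size s) 2; last first.
    rewrite (form2_degree fw s2) mulr0 big1// => p _.
    exact: (form2_degree (fF p) s2).
  case: s => [|u [|v [|? ?]]] // _.
  rewrite (evE hAK) -(dual_frame_form2 _ _ D); apply: eq_bigr => p _.
  by rewrite /F fwedge_form0 fwedge_flat.
have pairs (u v : sec E) : smooth_sec u -> smooth_sec v ->
    smooth (fun y => cpair (u y) (v y)) by exact: pair_smooth.
have swed p : smooth (fun y => cpair (k p.1 y) (a y) * cpair (k p.2 y) (c y)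
     - cpair (k p.1 y) (c y) * cpair (k p.2 y) (a y)).
  by apply: smoothD; [|apply: smoothN]; apply: smoothM; exact: pairs.
(* the same combination computed with the derivation property of [S] and with
   that of the Lie derivative *)
have LS : \sum_p (anchor (xi' x) (W p) * (cpair (k p.1 x) (a x) *
      cpair (k p.2 x) (c x) - cpair (k p.1 x) (c x) * cpair (k p.2 x) (a x)) +
    W p x * (cpair (bracket xi' (k p.1) x) (a x) * cpair (k p.2 x) (c x)
      - cpair (bracket xi' (k p.1) x) (c x) * cpair (k p.2 x) (a x)
      + (cpair (k p.1 x) (a x) * cpair (bracket xi' (k p.2) x) (c x)
      - cpair (k p.1 x) (c x) * cpair (bracket xi' (k p.2) x) (a x)))) =
    anchor (xi' x) th2 * ev w (a x) (c x) +
    th2 x * S (flat xi') w x [:: pr A K (a x); pr A K (c x)].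
  have := congr1 (fun w => S (flat xi') w x [:: pr A K (a x); pr A K (c x)]) FE.
  rewrite (schouten_form0_wedge sth2 fw) (schouten_sum _ fxi fF) => <-.
  apply: eq_bigr => p _; rewrite (schouten_form0_wedge (sW p) (fkk p)).
  rewrite schouten_flat_wedge// fwedge_flat /wedge_pair !vsval_pr.
  by rewrite !(pA_id hAK).
have LL : \sum_p (anchor (xi' x) (W p) * (cpair (k p.1 x) (a x) *
      cpair (k p.2 x) (c x) - cpair (k p.1 x) (c x) * cpair (k p.2 x) (a x)) +
    W p x * anchor (xi' x) (fun y => cpair (k p.1 y) (a y) *
      cpair (k p.2 y) (c y) - cpair (k p.1 y) (c y) * cpair (k p.2 y) (a y))) =
    anchor (xi' x) th2 * ev w (a x) (c x) +
    th2 x * anchor (xi' x) (fun y => ev w (a y) (c y)).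
  have sev := ev_smooth hAK fw ha hc.
  rewrite addrC [X in _ + X]mulrC -(anchorM _ sth2 sev).
  rewrite (_ : (fun y => _) = (fun y => \sum_p W p y *
      (cpair (k p.1 y) (a y) * cpair (k p.2 y) (c y)
       - cpair (k p.1 y) (c y) * cpair (k p.2 y) (a y)))); last first.
    by apply/funext => y; rewrite -(dual_frame_form2 _ _ D).
  rewrite anchor_sum; last by move=> p; apply: smoothM (sW p) (swed p).
  apply: eq_bigr => p _; rewrite (anchorM _ (sW p) (swed p)).
  by rewrite addrC [X in _ + X]mulrC.
have th20 : th2 x != 0 by rewrite !mulf_neq0 ?(df_neq0 D)// pnatr_eq0.
(* Multiplied by [th2] and completed by the derivative of [th2], the identity can be compared term
   by term through [LS] and [LL]. *)
apply: (mulfI th20); apply: (addrI (anchor (xi' x) th2 * ev w (a x) (c x))).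
rewrite -LS !mulrBr !addrA -LL -!(dual_frame_form2 _ _ D) -!sumrB.
apply: eq_bigr => p _; rewrite -!addrA; congr (_ + _).
have m k' e : smooth_sec k' -> smooth_sec e ->
  anchor (xi' x) (fun y => cpair (k' y) (e y)) =
    cpair (bracket xi' k' x) (e x) + cpair (k' x) (bracket xi' e x).
  by move=> *; exact: courant_metric.
rewrite anchorD; last first.
- by apply: smoothN; apply: smoothM; exact: pairs.
- by apply: smoothM; exact: pairs.
rewrite anchorN; last by apply: smoothM; exact: pairs.
rewrite !anchorM; try exact: pairs.
rewrite !m// -/(W p x); ring.
Qed.

Lemma schouten_degree x (s : seq (sfiber A x)) :
  size s != 2 -> S (flat xi') w x s = 0.
Proof. by have := schouten_form _ _ hS _ _ _ _ fxi fw => f; exact: (form2_degree f). Qed.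

End Form2.
End Schouten.

(** * The evolution equation as an infinitesimal action *)

Section EvolutionRhs.
Context {R : realType} {M : smooth_manifold R} {E : courant M}.
Context {A K : subbundle E}.
Hypotheses (lagA : is_lagrangian A) (lagK : is_lagrangian K).
Hypothesis (hAK : is_complement A K).
Local Notation ev := (@ev R M E A K).

Lemma bracket_combl n (c : 'I_n -> R) (k : 'I_n -> sec E) s x (v : E x) :
  (forall i, sec_in K (k i)) -> sec_in K s ->
  cpair (bracket (fun y => \sum_i c i *: k i y) s x) v =
    \sum_i c i * cpair (bracket (k i) s x) v.
Proof.
move=> hk hs.
have hc : sec_in K (fun y => \sum_i c i *: k i y).
  split; first by apply: smooth_sec_sum => i _; apply: smooth_sec_cstZ; exact: (hk i).1.
  by move=> y; apply: memv_suml => i _; rewrite memvZ//; exact: (hk i).2.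
rewrite (bracket_skew12 v lagK hc hs) bracket_sumr.
- rewrite pair_suml -sumrN; apply: eq_bigr => i _.
  rewrite bracketZr; [|exact: hs.1|exact: (hk i).1|exact: smooth_cst].
  by rewrite anchor_cst scale0r addr0 pairZl (bracket_skew12 v lagK hs (hk i)) mulrN opprK.
- exact: hs.1.
- by move=> i; apply: smooth_sec_cstZ; exact: (hk i).1.
Qed.

(** By tensoriality [s1] and [s2] may be replaced by combinations of the [k i] with constant
    coefficients, for which the anchor terms of the Leibniz rule vanish. *)
Lemma bracket_trilinear n (k : 'I_n -> sec E) (c1 c2 c3 : 'I_n -> R) s1 s2 s3 x :
  (forall i, sec_in K (k i)) -> sec_in K s1 -> sec_in K s2 -> sec_in K s3 ->
  s1 x = \sum_i c1 i *: k i x -> s2 x = \sum_i c2 i *: k i x ->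
  s3 x = \sum_i c3 i *: k i x ->
  \sum_i \sum_j \sum_l cpair (bracket (k i) (k j) x) (k l x) *
    (c1 i * c2 j * c3 l) = cpair (bracket s1 s2 x) (s3 x).
Proof.
move=> hk h1 h2 h3 e1 e2 e3.
have hcomb (c : 'I_n -> R) : sec_in K (fun y => \sum_i c i *: k i y).
  split; first by apply: smooth_sec_sum => i _; apply: smooth_sec_cstZ; exact: (hk i).1.
  by move=> y; apply: memv_suml => i _; rewrite memvZ//; exact: (hk i).2.
rewrite -[RHS](pair_pA lagK hAK _ (h3.2 x)).
rewrite (bracketK_tensor lagA lagK hAK h1 h2 (hcomb c1) (hcomb c2))//.
rewrite (pair_pA lagK hAK _ (h3.2 x)).
rewrite bracket_combl//; apply: eq_bigr => i _.
rewrite bracket_sumr; last first.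
- by move=> j; apply: smooth_sec_cstZ; exact: (hk j).1.
- exact: (hk i).1.
rewrite pair_suml mulr_sumr; apply: eq_bigr => j _.
rewrite bracketZr; [|exact: (hk i).1|exact: (hk j).1|exact: smooth_cst].
rewrite anchor_cst scale0r addr0 pairZl e3 pair_sumr mulrA mulr_sumr.
by apply: eq_bigr => l _; rewrite pairZr; ring.
Qed.

Section Form2.
Variables (w : extform A) (fw : is_form 2 w).
Arguments w : clear implicits.
Variables (xi : sec (sfiber K)) (hxi : smooth_ssec xi).
Let xi' := incl_sec xi.
Variables (a c ka kc : sec E).
Hypotheses (ha : sec_in A a) (hc : sec_in A c).
Hypotheses (hka : sec_in K ka) (hkc : sec_in K kc).
Hypothesis kaE : forall x v, v \in A x -> cpair (ka x) v = ev w (a x) v.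
Hypothesis kcE : forall x v, v \in A x -> cpair (kc x) v = ev w (c x) v.

(** The contraction gives Psi(xi, ka, kc) - Psi(xi, kc, ka), and skew symmetry doubles it; this 2
    cancels the 1/2 in the equation. The signs from w(e_j, a) = - w(a, e_j) occur in pairs. *)
Lemma sharp_wedge_PsiE x :
  sharp_wedge_Psi K (flat xi') w w x [:: pr A K (a x); pr A K (c x)] =
    2 * cpair (bracket xi' ka x) (kc x).
Proof.
have hxi' : sec_in K xi' := sec_in_incl hxi.
pose e := vbasis {: sfiber A x}.
(* Sections of [K] that represent at [x] the basis dual to the basis [e] of [A x]. *)
have kex i : exists k : sec E, sec_in K k /\
    forall s : sfiber A x, cpair (k x) (vsval s) = coord e i s.
  have [|v vK vE] := represent lagK hAK (x := x)
      (h := fun u => coord e i (pr A K u)).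
    by move=> r u v; rewrite pr_linear linearP.
  have [k [sk mk kv]] := subbundle_sec_through vK.
  exists k; split => // s.
  by rewrite kv vE ?subvsP// pr_vsval.
have [k kP] := choice kex.
have hk i : sec_in K (k i) := (kP i).1.
have T3E i j l : Psi K x (coord e i) (coord e j) (coord e l) =
    cpair (bracket (k i) (k j) x) (k l x).
  have [hi ei] := extKP lagA hAK (hk i) (kP i).2.
  have [hj ej] := extKP lagA hAK (hk j) (kP j).2.
  rewrite /Psi -(kP l).2 /Psi_vec vsval_pr.
  rewrite (bracketK_tensor lagA lagK hAK hi hj (hk i) (hk j) ei ej).
  by rewrite pair_sym (pair_pA lagK hAK)//; exact: (hk l).2.
rewrite /sharp_wedge_Psi extend_trivector_sharp.
- rewrite (eq_bigr (fun i => \sum_j \sum_l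
    cpair (bracket (k i) (k j) x) (k l x) * (cpair (xi' x) (vsval e`_i) *
      cpair (ka x) (vsval e`_j) * cpair (kc x) (vsval e`_l))
    - \sum_j \sum_l
    cpair (bracket (k i) (k j) x) (k l x) * (cpair (xi' x) (vsval e`_i) *
      cpair (kc x) (vsval e`_j) * cpair (ka x) (vsval e`_l)))); last first.
    move=> i _; rewrite -sumrB; apply: eq_bigr => j _.
    rewrite -sumrB; apply: eq_bigr => l _; rewrite -mulrBr -T3E.
    congr (_ * _); rewrite !(evE hAK) !vsval_pr !(ev_pAr hAK) /=.
    rewrite !kaE ?kcE ?subvsP// !(ev_skew fw _ (a x)) !(ev_skew fw _ (c x)).
    ring.
  rewrite sumrB.
  have dec u : sec_in K u -> u x = \sum_(i < \dim {: sfiber A x}) cpair (u x) (vsval e`_i) *: k i x.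
    move=> hu; apply/eqP; rewrite -subr_eq0; apply/eqP.
    apply: (complement_pair0 lagA hAK).
      rewrite memvB//; first exact: hu.2.
      by apply: memv_suml => i _; rewrite memvZ//; exact: (hk i).2.
    move=> v vA; rewrite pairDl pairNl pair_suml.
    have vE : v = vsval (pr A K v) by rewrite vsval_pr (pA_id hAK).
    rewrite {1}vE (coord_vbasis (memvf (pr A K v))) linear_sum pair_sumr.
    apply/eqP; rewrite subr_eq0; apply/eqP; apply: eq_bigr => i _.
    by rewrite linearZ /= pairZr pairZl [in RHS]vE (kP i).2 mulrC.
  rewrite (bracket_trilinear hk hxi' hka hkc (dec _ hxi') (dec _ hka) (dec _ hkc)).
  rewrite (bracket_trilinear hk hxi' hkc hka (dec _ hxi') (dec _ hkc) (dec _ hka)).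
  rewrite (bracket_skew23 x lagK hxi hkc hka) (pair_sym (kc x)); ring.
- by move=> i j l; rewrite !T3E; exact: (bracket_skew12 _ lagK).
- move=> i j l; rewrite !T3E (bracket_skew23 x lagK _ (hk j) (hk l)).
    by rewrite pair_sym.
  exact: (hk i).1.
- by move=> s; exact: flat_degree.
- by move=> s; exact: form2_degree.
Qed.

Context {S : extform A -> extform A -> extform A}.
Hypothesis hS : is_schouten K S.
Hypothesis invA : is_involutive A.

(* The right-hand side of the evolution equation is the infinitesimal action
   of [bracket xi] on the graph of [w]. *)
Lemma evolution_rhsE x :
  evolution_rhs K S xi w x [:: pr A K (a x); pr A K (c x)] =
    cpair (bracket xi' (fun y => a y + ka y) x) (c x + kc x).
Proof.
have [sa sc ska skc] := And4 ha.1 hc.1 hka.1 hkc.1.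
rewrite /evolution_rhs (dA_flat lagA hAK invA hxi x ha hc) -/xi'.
rewrite sharp_wedge_PsiE (schouten_form2 lagA lagK hAK hS hxi fw x ha hc) -/xi'.
have -> : (fun y => ev w (a y) (c y)) = (fun y => cpair (ka y) (c y)).
  by apply/funext => y; rewrite kaE//; exact: hc.2.
rewrite courant_metric//.
(* This term cancels the second half of the metric axiom applied to <ka, c>. *)
have -> : ev w (a x) (bracket xi' c x) = cpair (bracket xi' c x) (ka x).
  by rewrite -(ev_pAr hAK) -kaE ?pA_mem// pair_sym (pair_pA lagK hAK _ (hka.2 x)).
have -> : ev w (bracket xi' a x) (c x) = - cpair (bracket xi' a x) (kc x).
  rewrite (ev_skew fw) -(ev_pAr hAK) -kcE ?pA_mem// pair_sym.
  by rewrite (pair_pA lagK hAK _ (hkc.2 x)).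
rewrite bracketDr// pairDl !pairDr (pair_sym (ka x) (bracket xi' c x)).
rewrite opprK mulrA mulVf ?pnatr_eq0// mul1r.
ring.
Qed.

Lemma evolution_rhs_degree x (s : seq (sfiber A x)) : size s != 2 ->
  evolution_rhs K S xi w x s = 0.
Proof.
move=> s2; rewrite /evolution_rhs dA_flat_degree// (schouten_degree hS hxi fw s2).
rewrite /sharp_wedge_Psi extend_trivector_degree//.
- by rewrite oppr0 mulr0 !addr0.
- by move=> t; exact: flat_degree.
- by move=> t; exact: form2_degree.
Qed.

End Form2.
End EvolutionRhs.

(** * Derivatives along the flow *)

Section TimeDerivatives.
Context {R : realType} {M : smooth_manifold R}.

Lemma differentiable_idfun (t : R) : differentiable (fun s : R => s) t.
Proof. by have [] := is_diff_id t. Qed.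

Lemma smooth_fam_at_derivable (h : R -> M -> R) (t : R) (x : M) :
  smooth_fam_at h t x -> derivable (fun s => h s x) t 1.
Proof.
move=> sh; have [i dx] := chart_cover x.
have dH := smooth_germ_diff (sh i dx).
have dp : differentiable (fun s : R => (s, chart i x)) t.
  by apply: differentiable_pair; [exact: differentiable_idfun|exact: differentiable_cst].
apply/derivable1_diffP.
have := differentiable_comp dp dH.
by congr (differentiable _ _); apply/funext => s /=; rewrite chartK.
Qed.

(** Differentiability of a curve in [M] is tested on global smooth functions; the coordinates of a
    chart become such after multiplication by a bump function. *)
Lemma chart_coord_cutoff (i : chart_idx M) (y : M) : chart_dom i y ->
  exists (b : M -> R) (g : 'I_(mdim M) -> M -> R),
  [/\ smooth b, b y != 0, forall k, smooth (g k),
      forall z, b z != 0 -> chart_dom i z &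
      forall z k, g k z = b z * chart i z 0 k].
Proof.
move=> dy; have [b [C [sb b0 cC CU bC]]] :=
  smooth_bump (@chart_dom_open R M i) dy.
exists b, (fun k z => b z * chart i z 0 k); split => //; last first.
  move=> z bz; apply: CU; apply: contrapT => /bC bz0.
  by rewrite bz0 eqxx in bz.
move=> k; apply/smooth_fam_atP => z.
have [dz|ndz] := pselect (chart_dom i z).
  apply: smooth_fam_atM; first exact: smooth_fam_at_const.
  exact: chart_coord_smooth.
apply: smooth_fam_at_ext (@smooth_fam_at_cst _ _ 0 0 z).
have : nbhs z (~` C).
  by apply: open_nbhs_nbhs; split; [exact: closed_openC|move=> /CU].
by move=> /(near_snd 0) H; near=> p; rewrite bC ?mul0r//; near: p.
Unshelve. all: by end_near. Qed.

Section AlongCurve.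
Variables (c : R -> M) (t : R).
Hypothesis dc : forall f : M -> R, smooth f -> derivable (f \o c) t 1.

Let dcont (f : M -> R) : smooth f -> {for t, continuous (f \o c)}.
Proof. by move=> /dc/derivable1_diffP/differentiable_continuous. Qed.

(** The coordinates along the curve are the quotients of [g k] by [b], and the nonvanishing of [b],
    an open condition in time, keeps the curve inside the chart. *)
Lemma chart_curve_differentiable (i : chart_idx M) : chart_dom i (c t) ->
  (\near t, chart_dom i (c t)) /\
  differentiable (fun s => chart i (c s) : 'rV[R]_(mdim M)) t.
Proof.
move=> dy; have [b [g [sb b0 sg bd gE]]] := chart_coord_cutoff dy.
have nb : \near t, b (c t) != 0.
  exact: (cvgr_neq0 _ (dcont sb) b0).
split; first by near=> s; apply: bd; near: s.
apply/derivable1_diffP/derivable_mxP => r k.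
apply: (@near_eq_derivable _ _ _ (fun s => (b (c s))^-1 * g k (c s))).
  near=> s; have bs : b (c s) != 0 by near: s.
  by rewrite gE mulrA mulVf// mul1r ord1.
apply: derivableM; last exact: dc (sg k).
by apply: derivableV => //; exact: dc sb.
Unshelve. all: by end_near. Qed.

Lemma derivable_along_curve (h : R -> M -> R) :
  smooth_fam_at h t (c t) -> derivable (fun s => h s (c s)) t 1.
Proof.
move=> sh; have [i dx] := chart_cover (c t).
have [nd dch] := chart_curve_differentiable dx.
have dH := smooth_germ_diff (sh i dx).
have dp : differentiable (fun s : R => (s, chart i (c s))) t.
  by apply: differentiable_pair => //; exact: differentiable_idfun.
have /derivable1_diffP := differentiable_comp dp dH.
apply: near_eq_derivable; near=> s.
by rewrite /= chartK//; near: s.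
Unshelve. all: by end_near. Qed.

(** In a chart [h] is jointly differentiable, so its derivative in the direction (1, v) is the sum
    of those in the directions (1, 0) and (0, v), which are [d1] and [d2]. *)
Lemma is_derive_along_curve (h : R -> M -> R) (d1 d2 : R) :
  smooth_fam_at h t (c t) -> is_derive t 1 (fun s => h s (c t)) d1 ->
  is_derive t 1 (fun s => h t (c s)) d2 ->
  is_derive t 1 (fun s => h s (c s)) (d1 + d2).
Proof.
move=> sh [_ e1] [_ e2]; have [i dx] := chart_cover (c t).
have [nd dch] := chart_curve_differentiable dx.
have dH := smooth_germ_diff (sh i dx).
pose H (p : R * 'rV[R]_(mdim M)) := h p.1 (chart_inv i p.2).
pose g s : 'rV[R]_(mdim M) := chart i (c s).
have did : differentiable (fun s : R => s) t by exact: differentiable_idfun.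
have dpa : differentiable (fun s : R => (s, g s)) t by exact: differentiable_pair.
have dp1 : differentiable (fun s : R => (s, g t)) t.
  by apply: differentiable_pair => //; exact: differentiable_cst.
have dp2 : differentiable (fun s : R => (t, g s)) t.
  by apply: differentiable_pair => //; exact: differentiable_cst.
pose v := 'd g t 1.
have da : is_derive t 1 (fun s => h s (c s)) ('d H (t, g t) (1, v)).
  apply: (@near_eq_is_derive _ _ _ (H \o (fun s => (s, g s)))).
    by near=> s; rewrite /H /g /= chartK//; near: s.
  apply: DeriveDef; first exact/diff_derivable/differentiable_comp.
  rewrite deriveE; last exact: differentiable_comp.
  rewrite diff_comp//= diff_pair//=.
  by have [_ ->] := is_diff_id t.
have d1E : d1 = 'd H (t, g t) (1, 0).
  rewrite -e1; have [_ <-] // : is_derive t 1 (fun s => h s (c t))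
    ('d H (t, g t) (1, 0)).
  apply: (@near_eq_is_derive _ _ _ (H \o (fun s => (s, g t)))).
    by near=> s; rewrite /H /g /= chartK.
  apply: DeriveDef; first exact/diff_derivable/differentiable_comp.
  rewrite deriveE; last exact: differentiable_comp.
  rewrite (diff_comp dp1 dH) /= (diff_pair did (differentiable_cst (g t) t)) /=.
  by rewrite diff_cst; have [_ ->] := is_diff_id t.
have d2E : d2 = 'd H (t, g t) (0, v).
  rewrite -e2; have [_ <-] // : is_derive t 1 (fun s => h t (c s))
    ('d H (t, g t) (0, v)).
  apply: (@near_eq_is_derive _ _ _ (H \o (fun s => (t, g s)))).
    by near=> s; rewrite /H /g /= chartK//; near: s.
  apply: DeriveDef; first exact/diff_derivable/differentiable_comp.
  rewrite deriveE; last exact: differentiable_comp.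
  rewrite (diff_comp dp2 dH) /= (diff_pair (differentiable_cst t t) dch) /=.
  by rewrite diff_cst.
rewrite d1E d2E -linearD; have -> : (1, 0) + (0, v) = (1, v) :> R * _.
  by rewrite /GRing.add /=; congr pair; rewrite ?addr0 ?add0r.
exact: da.
Unshelve. all: by end_near. Qed.

End AlongCurve.
End TimeDerivatives.

Section Flow.
Context {R : realType} {M : smooth_manifold R} {E : courant M}.
Variables (xi : sec E) (sxi : smooth_sec xi) (Phi : R -> automorphism E).
Hypothesis hPhi : is_flow_of xi Phi.

Lemma flow_baseNK t x : abase (Phi t) (abase (Phi (- t)) x) = x.
Proof. by rewrite -(flow_baseD hPhi) subrr (flow_base0 hPhi). Qed.

Lemma flow_base_inv t x : abase_inv (Phi t) x = abase (Phi (- t)) x.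
Proof. by rewrite -{1}(flow_baseNK t x) (abaseK (Phi t)). Qed.

Lemma push_smooth_at (u : sec E) t x : smooth_sec u ->
  smooth_sec_at (fun t => push (Phi t) u) t x.
Proof.
by move=> su; apply: smooth_sec_family_at (flow_smooth hPhi su) _ => //; exact: openT.
Qed.

Lemma flow_curve_derivable x (f : M -> R) t : smooth f ->
  derivable (f \o (fun s => abase (Phi s) x)) t 1.
Proof.
move=> sf; apply: (@smooth_fam_at_derivable _ _ (fun s => f \o abase (Phi s))).
by apply: (smooth_family_in_fam_at _ _ (flow_base_smooth hPhi sf)) => //; exact: openT.
Qed.

Lemma is_derive_push_pair (u : sec E) (t : R) x (v : E x) : smooth_sec u ->
  is_derive t 1 (fun s => cpair (push (Phi s) u x) v)
    (cpair (bracket xi (push (Phi t) u) x) v).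
Proof.
move=> su; pose c i := coord (vbasis {:E x}) i.
have cE (w : E x) : cpair w v = \sum_i c i w * cpair (vbasis {:E x})`_i v.
  rewrite {1}(coord_vbasis (memvf w)) pair_suml.
  by apply: eq_bigr => i _; rewrite pairZl.
rewrite cE (_ : (fun s => _) = \sum_(i < \dim {:E x})
    (fun s => c i (push (Phi s) u x) * cpair (vbasis {:E x})`_i v)); last first.
  by apply/funext => s; rewrite cE fct_sumE.
apply: is_derive_sum => i.
have := is_deriveM (flow_derive hPhi su t i)
  (is_derive_cst (cpair (vbasis {:E x})`_i v) t (1 : R)).
move/is_derive_eq; apply.
by rewrite scaler0 add0r /GRing.scale /= mulrC.
Qed.

(** The flow is linked to [xi] through transported sections. The ratio of the transports of [f u]
    and [u] is [f] along the flow at time [- s]; the Leibniz rule gives the anchor term as its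
    derivative at 0, and reversing time gives the sign. The nonzero vector [v] makes the ratio
    meaningful. *)
Lemma is_derive_flow_base0 (f : M -> R) x (v : E x) : v != 0 -> smooth f ->
  is_derive (0 : R) 1 (fun s => f (abase (Phi s) x)) (- anchor (xi x) f).
Proof.
move=> v0 sf; have [u [su ux]] := sec_through v.
have [z pz] : exists z, cpair v z != 0.
  apply: contrapT => /forallNP H; move/eqP: v0; apply.
  by apply: pair_nondegenerate => z; apply/eqP; apply: contrapT => /negP; exact: H.
have sfu := smooth_secZ sf su.
pose g s := cpair (push (Phi s) u x) z.
pose h s := cpair (push (Phi s) (fun y => f y *: u y) x) z.
have hE s : h s = f (abase (Phi (- s)) x) * g s.
  by rewrite -flow_base_inv /h /push linearZ /= pairZl.
have dg := is_derive_push_pair 0 z su; have dh := is_derive_push_pair 0 z sfu.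
rewrite (flow0 hPhi su) in dg; rewrite (flow0 hPhi sfu) bracketZr// in dh.
have g0 : g 0 = cpair v z by rewrite /g (flow0 hPhi su) ux.
have g0n : g 0 != 0 by rewrite g0.
have h0 : h 0 = f x * g 0 by rewrite hE oppr0 (flow_base0 hPhi).
have dq := is_deriveM dh (is_deriveV g0n dg).
have dF : is_derive (0 : R) 1 (fun s => f (abase (Phi (- s)) x)) (anchor (xi x) f).
  apply: (near_eq_is_derive _ (is_derive_eq dq _)).
    have gn : \forall s \near (0 : R), g s != 0.
      have cg : {for 0, continuous g}.
        apply: differentiable_continuous; apply/derivable1_diffP.
        by have [] := dg.
      exact: (cvgr_neq0 (g 0) cg g0n).
    near=> s; have gs : g s != 0 by near: s.
    by rewrite fctE -/(h s) -/(g s) hE mulfK.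
  rewrite -/(h 0) h0 -/(g 0) pairDl !pairZl ux -g0 /GRing.scale /=.
  by field.
have dN : is_derive (0 : R) 1 (fun s : R => - s) (- 1).
  exact: is_deriveNid.
have := @is_derive1_comp R (fun s => f (abase (Phi (- s)) x)) (fun s => - s) 0.
rewrite oppr0 => /(_ _ _ dF dN); rewrite mulrN1.
by congr (is_derive _ _ _ _); apply/funext => s; rewrite /= opprK.
Unshelve. all: by end_near. Qed.

Lemma is_derive_flow_base (t : R) (f : M -> R) x (v : E (abase (Phi t) x)) :
  v != 0 -> smooth f ->
  is_derive t 1 (fun s => f (abase (Phi s) x))
    (- anchor (xi (abase (Phi t) x)) f).
Proof.
move=> v0 sf; have d0 := is_derive_flow_base0 v0 sf.
have dS : is_derive t 1 (fun s : R => s - t) 1.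
  have := is_deriveB (is_derive_id t 1) (is_derive_cst t t (1 : R)).
  by rewrite subr0.
have := @is_derive1_comp R (fun s => f (abase (Phi s) (abase (Phi t) x)))
  (fun s => s - t) t.
rewrite subrr => /(_ _ _ d0 dS); rewrite mulr1.
congr (is_derive _ _ _ _); apply/funext => s /=.
by rewrite -(flow_baseD hPhi) subrK.
Qed.

End Flow.

(** * The flow of a graph solves the evolution equation *)

Section Graphs.
Context {R : realType} {M : smooth_manifold R} {E : courant M}.
Context {A K : subbundle E}.
Hypotheses (lagA : is_lagrangian A) (lagK : is_lagrangian K).
Hypothesis (hAK : is_complement A K).
Local Notation pA := (@pA R M E A K _).
Local Notation ev := (@ev R M E A K).

(** The component of [e] in [A] pairs to 0 with [A], and [ev] ignores the component in [K]; hence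
    the graph is cut out by equations on [e] itself. *)
Lemma form_graphP (w : extform A) x (e : E x) : form_graph K w x e <->
  forall b, b \in A x -> cpair e b = ev w e b.
Proof.
split=> [[a [k [-> kE]]] b bA|H].
  have prb : vsval (pr A K b) = b by rewrite vsval_pr (pA_id hAK).
  rewrite pairDl (lag_pair0 lagA (subvsP a) bA) add0r -{1}prb kE /iota_form /ev.
  congr (w x [:: _; _]); apply/val_inj; rewrite /= vsval_pr (pAD (K := K)).
  by rewrite (pA_id hAK) ?subvsP// (pA_K hAK) ?subvsP// addr0.
exists (pr A K e), (pr K A e); split.
  by rewrite !vsval_pr (pApK hAK).
move=> b; rewrite vsval_pr /iota_form (evE hAK) vsval_pr (ev_pAl hAK) -H ?subvsP//.
by rewrite -[RHS](pair_pK lagA hAK _ (subvsP b)).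
Qed.

Lemma graph_of_sections (w : extform A) (a k : sec E) x :
  is_form 2 w -> a x \in A x -> k x \in K x ->
  (forall v, v \in A x -> cpair (k x) v = ev w (a x) v) ->
  form_graph K w x (a x + k x).
Proof.
move=> fw aA kK kE; apply/form_graphP => b bA.
rewrite pairDl (lag_pair0 lagA aA bA) add0r kE//.
by rewrite -[RHS](ev_pAl hAK) pAD (pA_id hAK aA) (pA_K hAK kK) addr0.
Qed.

(** The section is one of [A] through the [A]-part of [e], plus its contraction with [w]; at [x] the
    latter is the [K]-part of [e], since both pair in the same way with [A x]. *)
Lemma graph_section (w : extform A) x (e : E x) : is_form 2 w ->
  form_graph K w x e ->
  exists u : sec E, [/\ smooth_sec u, u x = e & forall y, form_graph K w y (u y)].
Proof.
move=> fw ge; have [a [sa aA ax]] := subbundle_sec_through (pA_mem (A := A) (K := K) e).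
have [k hk kE] := form_section lagA lagK hAK fw (conj sa aA).
exists (fun y => a y + k y); split.
- by apply: smooth_secD => //; exact: hk.1.
- rewrite ax -[RHS](pApK hAK e); congr (_ + _); apply/eqP; rewrite -subr_eq0.
  apply/eqP; apply: (complement_pair0 lagA hAK).
    by rewrite memvB ?pK_mem//; exact: hk.2.
  move=> v vA; rewrite pairDl pairNl kE// (pair_pK lagA hAK)//.
  by rewrite ax (ev_pAl hAK) ((form_graphP _ _).1 ge)// subrr.
- move=> y; apply: graph_of_sections => //; first exact: hk.2.
  by move=> v; exact: kE.
Qed.

Lemma graph_over (w : extform A) x (a : E x) : is_form 2 w -> a \in A x ->
  exists2 e, form_graph K w x e & pA e = a.
Proof.
move=> fw aA; have [|k kK kE] := represent lagK hAK (x := x) (h := ev w a).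
  by move=> c u v; rewrite (ev_linr fw).
exists (a + k); last by rewrite pAD (pA_id hAK aA) (pA_K hAK kK) addr0.
apply/form_graphP => b bA; rewrite pairDl (lag_pair0 lagA aA bA) add0r kE//.
by rewrite -[RHS](ev_pAl hAK) pAD (pA_id hAK aA) (pA_K hAK kK) addr0.
Qed.

End Graphs.

(** * Smoothness and time derivative of the transported graph *)

Section Existence.
Context {R : realType} {M : smooth_manifold R} {E : courant M}.
Context {A K : subbundle E}.
Hypotheses (lagA : is_lagrangian A) (lagK : is_lagrangian K).
Hypothesis (hAK : is_complement A K).
Local Notation pA := (@pA R M E A K _).
Local Notation pK := (@pK R M E A K _).
Local Notation ev := (@ev R M E A K).
Hypothesis invA : is_involutive A.
Context {S : extform A -> extform A -> extform A}.
Hypothesis hS : is_schouten K S.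
Variables (xi : sec (sfiber K)) (hxi : smooth_ssec xi).
Let xi' := incl_sec xi.
Variables (Phi : R -> automorphism E) (hPhi : is_flow_of xi' Phi).
Variables (eps : extform A) (feps : is_form 2 eps).
Variables (delta : R) (hdelta : 0 < delta) (epst : R -> extform A).
Arguments eps : clear implicits.
Arguments epst : clear implicits.
Hypothesis hform : forall t, `|t| < delta -> is_form 2 (epst t).
Hypothesis hgraph : forall t, `|t| < delta -> forall x,
  form_graph K (epst t) x =
    afib (Phi t) x @` form_graph K eps (abase_inv (Phi t) x).

Lemma open_time : open [set t : R | `|t| < delta].
Proof.
rewrite (_ : [set t | _] = ball (0 : R) delta); first exact: ball_open.
by apply/seteqP; split => t; rewrite -ball_normE /= sub0r normrN.
Qed.

Lemma push_graph t x (u : sec E) : `|t| < delta ->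
  (forall y, form_graph K eps y (u y)) -> form_graph K (epst t) x (push (Phi t) u x).
Proof. by move=> ht gu; rewrite hgraph//; exists (u (abase_inv (Phi t) x)). Qed.

Lemma graph_push_section t x (e : E x) : `|t| < delta ->
  form_graph K (epst t) x e -> exists u : sec E,
  [/\ smooth_sec u, push (Phi t) u x = e & forall y, form_graph K eps y (u y)].
Proof.
move=> ht; rewrite hgraph// => -[e0 g0 <-].
have [u [su ux gu]] := graph_section lagA lagK hAK feps g0.
by exists u; split => //; rewrite /push ux.
Qed.

Lemma epst_smooth a c t x : sec_in A a -> sec_in A c -> `|t| < delta ->
  smooth_fam_at (fun t x => ev (epst t) (a x) (c x)) t x.
Proof.
move=> ha hc ht.
(* [P r y] expresses the projections to A of the transported sections [u i] in
   the frame [b]; it is invertible near [(t, x)] by the choice of [u]. *)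
have [n [b [k [th D]]]] := exists_dual_frame lagA lagK hAK x.
have /choice[u uP] : forall i : 'I_n, exists u : sec E,
    [/\ smooth_sec u, pA (push (Phi t) u x) = b i x &
        forall y, form_graph K eps y (u y)].
  move=> i; have [e ge eE] := graph_over lagA lagK hAK (hform ht) (df_memA D i x).
  have [u [su ux gu]] := graph_push_section ht ge.
  by exists u; split => //; rewrite ux.
pose P r y : 'M[R]_n := \matrix_(i, l) cpair (push (Phi r) (u i) y) (k l y).
pose Q i r y := cpair (push (Phi r) (u i) y) (c y).
have su i : smooth_sec (u i) by have [] := uP i.
have sP i l : smooth_fam_at (fun r y => P r y i l) t x.
  apply: (@smooth_fam_at_ext _ _
    (fun r y => cpair (push (Phi r) (u i) y) (k l y))).
    by near=> p; rewrite mxE.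
  apply: (pair_smooth_at (s1 := fun r => push (Phi r) (u i)) (s2 := fun=> k l)).
    exact: (push_smooth_at hPhi t (su i)).
  exact: smooth_sec_at_const (df_smoothK D l).
have sQ i : smooth_fam_at (Q i) t x.
  apply: (pair_smooth_at (s1 := fun r => push (Phi r) (u i)) (s2 := fun=> c)).
    exact: (push_smooth_at hPhi t (su i)).
  exact: smooth_sec_at_const hc.1.
have sdet := smooth_fam_at_det sP.
have det0 : \det (P t x) != 0.
  have -> : P t x = (th x)%:M.
    apply/matrixP => i l; rewrite !mxE -(pair_pA lagK hAK) ?(df_memK D)//.
    by have [_ -> _] := uP i; rewrite (df_dual D).
  by rewrite det_scalar expf_neq0// (df_neq0 D).
(* Cramer's rule for the system [PQ] below. The factor [th] of that system cancels the one from the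
   expansion of [a] in the frame [b]. *)
have H : smooth_fam_at (fun r y => (\det (P r y))^-1 *
    \sum_l cpair (a y) (k l y) * \sum_i (\adj (P r y)) l i * Q i r y) t x.
  apply: smooth_fam_atM; first exact: smooth_fam_atV det0 sdet.
  apply: smooth_fam_at_sum => l _; apply: smooth_fam_atM.
    apply: smooth_fam_at_const; apply: pair_smooth; first exact: ha.1.
    exact: df_smoothK D l.
  apply: smooth_fam_at_sum => i _; apply: smooth_fam_atM => //.
  exact: smooth_fam_at_adj.
apply: smooth_fam_at_ext H.
have nth0 := near_neq0 t (df_smooth D) (df_neq0 D).
have ndet : \forall p \near (t, x), \det (P p.1 p.2) != 0.
  have cd := smooth_fam_at_continuous sdet.
  exact: (cvgr_neq0 _ cd det0).
have nJ : \forall p \near (t, x), `|p.1| < delta.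
  have nt : nbhs t [set r : R | `|r| < delta].
    by apply: open_nbhs_nbhs; split; [exact: open_time|].
  exact: (@cvg_fst _ _ (nbhs t) (nbhs x) _ _ nt).
near=> p.
have pth : th p.2 != 0 by near: p.
have pdet : \det (P p.1 p.2) != 0 by near: p.
have pJ : `|p.1| < delta by near: p.
have fw := hform pJ.
have PQ i : \sum_l P p.1 p.2 i l * ev (epst p.1) (b l p.2) (c p.2) =
    th p.2 * Q i p.1 p.2.
  have [_ _ gu] := uP i; have := push_graph p.2 pJ gu.
  move=> /(form_graphP lagA hAK) gp; rewrite /Q gp; last exact: hc.2.
  rewrite -(ev_pAl hAK) -(evZl fw) (df_decompA D) ?pA_mem// (ev_suml fw).
  apply: eq_bigr => l _; rewrite mxE (evZl fw) (pair_pA lagK hAK)//.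
  exact: df_memK D _ _.
set P' := P p.1 p.2 in pdet PQ *.
have adjQ l : \det P' * ev (epst p.1) (b l p.2) (c p.2) =
    th p.2 * \sum_i (\adj P') l i * Q i p.1 p.2.
  transitivity (\sum_m (\adj P' *m P') l m * ev (epst p.1) (b m p.2) (c p.2)).
    rewrite mul_adj_mx (bigD1 l)//= big1 ?addr0 => [|m ml].
      by rewrite mxE eqxx mulr1n.
    by rewrite mxE eq_sym (negbTE ml) mul0r.
  under eq_bigr do rewrite mxE mulr_suml.
  rewrite exchange_big mulr_sumr; apply: eq_bigr => i _ /=.
  rewrite mulrCA -PQ mulr_sumr; apply: eq_bigr => m _; by rewrite mulrA.
apply: (mulfI pdet); rewrite mulVKf//; apply: (mulfI pth).
rewrite mulrCA -(evZl fw) (df_decompA D); last exact: ha.2.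
rewrite (ev_suml fw) !mulr_sumr; apply: eq_bigr => l _.
by rewrite (evZl fw) mulrCA [RHS]mulrCA adjQ.
Unshelve. all: by end_near. Qed.

Lemma epst_derive a c (t : R) x : sec_in A a -> sec_in A c -> `|t| < delta ->
  is_derive t 1 (fun r => ev (epst r) (a x) (c x))
    (evolution_rhs K S xi (epst t) x [:: pr A K (a x); pr A K (c x)]).
Proof.
move=> ha hc ht; have fw := hform ht.
(* A section of the graph of [eps] is chosen whose transport at time [t] lies over [a x]. *)
have [e ge eE] := graph_over lagA lagK hAK fw (ha.2 x).
have [u [su ue gu]] := graph_push_section ht ge.
pose U := push (Phi t) u; have sU : smooth_sec U := push_smooth (Phi t) su.
have gU y : form_graph K (epst t) y (U y) by exact: push_graph.
have [kc hkc kcE] := form_section lagA lagK hAK fw hc.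
have hpA := sec_in_pA lagA lagK hAK sU; have hpK := sec_in_pK lagA lagK hAK sU.
(* [U] splits into a section of [A] and its contraction with [epst t], as required to write the
   right-hand side as a pairing with a bracket. *)
have pKE y v : v \in A y -> cpair (pK (U y)) v = ev (epst t) (pA (U y)) v.
  move=> vA; rewrite (pair_pK lagA hAK _ vA) (ev_pAl hAK).
  exact: (form_graphP lagA hAK _ _).1 (gU y) _ vA.
have ax : a x = pA (U x) by rewrite /U ue eE.
rewrite ax (evolution_rhsE lagA lagK hAK fw hxi hpA hc hpK hkc pKE kcE hS invA).
have -> : (fun y => pA (U y) + pK (U y)) = U.
  by apply/functional_extensionality_dep => y; rewrite (pApK hAK).
have [n [b [k [th D]]]] := exists_dual_frame lagA lagK hAK x.
have hb l : sec_in A (b l) by split; [exact: df_smoothA D l|exact: df_memA D l].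
have db l : derivable (fun r => ev (epst r) (b l x) (c x)) t 1.
  exact: smooth_fam_at_derivable (epst_smooth (hb l) hc ht).
pose d l := 'D_1 (fun r => ev (epst r) (b l x) (c x)) t.
have nJ : \forall r \near t, `|r| < delta.
  by apply: open_nbhs_nbhs; split; [exact: open_time|].
have dec r (z : E x) : `|r| < delta -> th x * ev (epst r) z (c x) =
    \sum_l cpair z (k l x) * ev (epst r) (b l x) (c x).
  move=> hr; have fr := hform hr.
  rewrite -[ev _ z _](ev_pAl hAK) -(evZl fr) (df_decompA D) ?pA_mem// (ev_suml fr).
  apply: eq_bigr => l _; rewrite (evZl fr) (pair_pA lagK hAK)//.
  exact: df_memK D _ _.
have d1 : is_derive t 1 (fun r => th x * cpair (push (Phi r) u x) (c x))
    (\sum_l (cpair (U x) (k l x) * d l + ev (epst t) (b l x) (c x) *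
       cpair (bracket xi' U x) (k l x))).
  apply: (@near_eq_is_derive _ _ _ (\sum_(l < n) (fun r =>
      cpair (push (Phi r) u x) (k l x) * ev (epst r) (b l x) (c x)))).
    near=> r; have hr : `|r| < delta by near: r.
    have := push_graph x hr gu; move=> /(form_graphP lagA hAK) ->; last exact: hc.2.
    by rewrite dec// fct_sumE.
  apply: is_derive_sum => l.
  exact: (is_deriveM (is_derive_push_pair hPhi t _ su) (DeriveDef (db l) erefl)).
have d2 : is_derive t 1 (fun r => th x * cpair (push (Phi r) u x) (c x))
    (th x * cpair (bracket xi' U x) (c x)).
  exact: (is_deriveZ _ (is_derive_push_pair hPhi t _ su)).
have th0 := df_neq0 D.
(* The same function of time has been differentiated in two ways; the comparison isolates the
   derivatives [d l] of [epst]. *)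
have dv : th x * cpair (bracket xi' U x) (c x) =
    \sum_l cpair (U x) (k l x) * d l + th x * ev (epst t) (bracket xi' U x) (c x).
  have [_ <-] := d2; have [_ ->] := d1; rewrite big_split /= dec//; congr (_ + _).
  by apply: eq_bigr => l _; rewrite mulrC.
have d3 : is_derive t 1 (fun r => ev (epst r) (pA (U x)) (c x))
    ((th x)^-1 * \sum_l cpair (U x) (k l x) * d l).
  apply: (@near_eq_is_derive _ _ _ ((th x)^-1 \*: \sum_(l < n) (fun r =>
      cpair (U x) (k l x) * ev (epst r) (b l x) (c x)))).
    near=> r; have hr : `|r| < delta by near: r.
    by rewrite (ev_pAl hAK) -[RHS](mulKf th0) dec//= fct_sumE.
  apply: is_deriveZ; apply: is_derive_sum => l.
  exact: (is_deriveZ _ (DeriveDef (db l) erefl)).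
apply: (is_derive_eq d3).
apply: (mulfI th0); rewrite mulVKf// pairDr mulrDr dv -addrA -mulrDr.
rewrite (ev_skew fw) -(ev_pAr hAK) -kcE ?pA_mem// (pair_sym (kc x)).
rewrite (pair_pA lagK hAK); last exact: hkc.2.
by rewrite addNr mulr0 addr0.
Unshelve. all: by end_near. Qed.

End Existence.

Section Solution.
Context {R : realType} {M : smooth_manifold R} {E : courant M}.
Context {A K : subbundle E}.
Hypotheses (lagA : is_lagrangian A) (lagK : is_lagrangian K).
Hypothesis (hAK : is_complement A K).
Local Notation ev := (@ev R M E A K).
Hypothesis invA : is_involutive A.
Context {S : extform A -> extform A -> extform A}.
Hypothesis hS : is_schouten K S.
Variables (xi : sec (sfiber K)) (hxi : smooth_ssec xi).
Let xi' := incl_sec xi.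
Variables (Phi : R -> automorphism E) (hPhi : is_flow_of xi' Phi).
Variables (eps : extform A) (feps : is_form 2 eps).
Variables (delta : R) (hdelta : 0 < delta) (epst : R -> extform A).
Arguments eps : clear implicits.
Arguments epst : clear implicits.
Hypothesis hform : forall t, `|t| < delta -> is_form 2 (epst t).
Hypothesis hgraph : forall t, `|t| < delta -> forall x,
  form_graph K (epst t) x =
    afib (Phi t) x @` form_graph K eps (abase_inv (Phi t) x).

Lemma sec_through_sfiber x (v : sfiber A x) :
  exists2 a : sec E, sec_in A a & pr A K (a x) = v.
Proof.
have [a [sa aA ax]] := subbundle_sec_through (subvsP v).
by exists a => //; rewrite ax (pr_vsval hAK).
Qed.

Lemma form2_eq (w1 w2 : extform A) x : is_form 2 w1 -> is_form 2 w2 ->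
  (forall u v : E x, u \in A x -> v \in A x -> ev w1 u v = ev w2 u v) ->
  w1 x = w2 x.
Proof.
move=> f1 f2 h; apply/funext => s.
have [|s2] := eqVneq (size s) 2; last by rewrite !form2_degree.
case: s => [|u [|v [|? ?]]] // _; rewrite !(evE hAK); apply: h; exact: subvsP.
Qed.

(** The graph of [w1] has an element over every vector of [A x]; if it also lies in the graph of
    [w2], its pairings with [A x] compute both forms. *)
Lemma graph_inj (w1 w2 : extform A) x : is_form 2 w1 -> is_form 2 w2 ->
  (forall e, form_graph K w1 x e -> form_graph K w2 x e) -> w1 x = w2 x.
Proof.
move=> f1 f2 h; apply: form2_eq => // u v uA vA.
have [e ge <-] := graph_over lagA lagK hAK f1 uA.
rewrite !(ev_pAl hAK) -((form_graphP lagA hAK _ _).1 ge)//.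
by rewrite -((form_graphP lagA hAK _ _).1 (h e ge)).
Qed.

Lemma epst0 : epst 0 = eps.
Proof.
have h0 : `|0 : R| < delta by rewrite normr0.
apply/functional_extensionality_dep => x.
apply/esym; apply: graph_inj => //; first exact: hform.
move=> e ge; have [u [su ux gu]] := graph_section lagA lagK hAK feps ge.
have := push_graph hgraph x h0 gu.
by rewrite (flow0 hPhi su) ux.
Qed.

Lemma epst_solution : is_solution K S xi eps [set t | `|t| < delta] epst.
Proof.
have oJ := @open_time R delta.
have nJ (t : R) : `|t| < delta -> \forall r \near t, `|r| < delta.
  by move=> ht; apply: open_nbhs_nbhs; split; [exact: oJ|].
split=> [t ht| l hl | | t ht x s].
- exact: hform.
- apply: fam_at_smooth_family_in => t x /= ht _.
  have nJx : \forall p \near (t, x), `|p.1| < delta.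
    exact: (@cvg_fst _ _ (nbhs t) (nbhs x) _ _ (nJ t ht)).
  have [l2|l2] := eqVneq (size l) 2; last first.
    apply: smooth_fam_at_ext (@smooth_fam_at_cst _ _ 0 t x).
    near=> p; have hp : `|p.1| < delta by near: p.
    by rewrite (form2_degree (hform hp))// size_map.
  case: l l2 hl => [|a [|c [|? ?]]] // _ hl.
  have ha := sec_in_incl (hl 0%N isT); have hc := sec_in_incl (hl 1%N isT).
  apply: smooth_fam_at_ext
    (epst_smooth lagA lagK hAK hPhi feps hform hgraph ha hc ht).
  by near=> p; rewrite [in RHS]/= [RHS](evE hAK).
- exact: epst0.
- have [|s2] := eqVneq (size s) 2; last first.
    rewrite (evolution_rhs_degree (hform ht) hxi hS s2); have nt := nJ t ht.
    apply: (near_eq_is_derive _ (is_derive_cst (0 : R) t (1 : R))).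
    near=> r; have hr : `|r| < delta by near: r.
    by rewrite (form2_degree (hform hr)).
  case: s => [|u [|v [|? ?]]] // _.
  have [a ha <-] := sec_through_sfiber u; have [c hc <-] := sec_through_sfiber v.
  exact: (epst_derive lagA lagK hAK invA hS hxi hPhi feps hform hgraph x ha hc ht).
Unshelve. all: by end_near. Qed.

End Solution.

(** * Uniqueness *)

Section LinearOde.
Context {R : realType}.

Lemma linear_ode_zero n (H : 'I_n -> R -> R) (C : 'I_n -> 'I_n -> R -> R)
    (B r t0 : R) :
  (forall t, `|t - t0| < r -> forall i,
     is_derive t 1 (H i) (\sum_j C i j t * H j t)) ->
  (forall t i j, `|t - t0| < r -> `|C i j t| <= B) ->
  forall t t', `|t - t0| < r -> `|t' - t0| < r ->
  (forall i, H i t = 0) -> forall i, H i t' = 0.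
Proof.
move=> dH CB t t' ht ht' H0.
(* Gronwall: [e] satisfies [`|e'| <= L * e]. *)
pose e s := \sum_i H i s ^+ 2.
pose e' s := \sum_i 2 * H i s * \sum_j C i j s * H j s.
(* From 2 |H_i| |C_ij| |H_j| <= B (H_i^2 + H_j^2): the sum over [i] and [j] counts each square 2n
   times. *)
pose L := 2 * n%:R * B.
have de s : `|s - t0| < r -> is_derive s 1 e (e' s).
  move=> hs; rewrite /e (_ : (fun s => _) = \sum_(i < n) (H i * H i)); last first.
    by apply/funext => z; rewrite fct_sumE.
  apply: is_derive_sum => i; apply: (is_derive_eq (is_deriveM (dH s hs i) (dH s hs i))).
  by rewrite /GRing.scale /=; ring.
have eL s : `|s - t0| < r -> `|e' s| <= L * e s.
  move=> hs; apply: (le_trans (ler_norm_sum _ _ _)).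
  have -> : L * e s = \sum_(i < n) \sum_(j < n) B * (H i s ^+ 2 + H j s ^+ 2).
    rewrite (eq_bigr (fun i => n%:R * (B * H i s ^+ 2) + B * e s)); last first.
      move=> i _; under eq_bigr do rewrite mulrDr.
      by rewrite big_split /= sumr_const card_ord -[_ * _ *+ n]mulr_natl /e mulr_sumr.
    rewrite big_split /= -!mulr_sumr sumr_const card_ord -[e s *+ n]mulr_natl -/(e s).
    by rewrite /L; ring.
  apply: ler_sum => i _; rewrite mulr_sumr; apply: (le_trans (ler_norm_sum _ _ _)).
  apply: ler_sum => j _; rewrite !normrM normr_nat.
  have c := CB s i j hs.
  have -> : 2 * `|H i s| * (`|C i j s| * `|H j s|) =
    `|C i j s| * (2 * `|H i s| * `|H j s|) by ring.
  apply: ler_pM => //.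
  rewrite -(real_normK (num_real (H i s))) -(real_normK (num_real (H j s))).
  have := sqr_ge0 (`|H i s| - `|H j s|); rewrite sqrrB => h; nra.
have e0 : e t = 0 by rewrite /e big1// => i _; rewrite H0 expr0n.
have ez s : e s <= 0 -> forall i, H i s = 0.
  move=> es i; apply/eqP; rewrite -sqrf_eq0 eq_le sqr_ge0 andbT.
  apply: le_trans es; rewrite /e (bigD1 i)//= lerDl sumr_ge0// => j _.
  exact: sqr_ge0.
have dg (a : R) s : `|s - t0| < r ->
    is_derive s 1 (fun s => e s * expR (a * s)) ((e' s + a * e s) * expR (a * s)).
  move=> hs; have dl : is_derive s 1 (fun s : R => a * s) a.
    have := is_deriveZ a (is_derive_id s (1 : R)).
    by move/is_derive_eq; apply; rewrite /GRing.scale /= mulr1.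
  have dx := is_derive1_comp (is_derive_expR (a * s)) dl.
  apply: (is_derive_eq (is_deriveM (de s hs) dx)).
  by rewrite /GRing.scale /=; ring.
have inr u v s : `|u - t0| < r -> `|v - t0| < r -> u <= s <= v -> `|s - t0| < r.
  rewrite !ltr_norml => /andP[a b] /andP[c d] /andP[us sv]; apply/andP; split; lra.
have cont (a : R) u v : `|u - t0| < r -> `|v - t0| < r ->
    {within `[u, v], continuous (fun s => e s * expR (a * s))}.
  move=> hu hv; apply: derivable_within_continuous => s; rewrite in_itv /= => suv.
  by have [] := dg a s (inr u v s hu hv suv).
have ino u v s : s \in `]u, v[ -> u <= s <= v.
  by rewrite in_itv /= => /andP[/ltW -> /ltW ->].
(* The weight exp(-L s) makes its product with [e] nonincreasing, which serves forwards in time;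
   exp(L s) makes it nondecreasing, which serves backwards. *)
apply: ez; rewrite -(pmulr_lle0 _ (expR_gt0 ((if t <= t' then - L else L) * t'))).
case: ifPn => [tt|]; last rewrite -ltNge => /ltW tt.
- have := @ler0_derive1_nincr R (fun s => e s * expR (- L * s)) t t' _ _
    (cont _ _ _ ht ht') t t' (lexx _) tt (lexx _).
  rewrite e0 mul0r mulrC; apply=> s /ino hs; have hs' := inr _ _ _ ht ht' hs.
    by have [] := dg (- L) s hs'.
  rewrite derive1E; have [_ ->] := dg (- L) s hs'.
  rewrite pmulr_lle0 ?expR_gt0// mulNr subr_le0.
  exact: le_trans (ler_norm _) (eL s hs').
- have := @ger0_derive1_ndecr R (fun s => e s * expR (L * s)) t' t _ _
    (cont _ _ _ ht' ht) t' t (lexx _) tt (lexx _).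
  rewrite e0 mul0r mulrC; apply=> s /ino hs; have hs' := inr _ _ _ ht' ht hs.
    by have [] := dg L s hs'.
  rewrite derive1E; have [_ ->] := dg L s hs'.
  rewrite pmulr_lge0 ?expR_gt0// -lerBlDr sub0r.
  by have := eL s hs'; rewrite ler_norml => /andP[].
Qed.

(** The times where [P] holds form an open subset of a connected interval, and so does their
    complement. This extends a conclusion reached on short intervals, where one frame is
    available. *)
Lemma interval_locally_constant (P : R -> Prop) (delta : R) :
  (forall t, `|t| < delta -> \forall s \near t, `|s| < delta -> (P s <-> P t)) ->
  forall t t', `|t| < delta -> `|t'| < delta -> P t -> P t'.
Proof.
move=> loc t t' ht ht' Pt; pose J := [set t : R | `|t| < delta].
have cJ : connected J.
  apply/connected_intervalP; rewrite (_ : J = [set` `]- delta, delta[]).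
    exact: interval_is_interval.
  by apply/seteqP; split => s; rewrite /J /= in_itv /= ltr_norml.
have oJ : open J.
  rewrite (_ : J = ball (0 : R) delta); first exact: ball_open.
  by apply/seteqP; split => s; rewrite -ball_normE /= sub0r normrN.
have op (Q : R -> Prop) : (forall t, `|t| < delta ->
    \forall s \near t, `|s| < delta -> (Q s <-> Q t)) -> open (J `&` Q).
  move=> lQ; rewrite openE => s [hs Qs].
  have ns : \forall r \near s, J r by apply: open_nbhs_nbhs; split.
  rewrite /interior; have lq := lQ s hs; near=> r.
  have Jr : J r by near: r.
  split => //; have := near lq r; move=> /(_ _ Jr) h.
  by apply/(h _).
suff E : J `&` P = J by have [] : (J `&` P) t' by rewrite E.
apply: cJ; first by exists t.
  by exists (J `&` P); [exact: op|rewrite setIA setIid].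
exists (~` (J `&` ~` P)).
  apply: open_closedC; apply: op => s hs; have := loc s hs.
  by apply: filterS => r h hr; have {}h := h hr; split => n1 n2; apply: n1; apply/h.
apply/seteqP; split => s [hs Qs]; split => //; first by move=> [_]; apply.
by apply: contrapT => nP; apply: Qs.
Unshelve. all: by end_near. Qed.

End LinearOde.

(** * The defect of a transported section from lying in the graph of a solution *)

Section Uniqueness.
Context {R : realType} {M : smooth_manifold R} {E : courant M}.
Context {A K : subbundle E}.
Hypotheses (lagA : is_lagrangian A) (lagK : is_lagrangian K).
Hypothesis (hAK : is_complement A K).
Local Notation pA := (@pA R M E A K _).
Local Notation ev := (@ev R M E A K).
Hypothesis invA : is_involutive A.
Context {S : extform A -> extform A -> extform A}.
Hypothesis hS : is_schouten K S.
Variables (xi : sec (sfiber K)) (hxi : smooth_ssec xi).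
Let xi' := incl_sec xi.
Variables (Phi : R -> automorphism E) (hPhi : is_flow_of xi' Phi).
Variables (eps : extform A) (delta : R) (w : R -> extform A).
Arguments eps : clear implicits.
Arguments w : clear implicits.
Hypothesis hw : is_solution K S xi eps [set t | `|t| < delta] w.
Variables (u : sec E) (su : smooth_sec u).
Let U t := push (Phi t) u.
Let sU t : smooth_sec (U t). Proof. exact: push_smooth. Qed.

Let fw t : `|t| < delta -> is_form 2 (w t).
Proof. by move=> ht; have [H _ _ _] := hw; exact: H. Qed.

Lemma solution_smooth a c t x : sec_in A a -> sec_in A c -> `|t| < delta ->
  smooth_fam_at (fun t x => ev (w t) (a x) (c x)) t x.
Proof.
move=> [sa mA] [sc mC] ht; have [_ H _ _] := hw.
have := H [:: (fun x => pr A K (a x)); (fun x => pr A K (c x))].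
move=> /(_ _)/(smooth_family_in_fam_at (@open_time R delta) openT) h.
apply: h => //; move=> [|[|i]] //= _; rewrite /smooth_ssec (incl_sec_pr hAK)//.
Qed.

(* the defect of [U t x] from belonging to the graph of [w t] *)
Definition defect t x (b : E x) : R := cpair (U t x) b - ev (w t) (U t x) b.

Lemma defect_smooth b t x : sec_in A b -> `|t| < delta ->
  smooth_fam_at (fun t x => defect t (b x)) t x.
Proof.
move=> hb ht; have [n [q [k [th D]]]] := exists_dual_frame lagA lagK hAK x.
have hq l : sec_in A (q l) by split; [exact: df_smoothA D l|exact: df_memA D l].
have sUk l : smooth_fam_at (fun r y => cpair (U r y) (k l y)) t x.
  apply: (pair_smooth_at (s1 := U) (s2 := fun=> k l)).
    exact: (push_smooth_at hPhi t su).
  exact: smooth_sec_at_const (df_smoothK D l).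
have H : smooth_fam_at (fun r y => cpair (U r y) (b y) + - ((th y)^-1 *
    \sum_l cpair (U r y) (k l y) * ev (w r) (q l y) (b y))) t x.
  apply: smooth_fam_atD.
    apply: (pair_smooth_at (s1 := U) (s2 := fun=> b)).
      exact: (push_smooth_at hPhi t su).
    exact: smooth_sec_at_const hb.1.
  apply: smooth_fam_atN; apply: smooth_fam_atM.
    apply: smooth_fam_atV; first exact: df_neq0 D.
    exact: smooth_fam_at_const (df_smooth D).
  apply: smooth_fam_at_sum => l _; apply: smooth_fam_atM => //.
  exact: (solution_smooth (hq l) hb ht).
apply: smooth_fam_at_ext H.
have nz := near_neq0 t (df_smooth D) (df_neq0 D).
have nt : nbhs t [set r : R | `|r| < delta].
  by apply: open_nbhs_nbhs; split; [exact: open_time|].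
have nJ : \forall p \near (t, x), `|p.1| < delta.
  exact: (@cvg_fst _ _ (nbhs t) (nbhs x) _ _ nt).
near=> p; have pz : th p.2 != 0 by near: p.
have pJ : `|p.1| < delta by near: p.
congr (_ - _); apply: (mulfI pz); rewrite mulVKf//.
rewrite -(ev_pAl hAK) -(evZl (fw pJ)) (df_decompA D) ?pA_mem// (ev_suml (fw pJ)).
apply: eq_bigr => l _; rewrite (evZl (fw pJ)) (pair_pA lagK hAK)//.
exact: df_memK D _ _.
Unshelve. all: by end_near. Qed.

Section FixedTime.
Variables (t : R) (ht : `|t| < delta).
Variables (b kb : sec E) (hb : sec_in A b) (hkb : sec_in K kb).
Hypothesis kbE : forall y v, v \in A y -> cpair (kb y) v = ev (w t) (b y) v.
Let eb y := b y + kb y.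
Let seb : smooth_sec eb. Proof. exact: smooth_secD hb.1 hkb.1. Qed.

(** Skew symmetry of [w t] turns the term in [ev] into a pairing with [kb]. The defect is thereby a
    pairing of two sections, to which [courant_metric] applies. *)
Lemma defect_pair y : defect t (b y) = cpair (U t y) (eb y).
Proof.
rewrite /defect /eb pairDr; congr (_ + _).
rewrite (ev_skew (fw ht)) opprK -(ev_pAr hAK) -kbE ?pA_mem// pair_sym.
by rewrite (pair_pA lagK hAK _ (hkb.2 y)).
Qed.

(* With [et] the element of the graph over [pA (U t x)], the time derivative of
   the defect is that of [cpair (U t) eb], with [U t] replaced by [et] in the
   term containing the derivative of [w]. *)
Lemma defect_time_derive x ku : ku \in K x ->
  (forall v, v \in A x -> cpair ku v = ev (w t) (U t x) v) ->
  is_derive t 1 (fun r => defect r (b x))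
    (cpair (bracket xi' (U t) x) (eb x) +
     cpair (pA (U t x) + ku) (bracket xi' eb x)).
Proof.
move=> kuK kuE; have fwt := fw ht.
have [n [q [k [th D]]]] := exists_dual_frame lagA lagK hAK x.
have th0 := df_neq0 D.
have hq l : sec_in A (q l) by split; [exact: df_smoothA D l|exact: df_memA D l].
have kqex l : exists kq, sec_in K kq /\
    forall y v, v \in A y -> cpair (kq y) v = ev (w t) (q l y) v.
  by have [kq h1 h2] := form_section lagA lagK hAK fwt (hq l); exists kq.
have [kq kqP] := choice kqex.
have hkq l : sec_in K (kq l) := (kqP l).1.
pose el l y := q l y + kq l y.
pose d l := - cpair (el l x) (bracket xi' eb x).
have dq l : is_derive t 1 (fun r => ev (w r) (q l x) (b x)) (d l).
  have [_ _ _ H] := hw.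
  have := H t ht x [:: pr A K (q l x); pr A K (b x)].
  rewrite (evolution_rhsE lagA lagK hAK fwt hxi (hq l) hb (hkq l) hkb
    (kqP l).2 kbE hS invA).
  have sel : smooth_sec (el l) := smooth_secD (hq l).1 (hkq l).1.
  (* The graph of [w t] is isotropic, so the pairing of [el l] and [eb] vanishes identically, and
     the metric axiom moves the bracket from [el l] to [eb]. *)
  have := courant_metric (hxi : smooth_sec xi') sel seb x.
  have -> : (fun y => cpair (el l y) (eb y)) = fun=> 0.
    apply/funext => y; rewrite /el /eb pairDl !pairDr.
    rewrite (lag_pair0 lagA ((hq l).2 y) (hb.2 y)).
    rewrite (lag_pair0 lagK ((hkq l).2 y) (hkb.2 y)) (pair_sym (q l y)).
    rewrite kbE ?(kqP l).2 ?hb.2//; last exact: (hq l).2.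
    by rewrite (ev_skew fwt (b y)); ring.
  rewrite anchor_cst => /esym/eqP; rewrite addr_eq0 => /eqP e.
  by rewrite -/(el l) -/eb e /d.
have ru v := is_derive_push_pair hPhi t v su.
have nJ : \forall r \near t, `|r| < delta.
  by apply: open_nbhs_nbhs; split; [exact: open_time|].
have dec r z : `|r| < delta -> ev (w r) z (b x) =
    (th x)^-1 * \sum_l cpair z (k l x) * ev (w r) (q l x) (b x).
  move=> hr; apply: (mulfI th0); rewrite mulVKf//.
  rewrite -(ev_pAl hAK) -(evZl (fw hr)) (df_decompA D) ?pA_mem// (ev_suml (fw hr)).
  apply: eq_bigr => l _; rewrite (evZl (fw hr)) (pair_pA lagK hAK)//.
  exact: df_memK D _ _.
have d1 : is_derive t 1 (\sum_(l < n) (fun r =>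
      cpair (U r x) (k l x) * ev (w r) (q l x) (b x)))
    (\sum_l (cpair (U t x) (k l x) * d l + ev (w t) (q l x) (b x) *
       cpair (bracket xi' (U t) x) (k l x))).
  by apply: is_derive_sum => l; exact: (is_deriveM (ru _ _) (dq l)).
have d2 := is_deriveB (ru x (b x)) (is_deriveZ (th x)^-1 d1).
apply: (near_eq_is_derive _ (is_derive_eq d2 _)).
  near=> r; have hr : `|r| < delta by near: r.
  by rewrite /defect dec// fctE /= fct_sumE.
have S1 : \sum_l ev (w t) (q l x) (b x) * cpair (bracket xi' (U t) x) (k l x) =
    - (th x * cpair (bracket xi' (U t) x) (kb x)).
  rewrite -mulrN -(pair_pA lagK hAK _ (hkb.2 x)) (pair_sym _ (kb x)) kbE ?pA_mem//.
  rewrite (ev_pAr hAK) -(ev_skew fwt) dec// mulVKf//.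
  by apply: eq_bigr => l _; rewrite mulrC.
(* The [el l] recombine, up to [th], to the graph element over the [A]-part of [U t x]. *)
have S2 : \sum_l cpair (U t x) (k l x) *: el l x = th x *: (pA (U t x) + ku).
  rewrite /el; under eq_bigr do rewrite scalerDr.
  rewrite big_split /= scalerDr; congr (_ + _).
    rewrite (df_decompA D) ?pA_mem//; apply: eq_bigr => l _.
    by rewrite (pair_pA lagK hAK)//; exact: df_memK D _ _.
  apply/eqP; rewrite -subr_eq0; apply/eqP; apply: (complement_pair0 lagA hAK).
    rewrite memvB ?memvZ// memv_suml// => l _; rewrite memvZ//; exact: (hkq l).2.
  move=> v vA; rewrite pairDl pairNl pairZl kuE// pair_suml.
  rewrite -(ev_pAl hAK) -(evZl fwt) (df_decompA D) ?pA_mem// (ev_suml fwt).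
  rewrite -sumrB big1// => l _; rewrite pairZl (kqP l).2// (evZl fwt).
  by rewrite (pair_pA lagK hAK) ?subrr//; exact: df_memK D _ _.
rewrite big_split /= S1.
have -> : \sum_l cpair (U t x) (k l x) * d l =
    - (th x * cpair (pA (U t x) + ku) (bracket xi' eb x)).
  rewrite -pairZl -S2 pair_suml -sumrN; apply: eq_bigr => l _.
  by rewrite pairZl /d mulrN.
rewrite /GRing.scale /= -opprD -mulrDr mulrN mulKf// opprK /eb pairDr.
by ring.
Unshelve. all: by end_near. Qed.

End FixedTime.
End Uniqueness.

Section DefectCurve.
Context {R : realType} {M : smooth_manifold R} {E : courant M}.
Context {A K : subbundle E}.
Hypotheses (lagA : is_lagrangian A) (lagK : is_lagrangian K).
Hypothesis (hAK : is_complement A K).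
Local Notation pA := (@pA R M E A K _).
Local Notation pK := (@pK R M E A K _).
Local Notation ev := (@ev R M E A K).
Hypothesis invA : is_involutive A.
Context {S : extform A -> extform A -> extform A}.
Hypothesis hS : is_schouten K S.
Variables (xi : sec (sfiber K)) (hxi : smooth_ssec xi).
Let xi' := incl_sec xi.
Variables (Phi : R -> automorphism E) (hPhi : is_flow_of xi' Phi).
Variables (eps : extform A) (delta : R) (w : R -> extform A).
Arguments eps : clear implicits.
Arguments w : clear implicits.
Hypothesis hw : is_solution K S xi eps [set t | `|t| < delta] w.
Variables (u : sec E) (su : smooth_sec u).
Let U t := push (Phi t) u.
Let sU t : smooth_sec (U t). Proof. exact: push_smooth. Qed.

Let fw t : `|t| < delta -> is_form 2 (w t).
Proof. by move=> ht; have [H _ _ _] := hw; exact: H. Qed.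

Local Notation defect := (@defect R M E A K Phi w u).
Variables (y0 : M).
Let c s := abase (Phi s) y0.
Let dc t (f : M -> R) : smooth f -> derivable (f \o c) t 1.
Proof. exact: (flow_curve_derivable hPhi). Qed.

Lemma defectD t x (a b : E x) : `|t| < delta ->
  defect t (a + b) = defect t a + defect t b.
Proof. by move=> ht; rewrite /defect pairDr (evDr (fw ht)); ring. Qed.

Lemma defectZ t x r (a : E x) : `|t| < delta ->
  defect t (r *: a) = r * defect t a.
Proof. by move=> ht; rewrite /defect pairZr (evZr (fw ht)); ring. Qed.

Lemma defect_sum t x n (F : 'I_n -> E x) : `|t| < delta ->
  defect t (\sum_i F i) = \sum_i defect t (F i).
Proof.
move=> ht; apply: (big_morph (defect t (x := x))); first by move=> a b; exact: defectD.
by rewrite /defect pair0r (ev0r (fw ht)) subr0.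
Qed.

Hypothesis U0 : forall s, U s (c s) != 0.

(** The base moves along minus the anchor, so the chain rule adds - rho(xi)<U,eb> = - <[xi,U],eb> -
    <U,[xi,eb]>. The first term cancels the bracket of [U] in the time derivative. What is left
    pairs [xi,eb] with the difference of the graph element and [U], a vector of [K], and so sees
    only the [A]-part of [xi,eb]. *)
Lemma defect_curve_derive t (b kb : sec E) : `|t| < delta ->
  sec_in A b -> sec_in K kb ->
  (forall y v, v \in A y -> cpair (kb y) v = ev (w t) (b y) v) ->
  is_derive t 1 (fun s => defect s (b (c s)))
    (- defect t (pA (bracket xi' (fun y => b y + kb y) (c t)))).
Proof.
move=> ht hb hkb kbE; set x := c t; pose eb y := b y + kb y.
have fwt := fw ht.
have [|ku kuK kuE] := represent lagK hAK (x := x) (h := ev (w t) (U t x)).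
  by move=> r a v; rewrite (ev_linr fwt).
have d1 := defect_time_derive lagA lagK hAK invA hS hxi hPhi hw su ht hb hkb kbE
  kuK kuE.
have seb : smooth_sec eb := smooth_secD hb.1 hkb.1.
have sdef : smooth (fun y => defect t (b y)).
  rewrite (_ : (fun y => _) = fun y => cpair (U t y) (eb y)).
    exact: pair_smooth.
  by apply/funext => y; exact: (defect_pair lagK hAK Phi hw u ht hkb kbE y).
have d2 := is_derive_flow_base hxi hPhi (U0 t) sdef.
have := is_derive_along_curve (@dc t) (defect_smooth lagA lagK hAK hPhi hw su hb ht)
  d1 d2.
move/is_derive_eq; apply.
have -> : (fun y => defect t (b y)) = fun y => cpair (U t y) (eb y).
  by apply/funext => y; exact: (defect_pair lagK hAK Phi hw u ht hkb kbE y).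
rewrite (courant_metric (hxi : smooth_sec xi') (sU t) seb x).
rewrite -/(c t) -/x -/(U t) -/eb.
set z := bracket xi' eb x.
have -> : cpair (U t x) z = cpair (pA (U t x)) z + cpair (pK (U t x)) z.
  by rewrite -pairDl (pApK hAK).
have kz k : k \in K x -> cpair k z = cpair k (pA z).
  by move=> kK; rewrite pair_sym -(pair_pA lagK hAK _ kK) pair_sym.
rewrite pairDl (kz ku kuK) (kz _ (pK_mem _)) kuE ?pA_mem//.
rewrite (pair_pK lagA hAK) ?pA_mem// /defect.
rewrite /U; ring.
Qed.

(* The defects of a local frame satisfy a linear differential equation along the
   flow line of [y0]. *)
Lemma defect_locally_zero t0 : `|t0| < delta -> \forall s \near t0,
  `|s| < delta -> ((forall v, v \in A (c s) -> defect s v = 0) <->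
                   (forall v, v \in A (c t0) -> defect t0 v = 0)).
Proof.
move=> ht0.
have [n [b [k [th D]]]] := exists_dual_frame lagA lagK hAK (c t0).
have hb l : sec_in A (b l) by split; [exact: df_smoothA D l|exact: df_memA D l].
have hk l : sec_in K (k l) by split; [exact: df_smoothK D l|exact: df_memK D l].
have sbr l : smooth_sec (bracket xi' (k l)) := bracket_smooth hxi (hk l).1.
(* Coefficients of the equation [dH], in which [kb] is chosen anew at each time. There
   [bracket_skew23] takes [kb] out of the bracket, so that it enters only through [w] and the
   coefficients are jointly smooth. *)
pose C l m r y := - ((th y)^-1 * (cpair (bracket xi' (b l) y) (k m y) -
  ev (w r) (b l y) (pA (bracket xi' (k m) y)))).
have sC l m : smooth_fam_at (C l m) t0 (c t0).
  apply: smooth_fam_atN; apply: smooth_fam_atM.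
    apply: smooth_fam_atV; first exact: df_neq0 D.
    exact: smooth_fam_at_const (df_smooth D).
  apply: smooth_fam_atD.
    apply: smooth_fam_at_const; apply: pair_smooth; last exact: (hk m).1.
    exact: bracket_smooth hxi (hb l).1.
  apply: smooth_fam_atN.
  exact: (solution_smooth hAK hw (hb l) (sec_in_pA lagA lagK hAK (sbr m)) ht0).
(* Continuity bounds each coefficient near [t0] by its absolute value there plus 1; the sum of these
   bounds serves for all of them. *)
pose Bd l m := `|C l m t0 (c t0)| + 1.
have nC : \forall s \near t0, forall l m, `|C l m s (c s)| < Bd l m.
  have Ft : Filter (nbhs t0) by exact: nbhs_filter.
  apply: (@filter_forall _ 'I_n (fun l s => forall m, `|C l m s (c s)| < Bd l m)
    (nbhs t0) Ft) => l.
  apply: (@filter_forall _ 'I_n (fun m s => `|C l m s (c s)| < Bd l m)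
    (nbhs t0) Ft) => m.
  have cc : {for t0, continuous (fun s => C l m s (c s))}.
    apply/differentiable_continuous/derivable1_diffP.
    exact: (derivable_along_curve (@dc t0) (sC l m)).
  by apply: (cvgr_norm_lt (C l m t0 (c t0)) cc); rewrite ltrDl.
have nth0 : \forall s \near t0, th (c s) != 0.
  have cc : {for t0, continuous (th \o c)}.
    apply/differentiable_continuous/derivable1_diffP.
    exact: dc (df_smooth D).
  exact: (cvgr_neq0 _ cc (df_neq0 D)).
have nJ : \forall r \near t0, `|r| < delta.
  by apply: open_nbhs_nbhs; split; [exact: open_time|].
have : \forall s \near t0, [/\ `|s| < delta, th (c s) != 0 &
    forall l m, `|C l m s (c s)| < Bd l m].
  by near=> s; split; near: s.
move=> /nbhs_ballP[r /= r0 rP].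
have inb s : `|s - t0| < r -> [/\ `|s| < delta, th (c s) != 0 &
    forall l m, `|C l m s (c s)| < Bd l m].
  by move=> hs; apply: rP; rewrite -ball_normE /= distrC.
have dec s (z : E (c s)) : `|s - t0| < r -> z \in A (c s) ->
    defect s z = (th (c s))^-1 *
      \sum_m cpair z (k m (c s)) * defect s (b m (c s)).
  move=> /inb[hs thn _] zA; apply: (mulfI thn); rewrite mulVKf// -defectZ//.
  rewrite (df_decompA D)// defect_sum//; apply: eq_bigr => m _.
  by rewrite defectZ.
have dH s : `|s - t0| < r -> forall l,
    is_derive s 1 (fun s => defect s (b l (c s)))
      (\sum_m C l m s (c s) * defect s (b m (c s))).
  move=> hsr l; have [hs thn _] := inb s hsr.
  have [kb hkb kbE] := form_section lagA lagK hAK (fw hs) (hb l).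
  apply: (is_derive_eq (defect_curve_derive hs (hb l) hkb kbE)).
  rewrite dec ?pA_mem// -mulrN -sumrN mulr_sumr; apply: eq_bigr => m _.
  rewrite (pair_pA lagK hAK _ ((hk m).2 _)).
  rewrite (bracketDr _ (hxi : smooth_sec xi') (hb l).1 hkb.1) pairDl.
  rewrite (bracket_skew23 (c s) lagK (hxi : smooth_sec xi') hkb (hk m)).
  have -> : cpair (kb (c s)) (bracket xi' (k m) (c s)) =
      ev (w s) (b l (c s)) (pA (bracket xi' (k m) (c s))).
    rewrite -kbE ?pA_mem// pair_sym -(pair_pA lagK hAK _ (hkb.2 _)).
    by rewrite pair_sym.
  by rewrite /C; ring.
have H s1 s2 : `|s1 - t0| < r -> `|s2 - t0| < r ->
    (forall v, v \in A (c s1) -> defect s1 v = 0) ->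
    (forall v, v \in A (c s2) -> defect s2 v = 0).
  move=> h1 h2 z1 v vA.
  have := linear_ode_zero (H := fun l s => defect s (b l (c s)))
    (C := fun l m s => C l m s (c s)) (B := \sum_l \sum_m Bd l m) dH _ h1 h2 _.
  move=> Z; rewrite dec// big1 ?mulr0// => m _; rewrite Z ?mulr0//.
    move=> s l q /inb[_ _ /(_ l q)/ltW] h; apply: (le_trans h).
    have Bd0 i j : 0 <= Bd i j by rewrite addr_ge0.
    rewrite (bigD1 l)//= (bigD1 q)//= -addrA lerDl addr_ge0// sumr_ge0//.
    by move=> i _; rewrite sumr_ge0.
  by move=> i; apply: z1; exact: (hb i).2.
apply/nbhs_ballP; exists r => //= s; rewrite -ball_normE /= distrC => hs _.
have h0 : `|t0 - t0| < r by rewrite subrr normr0.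
by split; exact: H.
Unshelve. all: by end_near. Qed.

End DefectCurve.

Lemma solution_unique (R : realType) (M : smooth_manifold R) (E : courant M)
    (A K : subbundle E) (lagA : is_lagrangian A) (invA : is_involutive A)
    (lagK : is_lagrangian K) (hAK : is_complement A K)
    (S : extform A -> extform A -> extform A) (hS : is_schouten K S)
    (xi : sec (sfiber K)) (hxi : smooth_ssec xi)
    (Phi : R -> automorphism E) (hPhi : is_flow_of (incl_sec xi) Phi)
    (eps : extform A) (feps : is_form 2 eps) (delta : R)
    (epst : R -> extform A)
    (hform : forall t, `|t| < delta -> is_form 2 (epst t))
    (hgraph : forall t, `|t| < delta -> forall x,
       form_graph K (epst t) x =
       afib (Phi t) x @` form_graph K eps (abase_inv (Phi t) x))
    (w : R -> extform A)
    (hw : is_solution K S xi eps [set t | `|t| < delta] w) t :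
  `|t| < delta -> w t = epst t.
Proof.
move=> ht; have [fw _ w0 _] := hw.
apply/esym/functional_extensionality_dep => x.
apply: (graph_inj lagA lagK hAK (hform t ht) (fw t ht)) => e ge.
(* The zero vector lies in every graph; a nonzero one provides the nonvanishing section along the
   flow line on which the derivative of the base flow rests. *)
have [->|e0] := eqVneq e 0.
  by apply/(form_graphP lagA hAK) => b _; rewrite pair0l (ev0l (fw t ht)).
have [u [su ue gu]] := graph_push_section lagA lagK hAK feps hgraph ht ge.
(* The starting point of the flow line that reaches [x] at time [t]. *)
pose y0 := abase_inv (Phi t) x.
have u0 : u y0 != 0.
  by apply: contraNneq e0 => z; rewrite -ue /push -/y0 z linear0.
pose c s := abase (Phi s) y0.
have U0 s : push (Phi s) u (c s) != 0.
  (* Fibres over points that are only provably equal are distinct types: the point is generalised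
     before the equation is substituted. *)
  have H z : z = y0 -> u z != 0 by move=> ->.
  have := H _ (abaseK (Phi s) y0); apply: contraNneq => z.
  by apply/eqP; apply: (bij_inj (afib_bij (Phi s) (c s))); rewrite linear0.
pose P s := forall v, v \in A (c s) -> defect Phi w (K := K) u s v = 0.
have d0 : `|0 : R| < delta by rewrite normr0 (le_lt_trans _ ht).
have P0 : P 0.
  move=> v vA; rewrite /defect (flow0 hPhi su) w0.
  by rewrite ((form_graphP lagA hAK _ _).1 (gu (c 0)))// subrr.
have Pt : P t.
  apply: (interval_locally_constant (P := P) _ d0 ht P0) => s hs.
  exact: (defect_locally_zero lagA lagK hAK invA hS hxi hPhi hw su U0 hs).
have gt : form_graph K (w t) (c t) (push (Phi t) u (c t)).
  apply/(form_graphP lagA hAK) => b bA; apply/eqP; rewrite -subr_eq0; apply/eqP.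
  exact: Pt.
have H z : z = x -> form_graph K (w t) z (push (Phi t) u z) ->
    form_graph K (w t) x (push (Phi t) u x) by move=> ->.
by rewrite -ue; apply: H gt; exact: abase_invK.
Qed.

Theorem proposition4p2 (R : realType) (M : smooth_manifold R) (E : courant M)
    (A K : subbundle E)
    (hA : is_dirac A) (hK : is_lagrangian K) (hAK : is_complement A K)
    (S : extform A -> extform A -> extform A)
    (hS : is_schouten K S)
    (xi : sec (sfiber K)) (hxi : smooth_ssec xi)
    (hxi_supp : compact (closure [set x | xi x != 0]))
    (Phi : R -> automorphism E) (hPhi : is_flow_of (incl_sec xi) Phi)
    (eps : extform A) (heps : is_maurer_cartan K S eps)
    (delta : R) (hdelta : 0 < delta)
    (epst : R -> extform A)
    (hform : forall t, `|t| < delta -> is_form 2 (epst t))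
    (hgraph : forall t, `|t| < delta -> forall x,
       form_graph K (epst t) x =
       afib (Phi t) x @` form_graph K eps (abase_inv (Phi t) x)) :
  is_solution K S xi eps [set t | `|t| < delta] epst /\
  (forall w : R -> extform A,
     is_solution K S xi eps [set t | `|t| < delta] w ->
     forall t, `|t| < delta -> w t = epst t).
Proof.
have [lagA invA] := hA; have [feps _] := heps.
split.
  exact: (epst_solution lagA hK hAK invA hS hxi hPhi feps hdelta hform hgraph).
move=> w hw t ht.
exact: (solution_unique lagA invA hK hAK hS hxi hPhi feps hform hgraph hw ht).
Qed.
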